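(* Any affine complete improper affine sphere must be an elliptic paraboloid. That is, let $\Sigma$ be a connected oriented two-manifold and $\psi\colon\Sigma\to\mathbb{R}^3$ a locally strongly convex improper affine sphere whose affine metric $g$ is a complete Riemannian metric on $\Sigma$; then $\psi$ is an elliptic paraboloid.
   Context: Let $\psi\colon\Sigma\to\mathbb{R}^3$ be an immersion of an oriented two-manifold into the affine three-space $\mathbb{R}^3$ (with standard flat connection $D$ and standard volume element $\det$), and $\xi$ a vector field along $\psi$ transversal to $\psi_*(T\Sigma)$. The Gauss–Weingarten equations are $D_X\psi_*Y=\psi_*(\nabla_XY)+g(X,Y)\xi$ and $D_X\xi=-\psi_*(SX)+\tau(X)\xi$, which define the symmetric tensor $g$, the endomorphism field $S$ and the one-form $\tau$. Only the locally strongly convex case is considered, i.e. $g$ is positive definite. There is then a unique choice of $\xi$, the affine (Blaschke) normal, with $\tau\equiv0$ and $\mathrm{vol}_g(X_1,X_2)=\det(\psi_*X_1,\psi_*X_2,\xi)$ for all vector fields $X_1,X_2$ on $\Sigma$; for this $\xi$ the metric $g$ is called the affine metric. $\psi$ is an improper affine sphere if $S=0$ for the affine normal $\xi$ (equivalently, $\xi$ is constant). It is affine complete if the affine metric $g$ is complete. An elliptic paraboloid is a surface affinely equivalent to the graph $\{(u,v,\tfrac12(u^2+v^2)) : (u,v)\in\mathbb{R}^2\}$. *)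

(* Defs.v *)
From HB Require Import structures.
From mathcomp Require Import all_boot all_order all_algebra.
From mathcomp Require Import all_classical all_reals all_analysis.

Set Implicit Arguments.
Unset Strict Implicit.
Unset Printing Implicit Defensive.

Import Order.TTheory GRing.Theory Num.Theory.
Import numFieldNormedType.Exports.

Local Open Scope classical_set_scope.
Local Open Scope ring_scope.

Section smoothness.
Context {R : realType} {V W : normedModType R}.

(* Meaningful for open U. *)
Fixpoint Ck_on (k : nat) (U : set V) (f : V -> W) : Prop :=
  if k is k'.+1 then
    (forall u, U u -> differentiable f u) /\
    (forall v : V, Ck_on k' U (fun u => 'd f u v))
  else forall u, U u -> {for u, continuous f}.

Definition smooth_on (U : set V) (f : V -> W) : Prop :=
  forall k, Ck_on k U f.

End smoothness.

(* A smooth oriented two-manifold, given by an atlas whose transition maps are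
   smooth with positive Jacobian determinant. [chart_inv c] is meaningful only on
   the open set [chart_map c @` chart_dom c], where it inverts [chart_map c]; [chart_at]
   fixes a preferred chart around each point, so the charts cover. *)
Record orientedSurface (R : realType) := OrientedSurface {
  surface_space :> topologicalType ;
  chart : Type ;
  chart_dom : chart -> set surface_space ;
  chart_map : chart -> surface_space -> 'rV[R]_2 ;
  chart_inv : chart -> 'rV[R]_2 -> surface_space ;
  chart_at : surface_space -> chart ;
  surface_hausdorff : hausdorff_space surface_space ;
  surface_second_countable : @second_countable surface_space ;
  chart_atP : forall p, chart_dom (chart_at p) p ;
  chart_dom_open : forall c, open (chart_dom c) ;
  chart_map_open : forall c, open (chart_map c @` chart_dom c) ;
  chart_mapK : forall c p, chart_dom c p -> chart_inv c (chart_map c p) = p ;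
  chart_map_continuous : forall c p, chart_dom c p -> {for p, continuous (chart_map c)} ;
  chart_inv_continuous : forall c p, chart_dom c p ->
    {for chart_map c p, continuous (chart_inv c)} ;
  transition_smooth : forall c d,
    smooth_on (chart_map c @` (chart_dom c `&` chart_dom d)) (chart_map d \o chart_inv c) ;
  transition_oriented : forall c d p, chart_dom c p -> chart_dom d p ->
    0 < \det ('J (chart_map d \o chart_inv c) (chart_map c p))
}.

Section surface.
Context {R : realType} (Sigma : orientedSurface R).

(* Every tangent space is identified with R^2: v : 'rV[R]_2 stands for the
   tangent vector at p whose components in the chart [chart_at p] are v.
   All tensors at p below refer to this same basis, which is positively
   oriented but need not depend continuously on p. *)

Definition tangent_map (W : normedModType R) (F : Sigma -> W) (p : Sigma)
    (v : 'rV[R]_2) : W :=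
  'd (F \o chart_inv (chart_at p)) (chart_map (chart_at p) p) v.

Definition smooth_map (W : normedModType R) (F : Sigma -> W) : Prop :=
  forall c : chart Sigma, smooth_on (chart_map c @` chart_dom c) (F \o chart_inv c).

Definition smooth_field_on (U : set Sigma) (X : Sigma -> 'rV[R]_2) : Prop :=
  forall c : chart Sigma, smooth_on (chart_map c @` (chart_dom c `&` U))
    (fun u => tangent_map (chart_map c) (chart_inv c u) (X (chart_inv c u))).

Definition immersion (psi : Sigma -> 'rV[R]_3) : Prop :=
  smooth_map psi /\ forall p, injective (tangent_map psi p).

Definition transversal_field (psi xi : Sigma -> 'rV[R]_3) : Prop :=
  smooth_map xi /\ forall p, ~ range (tangent_map psi p) (xi p).

Definition pushforward (psi : Sigma -> 'rV[R]_3) (X : Sigma -> 'rV[R]_2)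
    : Sigma -> 'rV[R]_3 :=
  fun p => tangent_map psi p (X p).

(* The standard flat connection of R^3 along the surface. *)
Definition flatD (X : Sigma -> 'rV[R]_2) (Z : Sigma -> 'rV[R]_3)
    : Sigma -> 'rV[R]_3 :=
  fun p => tangent_map Z p (X p).

Definition form2 (G : 'M[R]_2) (v w : 'rV[R]_2) : R := (v *m G *m w^T) 0 0.

(* X and Y range over the smooth vector fields on open subsets U of the
   surface; their values outside U are irrelevant. *)
Definition gauss_weingarten (psi xi : Sigma -> 'rV[R]_3)
    (nabla : (Sigma -> 'rV[R]_2) -> (Sigma -> 'rV[R]_2) -> Sigma -> 'rV[R]_2)
    (g S : Sigma -> 'M[R]_2) (tau : Sigma -> 'cV[R]_2) : Prop :=
  forall (U : set Sigma) (X Y : Sigma -> 'rV[R]_2), open U ->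
    smooth_field_on U X -> smooth_field_on U Y -> forall p, U p ->
    flatD X (pushforward psi Y) p =
      tangent_map psi p (nabla X Y p) + form2 (g p) (X p) (Y p) *: xi p /\
    flatD X xi p =
      - tangent_map psi p (X p *m S p) + (X p *m tau p) 0 0 *: xi p.

Definition positive_definite (g : Sigma -> 'M[R]_2) : Prop :=
  forall p, (g p)^T = g p /\ forall v, v != 0 -> 0 < form2 (g p) v v.

(* v and w are components in a positively oriented basis. *)
Definition vol_form (g : Sigma -> 'M[R]_2) (p : Sigma) (v w : 'rV[R]_2) : R :=
  Num.sqrt (\det (g p)) * \det (col_mx v w : 'M[R]_2).

Definition det3 (a b c : 'rV[R]_3) : R :=
  \det (col_mx a (col_mx b c) : 'M[R]_3).

Definition affine_normal (psi xi : Sigma -> 'rV[R]_3)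
    (g : Sigma -> 'M[R]_2) (tau : Sigma -> 'cV[R]_2) : Prop :=
  (forall p, tau p = 0) /\
  (forall p v w,
    vol_form g p v w = det3 (tangent_map psi p v) (tangent_map psi p w) (xi p)).

(* A C^1 curve on [0, 1], extended beyond the endpoints. *)
Definition C1_curve (gamma : R -> Sigma) : Prop :=
  exists U : set R, [/\ open U, `[0, 1]%classic `<=` U,
    forall t, U t -> {for t, continuous gamma} &
    forall c : chart Sigma,
      Ck_on 1 (U `&` gamma @^-1` chart_dom c : set R^o) (chart_map c \o gamma)].

Definition velocity (gamma : R -> Sigma) (t : R) : 'rV[R]_2 :=
  'd (chart_map (chart_at (gamma t)) \o gamma : R^o -> 'rV[R]_2)
    (t : R^o) (1 : R^o).

Definition curve_length (g : Sigma -> 'M[R]_2) (gamma : R -> Sigma) : R :=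
  (\int[@lebesgue_measure R]_(t in `[0%R, 1%R])
    Num.sqrt (form2 (g (gamma t)) (velocity gamma t) (velocity gamma t)))%R.

(* [piecewise_C1_length g p q l]: some piecewise C^1 curve, i.e. a finite
   concatenation of C^1 arcs, goes from p to q and has g-length l. *)
Inductive piecewise_C1_length (g : Sigma -> 'M[R]_2)
    : Sigma -> Sigma -> R -> Prop :=
| PiecewiseNil p : piecewise_C1_length g p p 0
| PiecewiseCons gamma q l : C1_curve gamma ->
    piecewise_C1_length g (gamma 1) q l ->
    piecewise_C1_length g (gamma 0) q (curve_length g gamma + l).

Definition riemannian_dist (g : Sigma -> 'M[R]_2) (p q : Sigma) : \bar R :=
  ereal_inf (EFin @` [set l | piecewise_C1_length g p q l]).

Definition complete_metric (g : Sigma -> 'M[R]_2) : Prop :=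
  forall x : nat -> Sigma,
    (forall e : R, 0 < e -> exists N : nat, forall m n : nat,
      (N <= m)%N -> (N <= n)%N -> (riemannian_dist g (x m) (x n) < e%:E)%E) ->
    exists p : Sigma, forall e : R, 0 < e -> exists N : nat, forall n : nat,
      (N <= n)%N -> (riemannian_dist g (x n) p < e%:E)%E.

Definition standard_paraboloid : set 'rV[R]_3 :=
  range (fun u : 'rV[R]_2 =>
    \row_(i < 3) [:: u 0 0; u 0 1; 2^-1 * (u 0 0 ^+ 2 + u 0 1 ^+ 2)]`_i).

(* As a parametrized surface: psi is a bijection onto an affine image of the
   standard paraboloid. *)
Definition elliptic_paraboloid (psi : Sigma -> 'rV[R]_3) : Prop :=
  injective psi /\
  exists (A : 'M[R]_3) (b : 'rV[R]_3), A \in unitmx /\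
    range psi = (fun x => x *m A + b) @` standard_paraboloid.

End surface.

(* Main.v *)
Require Import Defs.
From HB Require Import structures.
From mathcomp Require Import all_boot all_order all_algebra.
From mathcomp Require Import all_classical all_reals all_analysis.
From mathcomp Require Import ring lra.
Import Order.TTheory GRing.Theory Num.Theory.
Import numFieldNormedType.Exports.
Local Open Scope classical_set_scope.
Local Open Scope ring_scope.
Set Implicit Arguments.
Unset Strict Implicit.
Unset Printing Implicit Defensive.

(** Since S = 0 and tau = 0, the affine normal is constant, and in suitable linear
    coordinates psi is locally a graph z over (x1, x2) in its direction. With p the
    gradient of z, the affine metric is the Hessian dp . dx, of determinant 1.

    The Lewy transform Phi = x + p is a local diffeomorphism onto the plane, and
    g = det M * |dPhi|^2 where M = dx / dPhi is symmetric positive definite of trace 1,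
    so g <= |dPhi|^2. Hence Phi-lifts of segments have bounded g-length, and
    completeness extends a local section of Phi to a global one E, which is bijective
    because the surface is connected.

    In the coordinate w = Phi, the function theta = |x|^2 / 2 + x . p - z has gradient
    x and Hessian M, so its Laplacian is 1 and its second differences are bounded
    harmonic functions on the plane. By Liouville's theorem M is constant, so x is affine
    in w and z is a quadratic function of x. *)

(* Unification would otherwise try to unfold differentials. *)
#[local] Opaque diff.

(** * Differentiability and C^k functions *)

(** That the Hessian H of z has determinant 1 is the Monge-Ampere equation, and the Lewy transform
    makes it linear: H has eigenvalues l and 1/l, so those of M = (I + H)^-1, namely 1/(1 + l) and
    l/(1 + l), add up to 1.

    As M is obtained pointwise only, differences replace derivatives: the Hessian of a second
    difference of theta is a second difference of M, in which the constant trace cancels. The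
    Liouville theorem rests on a maximum principle that uses only pure second derivatives at each
    point.

    The inequality g <= |dPhi|^2 turns a sequence on a segment into a Cauchy sequence on the
    surface, but completeness then yields a limit for the Riemannian distance only. To make it a
    limit in the topology of the surface, a local bound in the opposite direction is needed: det M
    is bounded below near a point, and a bump function shows that curves joining the exterior of a
    small sheet of Phi to its centre cannot be short. *)

Lemma near_eq_continuous {T U : topologicalType} (f g : T -> U) (x : T) :
  {near x, f =1 g} -> {for x, continuous f} -> {for x, continuous g}.
Proof.
move=> fg fc; rewrite /prop_for /continuous_at -(nbhs_singleton fg).
by apply: cvg_trans fc; exact: near_eq_cvg.
Qed.

Section differential_toolkit.
Context {R : realType} {V W : normedModType R}.

Lemma is_diff_eps (f : V -> W) (L : {linear V -> W}) (x : V) : continuous L ->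
  (forall e : R, 0 < e ->
    \forall h \near (0 : V), `|f (x + h) - f x - L h| <= e * `|h|) ->
  is_diff x f L.
Proof.
move=> Lc fL.
have H : f \o shift x = cst (f x) + L +o_ 0 id.
  apply/eqaddoP => e e0; have := fL e e0; apply: filterS => h /=.
  rewrite ![in X in _ -> X]fctE /=.
  by rewrite [h + x]addrC opprD addrA.
have E := diff_unique Lc H.
apply: DiffDef => //; apply/diff_locallyP; rewrite E; split => //.
Qed.

Lemma diff_eps (f : V -> W) (x : V) : differentiable f x ->
  forall e : R, 0 < e ->
    \forall h \near (0 : V), `|f (x + h) - f x - 'd f x h| <= e * `|h|.
Proof.
move=> /diff_locally /eqaddoP fx e e0; have := fx e e0; apply: filterS => h /=.
rewrite !fctE /= [h + x]addrC opprD addrA.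
by [].
Qed.

Lemma near_eq_is_diff (f g : V -> W) (x : V) : {near x, f =1 g} ->
  differentiable f x -> is_diff x g ('d f x).
Proof.
move=> fg df; apply: is_diff_eps => [|e e0]; first exact: diff_continuous.
have gx := nbhs_singleton fg.
have : \forall h \near (0 : V), f (x + h) = g (x + h).
  by move/nbhs0P: fg.
by move=> Hf; near=> h; rewrite -(near Hf h) // -gx; near: h; exact: diff_eps.
Unshelve. all: by end_near. Qed.

Lemma near_eq_differentiable (f g : V -> W) (x : V) : {near x, f =1 g} ->
  differentiable f x -> differentiable g x.
Proof. by move=> fg /(near_eq_is_diff fg)[]. Qed.

Lemma near_eq_diff (f g : V -> W) (x v : V) : {near x, f =1 g} ->
  differentiable f x -> 'd g x v = 'd f x v.
Proof. by move=> fg /(near_eq_is_diff fg)[_ ->]. Qed.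

Lemma diff_is_derive (f : V -> W) (x v : V) : differentiable f x ->
  is_derive x v f ('d f x v).
Proof.
move=> df; apply: DeriveDef; first exact: diff_derivable.
exact: deriveE.
Qed.

Lemma continuous_epsP (f : V -> W) (x : V) : {for x, continuous f} <->
  forall e : R, 0 < e -> exists2 d : R, 0 < d &
    forall y, `|y - x| < d -> `|f y - f x| < e.
Proof.
split=> [/cvgrPdist_lt fx e e0|fx].
  have [d /= d0 Hd] := (nbhs_ballP _ _).1 (fx e e0).
  by exists d => // y yx; rewrite distrC; apply: Hd; rewrite -ball_normE /= distrC.
apply/cvgrPdist_lt => e /fx[d d0 Hd]; apply/nbhs_ballP; exists d => // y.
by rewrite -ball_normE /= distrC => /Hd; rewrite distrC.
Qed.

End differential_toolkit.

Section row_norm.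
Context {R : realType} {n : nat}.

Lemma rV_coord_le (v : 'rV[R]_n) i : `|v 0 i| <= `|v|.
Proof.
rewrite [leRHS]/Num.Def.normr/= mx_normrE.
by apply: le_trans (le_bigmax _ _ (0, i)).
Qed.

Lemma rV_norm_le (v : 'rV[R]_n) (e : R) : 0 <= e ->
  (forall i, `|v 0 i| <= e) -> `|v| <= e.
Proof.
move=> e0 ve; rewrite /Num.Def.normr/= mx_normrE (bigmax_le _ e0) //= => -[i j] _.
by rewrite ord1; exact: ve.
Qed.

Lemma rV_cvg (T : Type) (F : set_system T) (FF : Filter F)
    (f : T -> 'rV[R]_n) (l : 'rV[R]_n) :
  (forall i, (f x 0 i : R^o) @[x --> F] --> (l 0 i : R^o)) -> f @ F --> l.
Proof.
move=> fl; apply/cvgrPdist_le => e e0.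
have : \forall x \near F, forall i, `|l 0 i - f x 0 i| <= e.
  apply: filter_forall => i; have /cvgrPdist_le := fl i; exact.
apply: filterS => x xe; apply: rV_norm_le => [|i]; first exact: ltW.
by rewrite !mxE; exact: xe.
Qed.

End row_norm.

Section Ck_algebra.
Context {R : realType} {V : normedModType R}.
Implicit Types (U : set V) (k : nat).

Lemma open_near_eq {W : Type} U (f g : V -> W) u : open U -> U u ->
  (forall y, U y -> f y = g y) -> {near u, f =1 g}.
Proof.
move=> oU Uu fg; apply: filterS (open_nbhs_nbhs _) => //; last by split; [exact: oU|].
exact: fg.
Qed.

Lemma Ck_on_ext {W : normedModType R} k U (f g : V -> W) : open U ->
  (forall u, U u -> f u = g u) -> Ck_on k U f -> Ck_on k U g.
Proof.
move=> oU; elim: k f g => [|k IH] f g fg /=.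
  move=> cf u Uu; rewrite /prop_for /continuous_at -fg //.
  apply: cvg_trans (cf u Uu); apply: near_eq_cvg.
  exact: open_near_eq Uu fg.
move=> [df Cf]; split=> [u Uu|v].
  exact: near_eq_differentiable (open_near_eq oU Uu fg) (df u Uu).
apply: IH (Cf v) => u Uu; rewrite (near_eq_diff v (open_near_eq oU Uu fg)) //.
exact: df.
Qed.

Lemma Ck_on_continuous {W : normedModType R} k U (f : V -> W) u :
  Ck_on k U f -> U u -> {for u, continuous f}.
Proof.
case: k => [|k] /=; first by move=> + Uu; apply.
by move=> [+ _] Uu => /(_ u Uu); exact: differentiable_continuous.
Qed.

Lemma Ck_onS {W : normedModType R} k U (f : V -> W) :
  Ck_on k.+1 U f -> Ck_on k U f.
Proof.
elim: k f => [|k IH] f; first by move=> Cf u Uu; exact: Ck_on_continuous Cf Uu.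
by move=> [df Cf]; split=> // v; apply: IH; exact: Cf.
Qed.

Lemma Ck_on_cst {W : normedModType R} k U (a : W) : Ck_on k U (fun=> a : W).
Proof.
elim: k a => [|k IH] a /=; first by move=> u _; exact: cst_continuous.
split=> [u _|v]; first exact: differentiable_cst.
suff -> : (fun u => 'd (fun=> a) u v) = (fun=> 0 : W) by exact: IH.
by apply/funext => u; rewrite (_ : (fun=> a) = cst a) // diff_cst.
Qed.

Lemma Ck_onD {W : normedModType R} k U (f g : V -> W) : open U ->
  Ck_on k U f -> Ck_on k U g -> Ck_on k U (fun u => f u + g u).
Proof.
move=> oU; elim: k f g => [|k IH] f g /=.
  by move=> cf cg u Uu; apply: continuousD; [exact: cf|exact: cg].
move=> [df Cf] [dg Cg]; split=> [u Uu|v].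
  by apply: differentiableD; [exact: df|exact: dg].
apply: Ck_on_ext (IH _ _ (Cf v) (Cg v)) => // u Uu.
rewrite (_ : (fun u => f u + g u) = f + g) // diffD //; [exact: df|exact: dg].
Qed.

Lemma Ck_onZ {W : normedModType R} k U (a : R) (f : V -> W) : open U ->
  Ck_on k U f -> Ck_on k U (fun u => a *: f u).
Proof.
move=> oU; elim: k f => [|k IH] f /=.
  by move=> cf u Uu; apply: continuousZr; exact: cf.
move=> [df Cf]; split=> [u Uu|v].
  by apply: differentiableZ; exact: df.
apply: Ck_on_ext (IH _ (Cf v)) => // u Uu.
rewrite (_ : (fun u => a *: f u) = a \*: f) // diffZ //; exact: df.
Qed.

Lemma Ck_onM k U (f g : V -> R^o) : open U ->
  Ck_on k U f -> Ck_on k U g -> Ck_on k U (fun u => f u * g u : R^o).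
Proof.
move=> oU; elim: k f g => [|k IH] f g.
  by move=> cf cg u Uu; apply: continuousM; [exact: cf|exact: cg].
move=> Cf Cg; split=> [u Uu|v].
  by apply: differentiableM; [case: Cf => + _; apply|case: Cg => + _; apply].
have C1 := IH _ _ (Ck_onS Cf) (Cg.2 v); have C2 := IH _ _ (Ck_onS Cg) (Cf.2 v).
apply: Ck_on_ext (Ck_onD oU C1 C2) => // u Uu.
rewrite (_ : (fun u => f u * g u : R^o) = f * g) // diffM //.
  by case: Cf => + _; apply.
by case: Cg => + _; apply.
Qed.

Lemma Ck_onN {W : normedModType R} k U (f : V -> W) : open U ->
  Ck_on k U f -> Ck_on k U (fun u => - f u).
Proof.
move=> oU Cf; apply: Ck_on_ext (Ck_onZ (-1) oU Cf) => // u _.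
by rewrite scaleN1r.
Qed.

Lemma Ck_onV k U (f : V -> R^o) : open U -> (forall u, U u -> f u != 0) ->
  Ck_on k U f -> Ck_on k U (fun u => (f u)^-1 : R^o).
Proof.
move=> oU f0; elim: k => [|k IH].
  by move=> cf u Uu; apply: cvgV; [exact: f0|exact: cf].
move=> Cf; split=> [u Uu|v].
  by apply: differentiableV; [case: Cf => + _; apply|exact: f0].
(* The derivative [- df / f^2] involves the reciprocal only through its square, to which the
   induction hypothesis applies. *)
have CV := IH (Ck_onS Cf).
have C1 := Ck_onM oU (Ck_onN oU (Ck_onM oU CV CV)) (Cf.2 v).
apply: Ck_on_ext C1 => // u Uu.
have dfu : differentiable f u by case: Cf => + _; apply.
apply/esym/(etrans (congr1 (fun L : V -> R => L v) (diffV dfu (f0 u Uu)))).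
by rewrite -invfM -expr2.
Qed.

Lemma diff_coord n (f : V -> 'rV[R]_n) i u v : differentiable f u ->
  'd (fun y => f y 0 i : R^o) u v = ('d f u v) 0 i.
Proof.
move=> df.
have @L : {linear 'rV[R]_n -> R^o}.
  by exists (fun N : 'rV[R]_n => N 0 i); do 2![eexists]; do ?[constructor];
     rewrite ?mxE// => ? *; rewrite ?mxE//; move=> ?; rewrite !mxE.
have Lc : continuous L by exact: coord_continuous.
have dL : differentiable L (f u) by apply: linear_differentiable.
have -> : (fun y => f y 0 i : R^o) = L \o f by [].
rewrite diff_comp // -[LHS]/('d L (f u) ('d f u v)).
by rewrite (diff_lin _ Lc).
Qed.

Lemma differentiable_coordP n (f : V -> 'rV[R]_n) u :
  differentiable f u <-> forall i, differentiable (fun y => f y 0 i : R^o) u.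
Proof.
split=> [df i|df].
  apply: (@differentiable_comp _ _ _ _ f (fun N : 'rV[R]_n => N 0 i : R^o)) => //.
  exact: differentiable_coord.
rewrite (_ : f = \sum_(i < n) (fun y => (f y 0 i : R) *: (delta_mx 0 i : 'rV[R]_n))).
  by apply: differentiable_sum => i; apply: differentiableZl; exact: df.
apply/funext => y; rewrite fct_sumE; exact: row_sum_delta.
Qed.

Lemma Ck_on_coordP n k U (f : V -> 'rV[R]_n) : open U ->
  Ck_on k U f <-> forall i, Ck_on k U (fun u => f u 0 i : R^o).
Proof.
move=> oU; split; elim: k f => [|k IH] f.
- move=> cf i u Uu /=.
  apply: (@continuous_comp _ _ _ f (fun N : 'rV[R]_n => N 0 i : R^o)); first exact: cf.
  exact: coord_continuous.
- move=> [df Cf] i; split=> [u Uu|v].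
    by have /differentiable_coordP := df u Uu; apply.
  apply: Ck_on_ext (IH _ (Cf v) i) => // u Uu.
  by rewrite diff_coord //; exact: df.
- by move=> cf u Uu; apply: rV_cvg => i; exact: cf.
- move=> Cf; have df u : U u -> differentiable f u.
    by move=> Uu; apply/differentiable_coordP => i; case: (Cf i) => + _; apply.
  split=> // v; apply: IH => i; apply: Ck_on_ext ((Cf i).2 v) => // u Uu.
  by rewrite diff_coord //; exact: df.
Qed.

End Ck_algebra.

(** * Liouville's theorem in the plane *)

Section liouville.
Context {R : realType}.

Lemma is_derive_eps (h : R -> R) (c d : R) : is_derive c 1 h d ->
  forall e : R, 0 < e ->
    \forall k \near (0 : R), `|h (c + k) - h c - k * d| <= e * `|k|.
Proof.
move=> hd e e0; have dh : derivable h c 1 by [].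
have := @diff_eps R R^o R^o h c (proj1 (derivable1_diffP h c) dh) e e0.
apply: filterS => k; rewrite (deriv1E dh) derive1E derive_val.
by [].
Qed.

(** If [h2] were positive, then, the first derivative vanishing at the maximum [c], [h1] would be
    positive just to the right of [c], and the mean value theorem would make [h] exceed [h c]. *)
Lemma second_derivative_le0 (h h1 : R -> R) (h2 c d : R) : 0 < d ->
  (forall t : R, is_derive t 1 h (h1 t)) -> is_derive c 1 h1 h2 ->
  (forall t, `|t - c| < d -> h t <= h c) -> h2 <= 0.
Proof.
move=> d0 hh1 h1h2 hmax; rewrite leNgt; apply/negP => h20.
have h1c : h1 c = 0.
  have H : is_derive c 1 h 0.
    apply: (@derive1_at_max _ h (c - d) (c + d)); first by lra.
    - by move=> t _; case: (hh1 t).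
    - by rewrite in_itv /=; apply/andP; split; lra.
    - move=> t; rewrite in_itv /= => /andP[t1 t2]; apply: hmax.
      by rewrite ltr_norml; apply/andP; split; lra.
  by have := hh1 c; move=> [_ <-]; have [_ ->] := H.
(* Accuracy [h2 / 2] in the expansion of [h1] at [c] leaves [h1 x >= h2 / 2 * (x - c) > 0] for [x]
   close to [c] on the right. *)
have [r /= r0 hr] := is_derive_eps h1h2 (divr_gt0 h20 (ltr0Sn _ 1)).
have [k k0 /andP[kr kd]] : exists2 k, 0 < k & (k < r) && (k < d).
  have m0 : 0 < Num.min r d by rewrite lt_min r0 d0.
  exists (Num.min r d / 2); first by lra.
  by rewrite -lt_min; lra.
have [x] := @MVT R h h1 c (c + k) ltac:(lra) (fun t _ => hh1 t)
  (derivable_within_continuous (fun t _ => @ex_derive _ _ _ _ _ _ _ (hh1 t))).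
rewrite in_itv /= => /andP[cx xk] E.
have xmc : x - c < r by lra.
have xc0 : 0 < x - c by lra.
have := hr (x - c); rewrite /ball_ /= sub0r normrN (gtr0_norm xc0).
move=> /(_ xmc); rewrite addrCA subrr addr0 h1c subr0.
rewrite ler_norml => /andP[H1 _].
have : 0 < h1 x.
  have : 0 < h2 / 2 * (x - c) by rewrite mulr_gt0; lra.
  by lra.
move=> h1x; have : 0 < h (c + k) - h c.
  by rewrite E mulr_gt0 //; lra.
have := hmax (c + k); rewrite addrAC subrr add0r gtr0_norm // => /(_ kd).
by lra.
Qed.

(** At an interior maximum both pure second derivatives are nonpositive, against the strict
    inequality for their sum; so the maximum over the compact box is attained on the boundary. *)
Lemma box_max_principle (W W1 W2 W11 W22 : R -> R -> R) (r : R) : 0 < r ->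
  continuous (fun p : R * R => W p.1 p.2) ->
  (forall x y : R, is_derive x 1 (W^~ y) (W1 x y)) ->
  (forall x y : R, is_derive x 1 (W1^~ y) (W11 x y)) ->
  (forall x y : R, is_derive y 1 (W x) (W2 x y)) ->
  (forall x y : R, is_derive y 1 (W2 x) (W22 x y)) ->
  (forall x y, 0 < W11 x y + W22 x y) ->
  (forall y, -r <= y <= r -> W 0 y <= 0 /\ W r y <= 0) ->
  (forall x, 0 <= x <= r -> W x (-r) <= 0 /\ W x r <= 0) ->
  forall x y, 0 <= x <= r -> -r <= y <= r -> W x y <= 0.
Proof.
move=> r0 Wc dW1 dW11 dW2 dW22 lap bx by_ x y xr yr.
pose A := (`[0, r] `*` `[-r, r])%classic : set (R * R).
have cA : compact A by apply: compact_setX; exact: segment_compact.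
have A0 : A !=set0 by exists (x, y); split; rewrite /= in_itv.
have [[a b]] := compact_EVT_max A0 cA (continuous_subspaceT Wc).
rewrite inE => -[/=]; rewrite !in_itv /= => ar br max_ab.
have Hxy : W x y <= W a b.
  by apply: (max_ab (x, y)); rewrite inE; split; rewrite /= in_itv.
apply: (le_trans Hxy).
have [->|a0] := eqVneq a 0; first by have [] := bx b br.
have [->|ar'] := eqVneq a r; first by have [] := bx b br.
have [->|b0] := eqVneq b (-r); first by have [] := by_ a ar.
have [->|br'] := eqVneq b r; first by have [] := by_ a ar.
exfalso; case/andP: (ar) => aa ab; case/andP: (br) => ba bb.
have {}a0 : 0 < a by rewrite lt_def a0.
have {}ar' : a < r by rewrite lt_def eq_sym ar'.
have {}b0 : -r < b by rewrite lt_def b0.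
have {}br' : b < r by rewrite lt_def eq_sym br'.
have l1 : W11 a b <= 0.
  apply: (@second_derivative_le0 (W^~ b) (W1^~ b) _ a (Num.min a (r - a))) => //.
    by rewrite lt_min a0 subr_gt0.
  move=> t; rewrite lt_min !ltr_norml => /andP[/andP[t1 t2] /andP[t3 t4]].
  apply: (max_ab (t, b)); rewrite inE; split; rewrite /= in_itv //=.
  by apply/andP; split; lra.
have l2 : W22 a b <= 0.
  apply: (@second_derivative_le0 (W a) (W2 a) _ b (Num.min (b + r) (r - b))) => //.
    by rewrite lt_min; apply/andP; split; lra.
  move=> t; rewrite lt_min !ltr_norml => /andP[/andP[t1 t2] /andP[t3 t4]].
  apply: (max_ab (a, t)); rewrite inE; split; rewrite /= in_itv //=.
  by apply/andP; split; lra.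
by have := lap a b; lra.
Qed.

Lemma continuous_comp2 (f : R -> R -> R) (a b : R * R -> R) :
  continuous (fun p : R * R => f p.1 p.2) -> continuous a -> continuous b ->
  continuous (fun p => f (a p) (b p)).
Proof.
move=> fc ca cb p.
apply: (@continuous_comp _ _ _ (fun p => (a p, b p)) (fun p : R * R => f p.1 p.2)).
  exact: (cvg_pair (ca p) (cb p)).
exact: fc.
Qed.

(* On the box [0, r] x [-r, r], f x y - f (- x) y lies below the superharmonic
   barrier 2 M (y^2 - 2 x^2 + 3 r x) / r^2, which tends to 0 as r grows. *)
Lemma harmonic_reflect_le (f f1 f2 f11 f22 : R -> R -> R) (M : R) : 0 < M ->
  continuous (fun p : R * R => f p.1 p.2) ->
  (forall x y : R, is_derive x 1 (f^~ y) (f1 x y)) ->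
  (forall x y : R, is_derive x 1 (f1^~ y) (f11 x y)) ->
  (forall x y : R, is_derive y 1 (f x) (f2 x y)) ->
  (forall x y : R, is_derive y 1 (f2 x) (f22 x y)) ->
  (forall x y, f11 x y + f22 x y = 0) ->
  (forall x y, `|f x y| <= M) ->
  forall x y : R, 0 <= x -> f x y <= f (- x) y.
Proof.
move=> M0 fc d1 d11 d2 d22 lap bf x y x0.
have bnd (r : R) : 0 < r -> 0 <= x <= r -> -r <= y <= r ->
    f x y - f (- x) y <= 2 * M / r ^+ 2 * (y ^+ 2 - 2 * x ^+ 2 + 3 * r * x).
  move=> r0 xr yr; rewrite -subr_le0.
  pose c := 2 * M / r ^+ 2.
  have c0 : 0 < c by rewrite /c divr_gt0 ?exprn_gt0 // mulr_gt0.
  have cM : c * r ^+ 2 = 2 * M by rewrite /c divfK // gt_eqF // exprn_gt0.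
  have refl (h : R -> R) (a dh : R) : is_derive (- a) 1 h dh ->
      is_derive a 1 (fun t => h (- t)) (- dh).
    move=> hd; have := @is_derive1_comp R h -%R a dh (-1) hd.
    by rewrite mulrN1; apply; exact: is_deriveNid.
  have bnd2 a b : f a b - f (- a) b <= 2 * M.
    have := bf a b; have := bf (- a) b; rewrite !ler_norml.
    by move=> /andP[? ?] /andP[? ?]; lra.
  (* The barrier has Laplacian [c * (2 - 4)], and [f] and its reflection are harmonic, so the
     compared function has Laplacian [2 * c > 0]. *)
  apply: (@box_max_principle
    (fun x y => f x y - f (- x) y - c * (y ^+ 2 - 2 * x ^+ 2 + 3 * r * x))
    (fun x y => f1 x y + f1 (- x) y - c * (- 4 * x + 3 * r))
    (fun x y => f2 x y - f2 (- x) y - c * (2 * y))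
    (fun x y => f11 x y - f11 (- x) y + 4 * c)
    (fun x y => f22 x y - f22 (- x) y - 2 * c) r) => //.
  - move=> p.
    have c1 : {for p, continuous (fun p : R * R => f p.1 p.2)} by exact: fc.
    have c2 : {for p, continuous (fun p : R * R => f (- p.1) p.2)}.
      apply: (continuous_comp2 (a := fun p => - p.1)) => // q; last exact: cvg_snd.
      by apply: cvgN; exact: cvg_fst.
    apply: cvgB; first by apply: cvgB.
    have C1 : (fun p : R * R => p.1) @ p --> p.1 by exact: cvg_fst.
    have C2 : (fun p : R * R => p.2) @ p --> p.2 by exact: cvg_snd.
    apply: cvgM; first exact: cvg_cst.
    apply: cvgD; last by apply: cvgM => //; exact: cvg_cst.
    apply: cvgB; first by apply: cvgM.
    by apply: cvgM; [exact: cvg_cst|apply: cvgM].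
  - move=> a b; have := d1 a b; have := refl _ _ _ (d1 (- a) b) => H1 H2.
    by apply: is_derive_eq; rewrite /GRing.scale /=; ring.
  - move=> a b; have := d11 a b; have := refl _ _ _ (d11 (- a) b) => H1 H2.
    by apply: is_derive_eq; rewrite /GRing.scale /=; ring.
  - move=> a b; have := d2 a b; have := d2 (- a) b => H1 H2.
    by apply: is_derive_eq; rewrite /GRing.scale /=; ring.
  - move=> a b; have := d22 a b; have := d22 (- a) b => H1 H2.
    by apply: is_derive_eq; rewrite /GRing.scale /=; ring.
  - by move=> a b; have := lap a b; have := lap (- a) b; lra.
  (* On the axis [x = 0] the reflected difference vanishes and the barrier is [c * b^2 >= 0]. On the
     three other sides the polynomial is at least [r^2], so the barrier is at least [2 * M], which
     dominates the difference. *)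
  - move=> b /andP[b1 b2]; split.
      by rewrite oppr0 subrr sub0r oppr_le0 expr0n /= !mulr0 subr0 addr0 mulr_ge0 ?sqr_ge0 ?ltW.
    have : 2 * M <= c * (b ^+ 2 - 2 * r ^+ 2 + 3 * r * r).
      by rewrite -cM ler_pM2l //; nra.
    by have := bnd2 r b; lra.
  - move=> a /andP[a1 a2].
    have : 2 * M <= c * (r ^+ 2 - 2 * a ^+ 2 + 3 * r * a).
      by rewrite -cM ler_pM2l //; nra.
    have := bnd2 a r; have := bnd2 a (- r); rewrite sqrrN.
    by move=> *; split; lra.
rewrite -subr_le0 leNgt; apply/negP => pos.
set d := f x y - _ in pos.
pose K := y ^+ 2 + 3 * x + 1.
have K0 : 0 < K by rewrite /K; nra.
(* For [r > 1] the polynomial is at most [K * r], so the barrier at [(x, y)] is at most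
   [2 * M * K / r]; the last summand makes this smaller than [d], the others put the point in the
   box. *)
pose r := 1 + x + `|y| + 2 * M * K / d.
have q0 : 0 < 2 * M * K / d by rewrite !(mulr_gt0, invr_gt0).
have r1 : 1 < r by rewrite /r; have := normr_ge0 y; lra.
have yr : `|y| <= r by rewrite /r; have := normr_ge0 y; lra.
have := bnd r; rewrite -ler_norml yr x0 /= (_ : x <= r); last first.
  by rewrite /r; have := normr_ge0 y; lra.
move=> /(_ ltac:(lra) isT isT); apply/negP; rewrite -ltNge -/d.
have rd : 2 * M * K < r * d.
  rewrite -ltr_pdivrMr // /r; have := normr_ge0 y; lra.
apply: (@le_lt_trans _ _ (2 * M / r ^+ 2 * (K * r))).
  rewrite ler_pM2l; last by rewrite divr_gt0 ?exprn_gt0; lra.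
  by rewrite /K; nra.
rewrite mulrAC ltr_pdivrMr ?exprn_gt0; try lra.
by rewrite expr2; nra.
Qed.

(** The reflection inequality, applied to translates of [f] and of [- f], makes [f] symmetric about
    every vertical line; two points at the same height are exchanged by the reflection in the line
    halfway between them. *)
Lemma harmonic_bounded_cst1 (f f1 f2 f11 f22 : R -> R -> R) (M : R) :
  continuous (fun p : R * R => f p.1 p.2) ->
  (forall x y : R, is_derive x 1 (f^~ y) (f1 x y)) ->
  (forall x y : R, is_derive x 1 (f1^~ y) (f11 x y)) ->
  (forall x y : R, is_derive y 1 (f x) (f2 x y)) ->
  (forall x y : R, is_derive y 1 (f2 x) (f22 x y)) ->
  (forall x y, f11 x y + f22 x y = 0) ->
  (forall x y, `|f x y| <= M) ->
  forall x x' y, f x y = f x' y.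
Proof.
move=> fc d1 d11 d2 d22 lap bf.
have {}bf x y : `|f x y| <= `|M| + 1.
  by apply: (le_trans (bf x y)); have := ler_norm M; lra.
have M0 : 0 < `|M| + 1 by have := normr_ge0 M; lra.
suff le c x y : 0 <= x -> f (c + x) y = f (c - x) y.
  move=> x x' y; have [h|h] := leP x x'.
    have := le ((x + x') / 2) ((x' - x) / 2) y ltac:(lra).
    by rewrite -!mulrDl -mulrBl (_ : x + x' + (x' - x) = x' * 2) ?mulfK //; [|ring];
      rewrite (_ : x + x' - (x' - x) = x * 2) ?mulfK //; ring.
  have := le ((x + x') / 2) ((x - x') / 2) y ltac:(lra).
  by rewrite -!mulrDl -mulrBl (_ : x + x' + (x - x') = x * 2) ?mulfK //; [|ring];
      rewrite (_ : x + x' - (x - x') = x' * 2) ?mulfK //; ring.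
have sh (h : R -> R) (a dh : R) : is_derive (c + a) 1 h dh ->
    is_derive a 1 (fun t => h (c + t)) dh.
  move=> hd; have := @is_derive1_comp R h (fun t => c + t) a dh 1 hd.
  rewrite mulr1; apply.
  by have := @is_deriveD R R^o R^o (cst c) id a 1 0 1 _ _; rewrite add0r; apply.
have shc (h : R -> R -> R) : continuous (fun p : R * R => h p.1 p.2) ->
    continuous (fun p : R * R => h (c + p.1) p.2).
  move=> hc; apply: (continuous_comp2 (a := fun p => c + p.1)) => // q; last exact: cvg_snd.
  by apply: cvgD; [exact: cvg_cst|exact: cvg_fst].
move=> x0; apply/eqP; rewrite eq_le; apply/andP; split.
  apply: (@harmonic_reflect_le (fun x y => f (c + x) y) (fun x y => f1 (c + x) y)
    (fun x y => f2 (c + x) y) (fun x y => f11 (c + x) y) (fun x y => f22 (c + x) y)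
    (`|M| + 1)) => //.
  - exact: shc.
  - by move=> a b; apply: (sh (f^~ b)).
  - by move=> a b; apply: (sh (f1^~ b)).
rewrite -lerN2.
apply: (@harmonic_reflect_le (fun x y => - f (c + x) y) (fun x y => - f1 (c + x) y)
    (fun x y => - f2 (c + x) y) (fun x y => - f11 (c + x) y) (fun x y => - f22 (c + x) y)
    (`|M| + 1)) => //.
- by move=> p; apply: cvgN; exact: shc.
- by move=> a b; apply: is_deriveN; apply: (sh (f^~ b)).
- by move=> a b; apply: is_deriveN; apply: (sh (f1^~ b)).
- by move=> a b; have := lap (c + a) b; lra.
- by move=> a b; rewrite normrN.
Qed.

Theorem harmonic_bounded_cst (f f1 f2 f11 f22 : R -> R -> R) (M : R) :
  continuous (fun p : R * R => f p.1 p.2) ->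
  (forall x y : R, is_derive x 1 (f^~ y) (f1 x y)) ->
  (forall x y : R, is_derive x 1 (f1^~ y) (f11 x y)) ->
  (forall x y : R, is_derive y 1 (f x) (f2 x y)) ->
  (forall x y : R, is_derive y 1 (f2 x) (f22 x y)) ->
  (forall x y, f11 x y + f22 x y = 0) ->
  (forall x y, `|f x y| <= M) ->
  forall x y x' y', f x y = f x' y'.
Proof.
move=> fc d1 d11 d2 d22 lap bf x y x' y'.
rewrite (harmonic_bounded_cst1 fc d1 d11 d2 d22 lap bf x x' y).
apply: (@harmonic_bounded_cst1 (fun a b => f b a) (fun a b => f2 b a)
  (fun a b => f1 b a) (fun a b => f22 b a) (fun a b => f11 b a) M) => //.
  by apply: continuous_comp2 => // q; [exact: cvg_snd|exact: cvg_fst].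
by move=> a b; rewrite addrC.
Qed.

End liouville.

(** * Functions with bounded Hessian of trace one *)

Section line_calculus.
Context {R : realType} {V : normedModType R}.

Lemma is_derive_line {W : normedModType R} (F : V -> W) (a h : V) (t : R) :
  differentiable F (a + t *: h) ->
  is_derive t 1 (fun s : R => F (a + s *: h)) ('d F (a + t *: h) h).
Proof.
move=> dF.
have dl : is_diff (t : R^o) (fun s : R^o => a + s *: h) (fun s => s *: h).
  have := @is_diffD R R^o V (cst a) (fun s : R^o => s *: h) 0 (fun s => s *: h) t _ _.
  by rewrite add0r; apply.
have [d1 e1] := @is_diff_comp R R^o V W (fun s : R^o => a + s *: h) (fun s => s *: h)
  F ('d F (a + t *: h)) t dl (differentiableP dF).
by have := diff_is_derive (1 : R^o) d1; rewrite e1 /= scale1r.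
Qed.

Lemma mvt_line (F : V -> R^o) (a h : V) :
  (forall t : R, 0 <= t <= 1 -> differentiable F (a + t *: h)) ->
  exists2 t : R, 0 <= t <= 1 & F (a + h) - F a = 'd F (a + t *: h) h.
Proof.
move=> dF.
have D (t : R) : 0 <= t <= 1 -> is_derive t 1 (fun s : R => F (a + s *: h)) ('d F (a + t *: h) h).
  by move=> /dF; exact: is_derive_line.
have [||t] := @MVT_segment R (fun s => F (a + s *: h)) (fun t => 'd F (a + t *: h) h) 0 1 ler01.
- by move=> t; rewrite in_itv /= => /andP[t0 t1]; apply: D; rewrite !ltW.
- apply: derivable_within_continuous => t; rewrite in_itv /= => /D dt.
  by case: dt.
rewrite in_itv /= => t01; rewrite scale1r scale0r addr0 subr0 mulr1 => E.
by exists t.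
Qed.

Lemma diff0_cst (F : V -> R^o) : (forall w, differentiable F w) ->
  (forall w v, 'd F w v = 0) -> forall w w', F w = F w'.
Proof.
move=> dF F0 w w'; have [t _] := mvt_line (F := F) (a := w') (h := w - w') (fun t _ => dF _).
by rewrite F0 (addrC w') subrK => /eqP; rewrite subr_eq0 => /eqP.
Qed.

End line_calculus.

Section row2.
Context {R : realType}.

Definition row2 (x y : R) : 'rV[R]_2 := \row_(i < 2) [:: x; y]`_i.

Lemma row2_0 x y : row2 x y 0 0 = x. Proof. by rewrite mxE. Qed.
Lemma row2_1 x y : row2 x y 0 1 = y. Proof. by rewrite mxE. Qed.

Lemma row2E (v : 'rV[R]_2) : v = row2 (v 0 0) (v 0 1).
Proof.
apply/rowP => i; rewrite mxE.
case: i => [[|[|//]] ilt] /=; congr (v _ _); exact/val_inj.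
Qed.

Lemma row2P (v w : 'rV[R]_2) : v 0 0 = w 0 0 -> v 0 1 = w 0 1 -> v = w.
Proof. by move=> h0 h1; rewrite (row2E v) (row2E w) h0 h1. Qed.

Lemma row2_decomp x y : row2 x y = x *: row2 1 0 + y *: row2 0 1.
Proof. by apply: row2P; rewrite !mxE /=; ring. Qed.

Lemma row2_linE (W : normedModType R) (L : {linear 'rV[R]_2 -> W}) v :
  L v = v 0 0 *: L (row2 1 0) + v 0 1 *: L (row2 0 1).
Proof. by rewrite {1}(row2E v) row2_decomp linearD !linearZ. Qed.

End row2.

Section rigidity.
Context {R : realType}.
Local Notation V := 'rV[R]_2.
Variables (X1 X2 theta : V -> R^o) (m11 m12 m22 : V -> R).
Hypothesis dX1 : forall w, differentiable X1 w.
Hypothesis dX2 : forall w, differentiable X2 w.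
Hypothesis dtheta : forall w, differentiable theta w.
Hypothesis thetaE : forall w v, 'd theta w v = X1 w * v 0 0 + X2 w * v 0 1.
Hypothesis X1E : forall w v, 'd X1 w v = m11 w * v 0 0 + m12 w * v 0 1.
Hypothesis X2E : forall w v, 'd X2 w v = m12 w * v 0 0 + m22 w * v 0 1.
Hypothesis m_tr : forall w, m11 w + m22 w = 1.
Hypothesis m_bnd : forall w, [/\ `|m11 w| <= 1, `|m12 w| <= 1 & `|m22 w| <= 1].

Let is_derive_shift1 (F : V -> R^o) (e : V) (x y : R) : differentiable F (row2 x y + e) ->
  is_derive x 1 (fun t : R => F (row2 t y + e)) ('d F (row2 x y + e) (row2 1 0)).
Proof.
have E t : row2 t y + e = (row2 0 y + e) + t *: row2 1 0.
  by apply: row2P; rewrite !mxE /=; ring.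
rewrite E => dF; have := is_derive_line dF.
have <- : (fun t : R => F (row2 t y + e)) =
    (fun s : R => F (row2 0 y + e + s *: row2 1 0)).
  by apply/funext => t; rewrite -E.
by [].
Qed.

Let is_derive_shift2 (F : V -> R^o) (e : V) (x y : R) : differentiable F (row2 x y + e) ->
  is_derive y 1 (fun t : R => F (row2 x t + e)) ('d F (row2 x y + e) (row2 0 1)).
Proof.
have E t : row2 x t + e = (row2 x 0 + e) + t *: row2 0 1.
  by apply: row2P; rewrite !mxE /=; ring.
rewrite E => dF; have := is_derive_line dF.
have <- : (fun t : R => F (row2 x t + e)) =
    (fun s : R => F (row2 x 0 + e + s *: row2 0 1)).
  by apply/funext => t; rewrite -E.
by [].
Qed.

(** Mixed second difference in the directions [e] and [e']. Writing [w + 0] gives all four arguments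
    the shape [w + c], to which the shifted derivative lemmas apply. *)
Let diff2 (F : V -> R) (e e' w : V) : R :=
  F (w + (e + e')) - F (w + e) - (F (w + e') - F (w + 0)).

Let continuous_row2 (F : V -> R^o) (e : V) : (forall w, differentiable F w) ->
  continuous (fun p : R * R => F (row2 p.1 p.2 + e) : R).
Proof.
move=> dF p.
apply: (@continuous_comp _ _ _ (fun p : R * R => row2 p.1 p.2 + e) F); last first.
  exact: differentiable_continuous.
apply: (@cvgD _ V); last exact: cvg_cst.
apply: rV_cvg => i; case: i => [[|[|//]] ilt] /=.
  rewrite (_ : (fun x => _) = (fun x : R * R => x.1 : R^o)); last first.
    by apply/funext => x; rewrite mxE.
  by rewrite mxE /=; exact: cvg_fst.
rewrite (_ : (fun x => _) = (fun x : R * R => x.2 : R^o)); last first.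
  by apply/funext => x; rewrite mxE.
by rewrite mxE /=; exact: cvg_snd.
Qed.

Let X_increment_le (F : V -> R^o) (a b : V -> R) (w e : V) :
  (forall w, differentiable F w) ->
  (forall w v, 'd F w v = a w * v 0 0 + b w * v 0 1) ->
  (forall w, `|a w| <= 1 /\ `|b w| <= 1) -> `|F (w + e) - F w| <= `|e 0 0| + `|e 0 1|.
Proof.
move=> dF FE ab; have [t _ ->] := mvt_line (F := F) (a := w) (h := e) (fun t _ => dF _).
rewrite FE (le_trans (ler_normD _ _)) // !normrM.
have [a1 b1] := ab (w + t *: e).
by rewrite lerD // ler_piMl.
Qed.

(** The pure second derivatives of this function of the base point are the same second differences
    of [m11] and [m22]; [m_tr] makes their sum vanish, so the function is harmonic, and Liouville's
    theorem applies once it is bounded. *)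
Let diff2_theta_cst (e e' w w' : V) : diff2 theta e e' w = diff2 theta e e' w'.
Proof.
pose f x y := diff2 theta e e' (row2 x y).
pose G (F : V -> R) (x y : R) := diff2 F e e' (row2 x y).
have dG1 (F : V -> R^o) (x y : R) : (forall w, differentiable F w) ->
    is_derive x 1 ((G F)^~ y) (G (fun w => 'd F w (row2 1 0)) x y).
  move=> dF; rewrite /G /diff2.
  have H1 := is_derive_shift1 (dF (row2 x y + (e + e'))).
  have H2 := is_derive_shift1 (dF (row2 x y + e)).
  have H3 := is_derive_shift1 (dF (row2 x y + e')).
  have H4 := is_derive_shift1 (dF (row2 x y + 0)).
  exact: (is_deriveB (is_deriveB H1 H2) (is_deriveB H3 H4)).
have dG2 (F : V -> R^o) (x y : R) : (forall w, differentiable F w) ->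
    is_derive y 1 (G F x) (G (fun w => 'd F w (row2 0 1)) x y).
  move=> dF; rewrite /G /diff2.
  have H1 := is_derive_shift2 (dF (row2 x y + (e + e'))).
  have H2 := is_derive_shift2 (dF (row2 x y + e)).
  have H3 := is_derive_shift2 (dF (row2 x y + e')).
  have H4 := is_derive_shift2 (dF (row2 x y + 0)).
  exact: (is_deriveB (is_deriveB H1 H2) (is_deriveB H3 H4)).
have GE (F H : V -> R) x y : F =1 H -> G F x y = G H x y.
  by move=> FH; rewrite /G /diff2 !FH.
have fc : continuous (fun p : R * R => f p.1 p.2).
  have C c p := @continuous_row2 theta c dtheta p.
  by move=> p; exact: (cvgB (cvgB (C _ p) (C _ p)) (cvgB (C _ p) (C _ p))).
have d1 (x y : R) : is_derive x 1 (f^~ y) (G X1 x y).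
  rewrite (GE X1 (fun w => 'd theta w (row2 1 0))); first exact: dG1.
  by move=> u; rewrite thetaE row2_0 row2_1; ring.
have d11 (x y : R) : is_derive x 1 ((G X1)^~ y) (G m11 x y).
  rewrite (GE m11 (fun w => 'd X1 w (row2 1 0))); first exact: dG1.
  by move=> u; rewrite X1E row2_0 row2_1; ring.
have d2 (x y : R) : is_derive y 1 (f x) (G X2 x y).
  rewrite (GE X2 (fun w => 'd theta w (row2 0 1))); first exact: dG2.
  by move=> u; rewrite thetaE row2_0 row2_1; ring.
have d22 (x y : R) : is_derive y 1 (G X2 x) (G m22 x y).
  rewrite (GE m22 (fun w => 'd X2 w (row2 0 1))); first exact: dG2.
  by move=> u; rewrite X2E row2_0 row2_1; ring.
have lap (x y : R) : G m11 x y + G m22 x y = 0.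
  rewrite /G /diff2.
  have := m_tr (row2 x y + (e + e')); have := m_tr (row2 x y + e).
  have := m_tr (row2 x y + e'); have := m_tr (row2 x y + 0); lra.
(* A second difference of [theta] is the increment along [e'] of its first difference along [e]; the
   mean value theorem turns it into first differences of [X1] and [X2], which [m_bnd] controls. *)
suff bnd (x y : R) : `|f x y| <= (`|e 0 0| + `|e 0 1|) * (`|e' 0 0| + `|e' 0 1|).
  have := harmonic_bounded_cst fc d1 d11 d2 d22 lap bnd (w 0 0) (w 0 1) (w' 0 0) (w' 0 1).
  by rewrite /f -!row2E.
set u := row2 x y; rewrite /f -/u /diff2.
pose g w := theta (w + e) - theta w : R^o.
have dsh (F : V -> R^o) (c : V) v : (forall w, differentiable F w) ->
    is_diff v (fun w => F (w + c)) ('d F (v + c)).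
  move=> dF.
  have dl : is_diff v (fun s : V => s + c) id.
    have := @is_diffD R V V id (cst c) id 0 v _ _.
    by rewrite addr0; apply.
  have := @is_diff_comp R V V R^o (fun s : V => s + c) id F ('d F (v + c)) v dl.
  apply; exact: differentiableP.
have dg w0 : is_diff w0 g (fun v => 'd theta (w0 + e) v - 'd theta w0 v).
  exact: (is_diffB (dsh theta e w0 dtheta) (differentiableP (dtheta w0))).
have dgE w0 v : 'd g w0 v = (X1 (w0 + e) - X1 w0) * v 0 0 + (X2 (w0 + e) - X2 w0) * v 0 1.
  have [_ ->] := dg w0.
  apply: (etrans (congr2 (fun a b : R => a - b) (thetaE (w0 + e) v) (thetaE w0 v))).
  by rewrite !mulrBl opprD addrACA.
have [t _ E] := mvt_line (F := g) (a := u) (h := e') (fun t _ => @ex_diff _ _ _ _ _ _ _ (dg _)).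
move: E; rewrite dgE; move: (u + t *: e') => p E.
have -> : theta (u + (e + e')) - theta (u + e) - (theta (u + e') - theta (u + 0)) =
    (X1 (p + e) - X1 p) * e' 0 0 + (X2 (p + e) - X2 p) * e' 0 1.
  rewrite -E /g (_ : u + e' + e = u + (e + e')); last by rewrite -addrA (addrC e').
  by rewrite (addr0 u) !opprB [X in X = _]addrACA [X in _ = X]addrACA; congr (_ + _); rewrite addrC.
rewrite (le_trans (ler_normD _ _)) // !normrM mulrDr.
apply: lerD; apply: ler_wpM2r => //.
  apply: (X_increment_le _ _ dX1 X1E) => v; by have [] := m_bnd v.
apply: (X_increment_le _ _ dX2 X2E) => v; by have [] := m_bnd v.
Qed.

(** Moving the base point of the constant second difference along [k] and differentiating at 0
    replaces [theta] by its partial derivative [F]; hence [F - F 0] is additive. *)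
Let X_increment_cst (F : V -> R^o) (k : V) w e :
  (forall w, 'd theta w k = F w) -> F (w + e) - F w = F e - F 0.
Proof.
move=> FE.
have H w0 : diff2 F e w0 0 = 0.
  rewrite /diff2 -!FE.
  have dsh c : is_derive (0 : R) 1 (fun t : R => theta (t *: k + c)) ('d theta c k).
    have := @is_derive_line R V R^o theta c k 0; rewrite scale0r addr0.
    move=> /(_ (dtheta c)).
    have -> // : (fun t : R => theta (c + t *: k)) = (fun t : R => theta (t *: k + c)).
    by apply/funext => t; rewrite addrC.
  have D : is_derive (0 : R) 1 (fun t : R => diff2 theta e w0 (t *: k))
     ('d theta (0 + (e + w0)) k - 'd theta (0 + e) k - ('d theta (0 + w0) k - 'd theta (0 + 0) k)).
    rewrite /diff2 !add0r.
    exact: (is_deriveB (is_deriveB (dsh _) (dsh _)) (is_deriveB (dsh _) (dsh _))).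
  have [_ <-] := D.
  rewrite (_ : (fun t => _) = cst (diff2 theta e w0 0)) ?derive_cst //.
  by apply/funext => t; exact: diff2_theta_cst.
have := H w; rewrite /diff2 !add0r [e + w]addrC; lra.
Qed.

Let ar (a b c d : R) : a - b = c - d -> a = c + (b - d).
Proof. by lra. Qed.

Lemma gradient_matrix_cst w : [/\ m11 w = m11 0, m12 w = m12 0 & m22 w = m22 0].
Proof.
have aux (F : V -> R^o) (k v : V) : (forall w, 'd theta w k = F w) ->
    (forall w, differentiable F w) -> 'd F w v = 'd F 0 v.
  move=> FE dF.
  have D1 := @is_derive_line R V R^o F w v 0; rewrite scale0r addr0 in D1.
  have D2 := @is_derive_line R V R^o F 0 v 0; rewrite scale0r addr0 in D2.
  have [_ e1] := D1 (dF _).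
  have [_ e2] := @is_deriveD R R^o R^o _ _ _ _ _ _ (D2 (dF _)) (is_derive_cst (F w - F 0) _ _).
  rewrite addr0 in e2; apply: (etrans (esym e1)); apply: (etrans _ e2).
  apply: (congr1 (fun h : R^o -> R^o => derive h (0 : R^o) (1 : R^o))); apply/funext => s; rewrite fctE /= add0r.
  exact: ar (X_increment_cst w (s *: v) FE).
have T1 u : 'd theta u (row2 1 0) = X1 u by rewrite thetaE row2_0 row2_1; ring.
have T2 u : 'd theta u (row2 0 1) = X2 u by rewrite thetaE row2_0 row2_1; ring.
have := etrans (esym (X1E _ _)) (etrans (aux X1 _ (row2 1 0) T1 dX1) (X1E _ _)).
have := etrans (esym (X1E _ _)) (etrans (aux X1 _ (row2 0 1) T1 dX1) (X1E _ _)).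
have := etrans (esym (X2E _ _)) (etrans (aux X2 _ (row2 0 1) T2 dX2) (X2E _ _)).
rewrite !row2_0 !row2_1 !mulr0 !mulr1 !addr0 !add0r.
by split.
Qed.

End rigidity.

(** * Inverse function theorem *)

Section inverse_function.
Context {R : realType}.
Local Notation V := 'rV[R]_2.

Lemma dist_continuous (W : normedModType R) (v : W) :
  continuous (fun u : W => `|u - v|).
Proof.
move=> u; apply/cvgrPdist_lt => e e0.
have := nbhsx_ballx u e e0; rewrite -ball_normE; apply: filterS => y /= uy.
by rewrite (le_lt_trans (ler_dist_dist _ _)) // opprB addrA subrK.
Qed.

Lemma rV_closed_ball_compact (u0 : V) (r : R) : compact [set u : V | `|u - u0| <= r].
Proof.
apply: bounded_closed_compact.
  exists (`|u0| + r); split; first exact: num_real.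
  move=> M ltM u Au /=; rewrite -(subrK u0 u) (le_trans (ler_normD _ _)) //.
  by rewrite addrC ltW // (le_lt_trans _ ltM) // lerD2l.
rewrite [X in closed X](_ : _ = (fun u : V => `|u - u0|) @^-1` [set x : R | x <= r]) //.
by apply: closed_comp; [move=> u _; exact: dist_continuous|exact: closed_le].
Qed.

(* The fixed point is a minimizer of the displacement |T u - u|. *)
Lemma contraction_closed_ball_fixpoint (T : V -> V) (u0 : V) (r : R) :
  0 <= r ->
  (forall u, `|u - u0| <= r -> `|T u - u0| <= r) ->
  (forall u u', `|u - u0| <= r -> `|u' - u0| <= r ->
    `|T u - T u'| <= 2^-1 * `|u - u'|) ->
  exists2 u, `|u - u0| <= r & T u = u.
Proof.
move=> r0 Tself Tlip.
pose A : set V := [set u | `|u - u0| <= r].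
have A0 : A !=set0 by exists u0; rewrite /A /= subrr normr0.
have Tc : {within A, continuous (fun u : V => `|T u - u|)}.
  apply/subspace_continuousP => x Ax; apply/cvgrPdist_le => e e0.
  have e2 : 0 < e / 2 by lra.
  have : \forall y \near within A (nbhs x), A y.
    by apply: withinT.
  have : \forall y \near within A (nbhs x), `|x - y| < e / 2.
    have := nbhsx_ballx x (e / 2) e2; rewrite -ball_normE => xe.
    by rewrite near_withinE; apply: filterS xe => y xy _.
  apply: filterS2 => y xy Ay.
  rewrite (le_trans (ler_dist_dist _ _)) //.
  rewrite (_ : T x - x - (T y - y) = (T x - T y) - (x - y)); last first.
    by rewrite !opprD !opprK addrACA.
  rewrite (le_trans (ler_normB _ _)) //.
  have := Tlip x y Ax Ay; move: (`|T x - T y|) (`|x - y|) xy => a b; lra.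
have [u] := EVT_min_rV A0 (@rV_closed_ball_compact u0 r) Tc.
rewrite inE => Au umin; exists u => //.
(* Minimality tested at [T u] gives [|T u - u| <= |T (T u) - T u| <= |T u - u| / 2], so the minimum
   is 0. *)
have := umin (T u); rewrite inE => /(_ (Tself u Au)) Tu.
have := Tlip (T u) u (Tself u Au) Au => Tu2.
apply/eqP; rewrite -subr_eq0 -normr_le0.
by move: Tu Tu2; move: `|T (T u) - T u| `|T u - u| => a b; lra.
Qed.

Variables (U : set V) (phi : V -> V) (u0 : V).
Hypothesis U_open : open U.
Hypothesis phi_C1 : Ck_on 1 U phi.
Hypothesis Uu0 : U u0.
Hypothesis dphi_inj : forall v, 'd phi u0 v = 0 -> v = 0.

Lemma inverse_matrix_bound : exists Li : {linear V -> V},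
  exists2 K, 0 < K & [/\ forall v, Li ('d phi u0 v) = v,
      forall w, 'd phi u0 (Li w) = w & forall w, `|Li w| <= K * `|w| ].
Proof.
pose A := lin1_mx ('d phi u0).
have AE v : v *m A = 'd phi u0 v by exact: mul_rV_lin1.
have Au : A \in unitmx.
  by rewrite -row_free_unit; apply: inj_row_free => v; rewrite AE; exact: dphi_inj.
pose Li : {linear V -> V} := mulmxr (invmx A).
have LiE w : Li w = w *m invmx A by [].
pose K : R := `|Li (row2 1 0)| + `|Li (row2 0 1)| + 1.
exists Li, K.
  by rewrite /K; have := normr_ge0 (Li (row2 1 0)); have := normr_ge0 (Li (row2 0 1)); lra.
split.
- by move=> v; rewrite -AE LiE mulmxK.
- by move=> w; rewrite -AE LiE mulmxKV.
move=> w; rewrite (row2_linE Li w).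
rewrite (le_trans (ler_normD _ _)) // !normrZ.
have h0 := rV_coord_le w 0; have h1 := rV_coord_le w 1.
have n0 := normr_ge0 (Li (row2 1 0)); have n1 := normr_ge0 (Li (row2 0 1)).
rewrite /K; move: `|Li (row2 1 0)| `|Li (row2 0 1)| `|w 0 0| `|w 0 1| `|w| (normr_ge0 w) h0 h1 n0 n1.
by move=> a b c d e *; nra.
Qed.

Lemma row2_lin_sub (L1 L2 : {linear V -> V}) (h : V) : L1 h - L2 h =
  - (h 0 0 *: (L2 (row2 1 0) - L1 (row2 1 0)) +
     h 0 1 *: (L2 (row2 0 1) - L1 (row2 0 1))).
Proof.
rewrite (row2_linE L1 h) (row2_linE L2 h) !scalerBr !opprD !opprK addrACA.
by congr (_ + _); rewrite addrC.
Qed.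

(** Continuity of the two partial derivatives at [u0] controls ['d phi x - 'd phi u0] uniformly for
    [x] near [u0]; the mean value theorem on the segment from [u'] to [u], one coordinate at a time,
    transfers this to increments. Freedom in both points is what makes the Newton map below a
    contraction. *)
Lemma strict_differentiable (e : R) : 0 < e -> exists2 r, 0 < r &
  (forall u, `|u - u0| < r -> U u) /\
  forall u u', `|u - u0| < r -> `|u' - u0| < r ->
    `|phi u - phi u' - 'd phi u0 (u - u')| <= e * `|u - u'|.
Proof.
move=> e0.
(* Each of the two basis directions contributes at most [e / 2 * |h|], because [|h 0 i| <= |h|] for
   the maximum norm. *)
have e2 : 0 < e / 2 by rewrite divr_gt0.
have H1 : \forall u \near u0, U u by apply: open_nbhs_nbhs.
have c1 := phi_C1.2 (row2 1 0) u0 Uu0; have c2 := phi_C1.2 (row2 0 1) u0 Uu0.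
move/cvgrPdist_le : c1 => /(_ (e / 2) e2) H2.
move/cvgrPdist_le : c2 => /(_ (e / 2) e2) H3.
have [r /= r0 Hr] := (nbhs_ballP _ _).1 (filterI H1 (filterI H2 H3)).
exists r => //.
have inb u : `|u - u0| < r -> ball u0 r u.
  by rewrite -ball_normE /= distrC.
split=> [u /inb /Hr[]//|u u' ur ur'].
apply: rV_norm_le => [|i]; first by rewrite mulr_ge0 // ltW.
pose h := u - u'.
have seg (t : R) : 0 <= t <= 1 -> `|u' + t *: h - u0| < r.
  move=> /andP[t0 t1].
  have -> : u' + t *: h - u0 = (1 - t) *: (u' - u0) + t *: (u - u0).
    by rewrite /h !scalerBr !scalerBl !scale1r; apply/rowP => k; rewrite !mxE; ring.
  rewrite (le_lt_trans (ler_normD _ _)) // !normrZ !ger0_norm //; last by rewrite subr_ge0.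
  by move: ur ur'; move: `|u - u0| `|u' - u0| => a b ar br; have [ab|ab] := leP a b; nra.
have dphi t : 0 <= t <= 1 -> differentiable phi (u' + t *: h).
  by move=> /seg /inb /Hr [Uu _]; exact: (phi_C1.1 _ Uu).
have [t t01] := @mvt_line R V (fun y => phi y 0 i : R^o) u' h
  (fun t t01 => (differentiable_coordP _ _).1 (dphi t t01) i).
rewrite (diff_coord i h (dphi t t01)) /h (addrC u') subrK -/h => E.
have -> : (phi u - phi u' - 'd phi u0 h) 0 i = ('d phi (u' + t *: h) h - 'd phi u0 h) 0 i.
  by rewrite !mxE E.
have := inb _ (seg t t01); move: (u' + t *: h) => x /Hr [_ [/= x1 x2]].
apply: (le_trans (rV_coord_le _ _)).
rewrite (row2_lin_sub ('d phi x) ('d phi u0) h).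
rewrite normrN (le_trans (ler_normD _ _)) // !normrZ.
have h0 := rV_coord_le h 0; have h1 := rV_coord_le h 1.
move: x1 x2 h0 h1; move: `|_ - _| `|_ - _| `|h 0 0| `|h 0 1| `|h| (normr_ge0 (h 0 0)) (normr_ge0 (h 0 1)) => a b c d f.
by move=> *; nra.
Qed.

(** Newton's map with frozen derivative, [u + Li (y - phi u)], is a contraction whose fixed points
    solve [phi u = y]. A lower Lipschitz bound for [phi] gives both injectivity and the continuity
    of [s]. *)
Lemma inverse_function_local : exists rho : R, exists r : R, exists s : V -> V,
  [/\ 0 < rho, 0 < r, forall u, `|u - u0| < rho -> U u,
    forall u u', `|u - u0| < rho -> `|u' - u0| < rho -> phi u = phi u' -> u = u' &
    forall y, `|y - phi u0| < r ->
      [/\ `|s y - u0| < rho, phi (s y) = y & {for y, continuous s}]].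
Proof.
have [Li [K K0 [LiK KLi Lib]]] := inverse_matrix_bound.
have LiB a b : Li (a - b) = Li a - Li b by exact: raddfB.
have LiN a : Li (- a) = - Li a.
  exact: raddfN.
(* As [Li] expands by at most [K], this accuracy leaves an error of at most [|u - u'| / 2] after
   applying [Li]. *)
have e0 : 0 < (2 * K)^-1 by rewrite invr_gt0 mulr_gt0.
have [rho rho0 [rhoU Hrho]] := strict_differentiable e0.
have lower u u' : `|u - u0| < rho -> `|u' - u0| < rho ->
    `|u - u'| <= 2 * K * `|phi u - phi u'|.
  move=> ur ur'.
  have H := Hrho u u' ur ur'.
  have : `|u - u'| <= K * `|'d phi u0 (u - u')| by rewrite -[X in `|X| <= _]LiK; exact: Lib.
  have : `|'d phi u0 (u - u')| <= `|phi u - phi u'| + `|phi u - phi u' - 'd phi u0 (u - u')|.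
    by rewrite -[X in `|X| <= _](subKr (phi u - phi u')) ler_normB.
  move: H; move: `|_ - _ - _| `|'d phi u0 _| `|phi u - _| `|u - u'| => a b c d H1 H2 H3.
  have : K * a <= 2^-1 * d.
    have := ler_wpM2l (ltW K0) H1.
    by rewrite mulrA invfM mulrCA mulfV ?gt_eqF // mulr1.
  by have := ler_wpM2l (ltW K0) H2; nra.
(* The Newton step from [u0] has length at most [K * r = rho / 4]; together with the contraction
   factor 1/2 this keeps the closed ball of radius [rho / 2] invariant. *)
pose r := rho / (4 * K).
have r0 : 0 < r by rewrite divr_gt0 // mulr_gt0.
have Kr : K * r = rho / 4 by rewrite /r; field; rewrite gt_eqF.
have ex y : `|y - phi u0| < r -> exists2 u, `|u - u0| < rho & phi u = y.
  move=> yr.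
  have rho2 : rho / 2 < rho by lra.
  pose T u := u + Li (y - phi u).
  have TL u u' : `|u - u0| <= rho / 2 -> `|u' - u0| <= rho / 2 ->
      `|T u - T u'| <= 2^-1 * `|u - u'|.
    move=> ur ur'.
    have -> : T u - T u' = - Li (phi u - phi u' - 'd phi u0 (u - u')).
      rewrite (LiB (phi u - phi u')) LiK /T opprD addrACA -LiB.
      have -> : y - phi u - (y - phi u') = - (phi u - phi u').
        by rewrite opprB opprB addrC addrA subrK.
      by rewrite LiN opprB.
    have := Hrho u u' (le_lt_trans ur rho2) (le_lt_trans ur' rho2) => H.
    rewrite normrN (le_trans (Lib _)) //.
    have := ler_wpM2l (ltW K0) H.
    by rewrite mulrA invfM mulrCA mulfV ?gt_eqF // mulr1.
  have [|||u ur Tu] := @contraction_closed_ball_fixpoint T u0 (rho / 2).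
  - by rewrite ltW // divr_gt0.
  - move=> u ur.
    have -> : T u - u0 = (T u - T u0) + Li (y - phi u0).
      by rewrite [T u0]/T opprD addrA subrK.
    rewrite (le_trans (ler_normD _ _)) //.
    have := TL u u0 ur; rewrite subrr normr0 => /(_ ltac:(lra)).
    have := Lib (y - phi u0).
    have : K * `|y - phi u0| <= rho / 4.
      have := ler_wpM2l (ltW K0) (ltW yr).
      by rewrite Kr.
    move: ur; move: `|T u - T u0| `|Li (y - phi u0)| (K * _) `|u - u0| => a b c d.
    by lra.
  - exact: TL.
  exists u; first exact: le_lt_trans ur rho2.
  have : Li (y - phi u) = 0 by apply: (addrI u); rewrite addr0; exact: Tu.
  move=> /(congr1 (fun z => 'd phi u0 z)); rewrite KLi linear0 => /eqP.
  by rewrite subr_eq0 => /eqP.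
pose s y := xget u0 [set u | `|u - u0| < rho /\ phi u = y].
have sP y : `|y - phi u0| < r -> `|s y - u0| < rho /\ phi (s y) = y.
  move=> /ex [u ur uy]; rewrite /s; case: xgetP => [v _ //|/(_ u)].
  by move=> H; exfalso; apply: H.
exists rho, r, s; split => //.
  move=> u u' ur ur' E; have := lower u u' ur ur'.
  by rewrite E subrr normr0 mulr0 normr_le0 subr_eq0 => /eqP.
move=> y yr; have [sy1 sy2] := sP y yr; split => //.
apply/(@continuous_epsP R _ _ s y) => e ee.
have d0 : 0 < r - `|y - phi u0| by rewrite subr_gt0.
have d1 : 0 < e / (2 * K) by rewrite divr_gt0 // mulr_gt0.
exists (Num.min (r - `|y - phi u0|) (e / (2 * K))); first by rewrite lt_min d0.
move=> z; rewrite lt_min => /andP[z1 z2].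
have zr : `|z - phi u0| < r.
  have -> : z - phi u0 = (z - y) + (y - phi u0) by rewrite addrA subrK.
  by rewrite (le_lt_trans (ler_normD _ _)) // -ltrBrDr.
have [sz1 sz2] := sP z zr.
rewrite (le_lt_trans (lower _ _ sz1 sy1)) // sy2 sz2 mulrC -ltr_pdivlMr //.
by rewrite mulr_gt0.
Qed.

End inverse_function.

(** * Charts and frames *)

Section chart_calculus.
Context {R : realType} {Sigma : orientedSurface R}.
Local Notation V := 'rV[R]_2.
Implicit Types (c d : chart Sigma) (p q : Sigma) (u v w : V).

Lemma chart_inv_near c q (N : set Sigma) : chart_dom c q -> nbhs q N ->
  \forall u \near chart_map c q, N (chart_inv c u).
Proof.
move=> cq Nq; apply: (chart_inv_continuous cq).
by rewrite /= (chart_mapK cq).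
Qed.

Lemma chart_dom_nbhs c q : chart_dom c q -> nbhs q (chart_dom c).
Proof. by move=> cq; apply: open_nbhs_nbhs; split => //; exact: chart_dom_open. Qed.

Lemma chart_imgP c u : (chart_map c @` chart_dom c) u ->
  chart_dom c (chart_inv c u) /\ chart_map c (chart_inv c u) = u.
Proof. by move=> [q cq <-]; rewrite (chart_mapK cq). Qed.

Lemma chart_img_nbhs c q : chart_dom c q ->
  \forall u \near chart_map c q, (chart_map c @` chart_dom c) u.
Proof.
by move=> cq; apply: open_nbhs_nbhs; split; [exact: chart_map_open|exists q].
Qed.

Lemma chart_image_open c (N : set Sigma) : open N ->
  open (chart_map c @` (chart_dom c `&` N)).
Proof.
move=> oN; rewrite openE => _ [q [cq Nq] <-].
have H1 := chart_img_nbhs cq.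
have H2 : \forall u \near chart_map c q, N (chart_inv c u).
  by apply: chart_inv_near => //; apply: open_nbhs_nbhs; split.
apply: filterS2 H1 H2 => u /chart_imgP [cu uE] Nu.
by exists (chart_inv c u).
Qed.

Lemma transition_differentiable c d q : chart_dom c q -> chart_dom d q ->
  differentiable (chart_map d \o chart_inv c) (chart_map c q).
Proof.
by move=> cq dq; have [+ _] := @transition_smooth R Sigma c d 1; apply; exists q.
Qed.

Lemma diff_chart_change (W : normedModType R) (F : Sigma -> W) c d q :
  chart_dom c q -> chart_dom d q ->
  differentiable (F \o chart_inv d) (chart_map d q) ->
  is_diff (chart_map c q) (F \o chart_inv c)
    (fun v => 'd (F \o chart_inv d) (chart_map d q)
      ('d (chart_map d \o chart_inv c) (chart_map c q) v)).
Proof.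
move=> cq dq dF.
have dt := transition_differentiable cq dq.
have E : (chart_map d \o chart_inv c) (chart_map c q) = chart_map d q.
  by rewrite /= (chart_mapK cq).
have dF' : is_diff ((chart_map d \o chart_inv c) (chart_map c q)) (F \o chart_inv d)
    ('d (F \o chart_inv d) (chart_map d q)).
  by rewrite E; exact: differentiableP.
have [dc ec] := is_diff_comp (differentiableP dt) dF'.
have nE : {near chart_map c q, (F \o chart_inv d) \o (chart_map d \o chart_inv c) =1
    F \o chart_inv c}.
  apply: filterS (chart_inv_near cq (chart_dom_nbhs dq)) => u du /=.
  by rewrite (chart_mapK du).
have [df ef] := near_eq_is_diff nE dc.
by apply: DiffDef; [exact: df|exact: etrans ef ec].
Qed.

Lemma chart_id_diff c q v : chart_dom c q ->
  'd (chart_map c \o chart_inv c) (chart_map c q) v = v.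
Proof.
move=> cq.
have nE : {near chart_map c q, id =1 chart_map c \o chart_inv c}.
  by apply: filterS (chart_img_nbhs cq) => u /chart_imgP[_ /= ->].
have [di ei] := @is_diff_id R V (chart_map c q).
exact: etrans (near_eq_diff v nE di) (congr1 (@^~ v) ei).
Qed.

Lemma transitionK c d q v : chart_dom c q -> chart_dom d q ->
  'd (chart_map c \o chart_inv d) (chart_map d q)
    ('d (chart_map d \o chart_inv c) (chart_map c q) v) = v.
Proof.
move=> cq dq.
have [_ e] := diff_chart_change cq dq (transition_differentiable dq cq).
exact: etrans (esym (congr1 (@^~ v) e)) (chart_id_diff v cq).
Qed.

(** The coordinate field of [c] with constant components [v], written in the basis of [chart_at q]
    in which all tensors are expressed. As that basis may jump with [q], regularity is handled
    through frames of one fixed chart. *)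
Definition frame c v q : V :=
  'd (chart_map (chart_at q) \o chart_inv c) (chart_map c q) v.

Lemma tangent_map_frame (W : normedModType R) (F : Sigma -> W) c q v :
  chart_dom c q -> differentiable (F \o chart_inv c) (chart_map c q) ->
  tangent_map F q (frame c v q) = 'd (F \o chart_inv c) (chart_map c q) v.
Proof.
move=> cq dF; have aq := chart_atP q.
have [da _] := diff_chart_change aq cq dF.
by have [_ e] := diff_chart_change cq aq da; exact: esym (congr1 (@^~ v) e).
Qed.

Lemma frame_surj c q v : chart_dom c q ->
  frame c ('d (chart_map c \o chart_inv (chart_at q)) (chart_map (chart_at q) q) v) q = v.
Proof. by move=> cq; exact: transitionK (chart_atP q) cq. Qed.

Lemma det2E (A : 'M[R]_2) : \det A = A 0 0 * A 1 1 - A 0 1 * A 1 0.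
Proof.
rewrite (expand_det_row _ 0) !big_ord_recl big_ord0 addr0 /cofactor !det_mx11 !mxE /=.
rewrite expr0 expr1 mul1r mulN1r mulrN.
by congr (_ * A _ _ - A _ _ * A _ _); exact/val_inj.
Qed.

End chart_calculus.

Section frames.
Context {R : realType} {Sigma : orientedSurface R}.
Local Notation V := 'rV[R]_2.
Implicit Types (c d : chart Sigma) (p q : Sigma) (u v w : V).

Lemma delta_row2_0 : delta_mx 0 0 = row2 1 0 :> V.
Proof. by apply: row2P; rewrite !mxE. Qed.

Lemma delta_row2_1 : delta_mx 0 1 = row2 0 1 :> V.
Proof. by apply: row2P; rewrite !mxE. Qed.

Definition transition_coef c d (i j : 'I_2) (u : V) : R^o :=
  'd (chart_map c \o chart_inv d) u (delta_mx 0 i) 0 j.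

Lemma transition_det_gt0 c d q : chart_dom c q -> chart_dom d q ->
  0 < transition_coef c d 0 0 (chart_map d q) * transition_coef c d 1 1 (chart_map d q)
    - transition_coef c d 0 1 (chart_map d q) * transition_coef c d 1 0 (chart_map d q).
Proof.
move=> cq dq; have := transition_oriented dq cq.
by rewrite /jacobian det2E !mxE.
Qed.

Lemma transition_coef_Ck c d i j k :
  Ck_on k (chart_map d @` (chart_dom d `&` chart_dom c)) (transition_coef c d i j).
Proof.
have oU : open (chart_map d @` (chart_dom d `&` chart_dom c)).
  by apply: chart_image_open; exact: chart_dom_open.
have := (@transition_smooth R Sigma d c k.+1).2 (delta_mx 0 i).
by move=> /(Ck_on_coordP _ _ oU) /(_ j).
Qed.

(** In a second chart [d] the components are [v] times the inverse of the transition matrix from [d]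
    to [c]. Cramer's formula builds them from [C^k] functions with products and one reciprocal, the
    determinant being positive by orientation. *)
Lemma frame_smooth c v : smooth_field_on (chart_dom c) (frame c v).
Proof.
move=> d k.
set U := chart_map d @` (chart_dom d `&` chart_dom c).
have oU : open U by apply: chart_image_open; exact: chart_dom_open.
have aC i j := @transition_coef_Ck c d i j k.
pose dt u : R^o := transition_coef c d 0 0 u * transition_coef c d 1 1 u -
  transition_coef c d 0 1 u * transition_coef c d 1 0 u.
have dtC : Ck_on k U dt.
  exact: Ck_onD oU (Ck_onM oU (aC _ _) (aC _ _))
    (Ck_onN oU (Ck_onM oU (aC _ _) (aC _ _))).
have dt0 u : U u -> dt u != 0.
  by move=> [q [dq cq] <-]; rewrite gt_eqF //; exact: transition_det_gt0.
have dtV := Ck_onV oU dt0 dtC.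
have cC (x : R) := @Ck_on_cst R V R^o k U x.
pose f0 u : R^o := (v 0 0 * transition_coef c d 1 1 u - v 0 1 * transition_coef c d 1 0 u) * (dt u)^-1.
pose f1 u : R^o := (v 0 1 * transition_coef c d 0 0 u - v 0 0 * transition_coef c d 0 1 u) * (dt u)^-1.
have C0 : Ck_on k U f0.
  exact: (Ck_onM oU (Ck_onD oU (Ck_onM oU (cC _) (aC _ _))
    (Ck_onN oU (Ck_onM oU (cC _) (aC _ _)))) dtV).
have C1 : Ck_on k U f1.
  exact: (Ck_onM oU (Ck_onD oU (Ck_onM oU (cC _) (aC _ _))
    (Ck_onN oU (Ck_onM oU (cC _) (aC _ _)))) dtV).
suff E u : U u -> row2 (f0 u) (f1 u) =
    tangent_map (chart_map d) (chart_inv d u) (frame c v (chart_inv d u)).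
  apply: (Ck_on_ext oU E); apply/(Ck_on_coordP _ _ oU) => i.
  case: i => [[|[|//]] ilt].
    by apply: (Ck_on_ext oU _ C0) => u Uu; rewrite !mxE.
  by apply: (Ck_on_ext oU _ C1) => u Uu; rewrite !mxE.
move=> Uu; have := dt0 u Uu; case: Uu => q [dq cq] <- dq0.
rewrite (chart_mapK dq) tangent_map_frame //; last exact: transition_differentiable.
suff H w : 'd (chart_map c \o chart_inv d) (chart_map d q) w = v ->
    row2 (f0 (chart_map d q)) (f1 (chart_map d q)) = w.
  exact: H _ (transitionK v cq dq).
move=> wE.
have lin j : v 0 j = w 0 0 * transition_coef c d 0 j (chart_map d q) +
    w 0 1 * transition_coef c d 1 j (chart_map d q).
  rewrite -[in LHS]wE (row2_linE ('d (chart_map c \o chart_inv d) (chart_map d q)) w).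
  by rewrite /transition_coef delta_row2_0 delta_row2_1 !mxE.
have e0 := lin 0; have e1 := lin 1; apply: row2P; rewrite ?row2_0 ?row2_1 /f0 /f1 e0 e1; apply: (mulIf dq0);
  rewrite divfK // /dt; ring.
Qed.

Lemma frame_det_gt0 c q : chart_dom c q ->
  0 < frame c (row2 1 0) q 0 0 * frame c (row2 0 1) q 0 1
    - frame c (row2 1 0) q 0 1 * frame c (row2 0 1) q 0 0.
Proof.
move=> cq; have := transition_det_gt0 (chart_atP q) cq.
by rewrite /transition_coef delta_row2_0 delta_row2_1.
Qed.

End frames.

(** * The structure equations in a chart; constancy of the affine normal *)

Section gauss_equation.
Context {R : realType} {Sigma : orientedSurface R}.
Local Notation V := 'rV[R]_2.
Implicit Types (c d : chart Sigma) (p q : Sigma) (u v w : V).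
Variables (psi xi : Sigma -> 'rV[R]_3)
    (nabla : (Sigma -> V) -> (Sigma -> V) -> Sigma -> V)
    (g S : Sigma -> 'M[R]_2) (tau : Sigma -> 'cV[R]_2).
Hypothesis psi_smooth : smooth_map psi.
Hypothesis xi_smooth : smooth_map xi.
Hypothesis psi_structure : gauss_weingarten psi xi nabla g S tau.

Lemma smooth_map_differentiable (W : normedModType R) (F : Sigma -> W) c q :
  smooth_map F -> chart_dom c q -> differentiable (F \o chart_inv c) (chart_map c q).
Proof. by move=> /(_ c 1%N)[+ _] cq; apply; exists q. Qed.

(** The Gauss equation for two coordinate frames. The vector [s] carries the Christoffel terms; only
    its tangency matters, because comparing components later eliminates it. *)
Lemma gauss_chart c q v w : chart_dom c q -> exists s,
  'd (fun u => 'd (psi \o chart_inv c) u w) (chart_map c q) v =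
  'd (psi \o chart_inv c) (chart_map c q) s +
    form2 (g q) (frame c v q) (frame c w q) *: xi q.
Proof.
move=> cq.
have [+ _] := psi_structure (chart_dom_open c) (@frame_smooth _ _ c v) (@frame_smooth _ _ c w) cq.
set n := nabla _ _ q => E.
exists ('d (chart_map c \o chart_inv (chart_at q)) (chart_map (chart_at q) q) n).
have E1 := etrans (congr1 (tangent_map psi q) (esym (frame_surj n cq)))
  (tangent_map_frame _ cq (smooth_map_differentiable psi_smooth cq)).
apply: etrans (etrans E (congr1 (+%R^~ _) E1)); rewrite /flatD.
(* Near [chart_map c q] the pushed-forward frame is a partial derivative of [psi] in the chart, so
   its differential is a second derivative of [psi]. *)
have Zd : is_diff (chart_map c q) (Defs.pushforward psi (frame c w) \o chart_inv c)
    ('d (fun u => 'd (psi \o chart_inv c) u w) (chart_map c q)).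
  apply: near_eq_is_diff.
    apply: filterS (chart_img_nbhs cq) => u /chart_imgP[cu uE].
    have := tangent_map_frame w cu (smooth_map_differentiable psi_smooth cu).
    by rewrite uE.
  have [_ /(_ w)[+ _]] := psi_smooth c 2.
  by apply; exists q.
have [dZ eZ] := Zd.
exact: esym (etrans (tangent_map_frame v cq dZ) (congr1 (@^~ v) eZ)).
Qed.

Hypothesis tau0 : forall p, tau p = 0.
Hypothesis S0 : forall p, S p = 0.

Lemma xi_chart_diff0 c q v : chart_dom c q ->
  'd (xi \o chart_inv c) (chart_map c q) v = 0.
Proof.
move=> cq.
have [_] := psi_structure (chart_dom_open c) (@frame_smooth _ _ c v) (@frame_smooth _ _ c v) cq.
rewrite /flatD tangent_map_frame //; last exact: smooth_map_differentiable.
move=> ->; rewrite S0 tau0 !mulmx0 mxE scale0r addr0.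
by rewrite /tangent_map linear0 oppr0.
Qed.

Hypothesis Sigma_connected : connected [set: Sigma].

Lemma locally_constant_cst (T : Type) (F : Sigma -> T) :
  (forall q, \forall p \near q, F p = F q) -> forall p q, F p = F q.
Proof.
move=> Floc p q.
pose A := [set x | F x = F q].
have oA : open A.
  by rewrite openE => x Ax; apply: filterS (Floc x) => y yx; exact: etrans yx Ax.
have cA : closed A.
  rewrite -openC openE => x Ax; apply: filterS (Floc x) => y /= E Ay.
  by apply: Ax; rewrite /A /= -E.
have : A = setT.
  apply: Sigma_connected; first by exists q.
    by exists A => //; rewrite setTI.
  by exists A => //; rewrite setTI.
by move=> AT; have : setT p by []; rewrite -AT.
Qed.

Lemma xi_cst p q : xi p = xi q.
Proof.
apply: locally_constant_cst => {p} {}q.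
have cq := chart_atP q; set c := chart_at q in cq.
have [r /= r0 Hr] := (nbhs_ballP _ _).1 (chart_img_nbhs cq).
have H1 : \forall p \near q, ball (chart_map c q) r (chart_map c p).
  by apply: (chart_map_continuous cq); exact: nbhsx_ballx.
apply: filterS2 H1 (chart_dom_nbhs cq) => p pr cp.
have E (y : V) : ball (chart_map c q) r y ->
    xi (chart_inv c y) = xi (chart_inv c (chart_map c q)).
  move=> yr; apply/rowP => i; apply/eqP; rewrite -subr_eq0; apply/eqP.
  have seg (t : R) : 0 <= t <= 1 ->
      ball (chart_map c q) r (chart_map c q + t *: (y - chart_map c q)).
    move: yr; rewrite -!ball_normE /= => yr /andP[t0 t1].
    rewrite opprD addrA subrr sub0r normrN normrZ ger0_norm // distrC.
    by rewrite (le_lt_trans _ yr) // ler_piMl.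
  have dseg (t : R) : 0 <= t <= 1 ->
      differentiable (xi \o chart_inv c) (chart_map c q + t *: (y - chart_map c q)) /\
      'd (xi \o chart_inv c) (chart_map c q + t *: (y - chart_map c q)) (y - chart_map c q) = 0.
    move=> /seg /Hr /chart_imgP[cu <-]; split; first exact: smooth_map_differentiable.
    exact: xi_chart_diff0.
  have [t t01] := @mvt_line R V (fun y => (xi \o chart_inv c) y 0 i : R^o)
    (chart_map c q) (y - chart_map c q)
    (fun t t01 => (differentiable_coordP _ _).1 (dseg t t01).1 i).
  rewrite (diff_coord i _ (dseg t t01).1) (dseg t t01).2 mxE.
  by rewrite (addrC (chart_map c q)) subrK.
by have := E _ pr; rewrite !chart_mapK.
Qed.

End gauss_equation.

(** * Determinants and linear coordinates in space *)

Section linear_coordinates.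
Context {R : realType}.

Lemma det3E (a b c : 'rV[R]_3) : det3 a b c =
  a 0 0 * (b 0 1 * c 0 2 - b 0 2 * c 0 1) - a 0 1 * (b 0 0 * c 0 2 - b 0 2 * c 0 0)
  + a 0 2 * (b 0 0 * c 0 1 - b 0 1 * c 0 0).
Proof.
pose M : 'M[R]_3 := \matrix_(i, j) [:: a 0 j; b 0 j; c 0 j]`_i.
have -> : det3 a b c = \det M.
  congr (\det _); apply/matrixP => i j; rewrite [RHS]mxE mxE.
  case: splitP => k ik; first by rewrite ik (ord1 k).
  by rewrite mxE; case: splitP => k' kk'; rewrite ik kk' (ord1 k').
rewrite (expand_det_row _ 0) !big_ord_recl big_ord0 addr0 /cofactor !det2E !mxE /=.
rewrite expr0 expr1 expr2.
have o1 : lift ord0 ord0 = 1 :> 'I_3 by exact/val_inj.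
have o2 : lift ord0 (lift ord0 ord0) = 2 :> 'I_3 by exact/val_inj.
have l00 : lift ord0 0 = 1 :> 'I_3 by exact/val_inj.
have l01 : lift ord0 1 = 2 :> 'I_3 by exact/val_inj.
have l10 : lift 1 0 = 0 :> 'I_3 by exact/val_inj.
have l11 : lift 1 1 = 2 :> 'I_3 by exact/val_inj.
have l20 : lift 2 0 = 0 :> 'I_3 by exact/val_inj.
have l21 : lift 2 1 = 1 :> 'I_3 by exact/val_inj.
rewrite o2 o1 ?l00 ?l01 ?l10 ?l11 ?l20 ?l21.
ring.
Qed.

Lemma det3Zl k (a b c : 'rV[R]_3) : det3 (k *: a) b c = k * det3 a b c.
Proof. by rewrite !det3E !mxE; ring. Qed.

Lemma det3_mulr (a b c : 'rV[R]_3) (A : 'M[R]_3) :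
  det3 (a *m A) (b *m A) (c *m A) = det3 a b c * \det A.
Proof. by rewrite /det3 -!mul_col_mx det_mulmx. Qed.

Lemma diff_linear_comp (V W W' : normedModType R) (L : {linear W -> W'}) (f : V -> W) u v :
  continuous L -> differentiable f u ->
  differentiable (fun y => L (f y)) u /\ 'd (fun y => L (f y)) u v = L ('d f u v).
Proof.
move=> Lc df.
have dL : differentiable L (f u) by apply: linear_differentiable.
have dLi : is_diff (f u) L L by apply: DiffDef => //; exact: diff_lin.
have [d e] := is_diff_comp (differentiableP df) dLi.
by split; [exact: d|exact: (congr1 (fun h : V -> W' => h v) e)].
Qed.

Section coordinate_form.
Variables (n : nat) (A : 'M[R]_n) (i : 'I_n).

Definition mulmx_coord (w : 'rV[R]_n) : R^o := (w *m A) 0 i.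

Lemma mulmx_coord_is_linear : linear mulmx_coord.
Proof. by move=> k x y; rewrite /mulmx_coord mulmxDl -scalemxAl !mxE. Qed.

HB.instance Definition _ :=
  GRing.isLinear.Build R 'rV[R]_n R^o _ mulmx_coord mulmx_coord_is_linear.

Lemma mulmx_coord_continuous : continuous mulmx_coord.
Proof.
move=> w; apply: differentiable_continuous.
rewrite (_ : mulmx_coord = \sum_(k < n) (fun w : 'rV[R]_n => A k i *: (w 0 k : R^o))).
  apply: differentiable_sum => k; apply: differentiableZ; exact: differentiable_coord.
apply/funext => y; rewrite fct_sumE /mulmx_coord mxE; apply: eq_bigr => k _.
by rewrite mulrC.
Qed.

End coordinate_form.

Lemma Ck_on_linear_comp (V W W' : normedModType R) k (U : set V) (L : {linear W -> W'})
  (f : V -> W) : open U -> continuous L -> Ck_on k U f -> Ck_on k U (fun u => L (f u)).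
Proof.
move=> oU Lc; elim: k f => [|k IH] f.
  by move=> cf u Uu; apply: (continuous_comp (cf u Uu)); exact: Lc.
move=> [df Cf]; split=> [u Uu|v].
  by have [] := diff_linear_comp 0 Lc (df u Uu).
apply: Ck_on_ext (IH _ (Cf v)) => // u Uu.
by have [_ ->] := diff_linear_comp v Lc (df u Uu).
Qed.

End linear_coordinates.

Section affine_coordinates.
Context {R : realType} {Sigma : orientedSurface R}.
Local Notation V := 'rV[R]_2.
Implicit Types (c d : chart Sigma) (p q : Sigma) (u v w : V).

Definition chart_diff (W : normedModType R) c (F : Sigma -> W) q v : W :=
  'd (F \o chart_inv c) (chart_map c q) v.

Lemma form2E (G : 'M[R]_2) v w : form2 G v w =
  v 0 0 * w 0 0 * G 0 0 + v 0 0 * w 0 1 * G 0 1 +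
  v 0 1 * w 0 0 * G 1 0 + v 0 1 * w 0 1 * G 1 1.
Proof.
rewrite /form2 !mxE !big_ord_recl big_ord0 !mxE !big_ord_recl !big_ord0.
have -> : lift ord0 ord0 = 1 :> 'I_2 by exact/val_inj.
by rewrite -[ord0]/(0 : 'I_2); ring.
Qed.

Lemma det_col_mx2 v w : \det (col_mx v w : 'M[R]_2) = v 0 0 * w 0 1 - v 0 1 * w 0 0.
Proof.
rewrite det2E.
have E (M N : V) j : (col_mx M N : 'M[R]_2) 0 j = M 0 j.
  by rewrite mxE; case: splitP => k; rewrite (ord1 k).
have E' (M N : V) j : (col_mx M N : 'M[R]_2) 1 j = N 0 j.
  by rewrite mxE; case: splitP => k; rewrite (ord1 k).
by rewrite !E !E'.
Qed.

Lemma positive_definite_det (g : Sigma -> 'M[R]_2) q : positive_definite g -> 0 < \det (g q).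
Proof.
move=> /(_ q)[gs gp].
have g01 : g q 1 0 = g q 0 1 by rewrite -{1}gs mxE.
have g00 : 0 < g q 0 0.
  have := gp (row2 1 0); rewrite form2E !row2_0 !row2_1 !(mul0r, mulr0, mul1r, addr0).
  apply; apply/eqP => /(congr1 (fun z : V => z 0 0)); rewrite row2_0 mxE => /eqP.
  by rewrite oner_eq0.
(* This vector is orthogonal to the first basis vector; the form takes on it the value [g 0 0] times
   the determinant. *)
have := gp (row2 (- g q 0 1) (g q 0 0)).
rewrite form2E !row2_0 !row2_1 det2E g01.
set a := g q 0 0; set b := g q 0 1; set d := g q 1 1.
have -> : - b * - b * a + - b * a * b + a * - b * b + a * a * d = a * (a * d - b * b) by ring.
rewrite pmulr_rgt0 //; apply.
apply/eqP => /(congr1 (fun z : V => z 0 1)); rewrite row2_1 mxE => /eqP.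
by rewrite gt_eqF.
Qed.

End affine_coordinates.

(** * Special coordinates *)

Lemma cramer2 (F : fieldType) (a b c a' b' c' v0 v1 : F) : a * b' - b * a' != 0 ->
  v0 * c + v1 * c' =
  (c * b' - b * c') / (a * b' - b * a') * (v0 * a + v1 * a') +
  (a * c' - c * a') / (a * b' - b * a') * (v0 * b + v1 * b').
Proof. by move=> j0; field. Qed.

Lemma cramer2_sol (F : fieldType) (a b c a' b' c' x y : F) :
  c = x * a + y * b -> c' = x * a' + y * b' -> a * b' - b * a' != 0 ->
  x = (c * b' - b * c') / (a * b' - b * a') /\
  y = (a * c' - c * a') / (a * b' - b * a').
Proof. by move=> -> -> j0; split; field. Qed.

(** Differentiating [dz = P1 dx1 + P2 dx2] produces second derivatives and the term [dP . dX]. By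
    the Gauss equation the second derivatives are tangential, up to [G] in the transversal
    coordinate; the tangential parts satisfy the relation for [dz] and cancel. *)
Lemma metric_arith (R : realType) (G a2 a0 a1 d2 d0 d1 P1 P2 P1' P2' X0 X1 dP1 dP2 : R) :
  d2 = a2 + G -> d0 = a0 -> d1 = a1 -> P1' = P1 -> P2' = P2 ->
  d2 = P1' * d0 + dP1 * X0 + (P2' * d1 + dP2 * X1) ->
  a2 = P1 * a0 + P2 * a1 -> G = dP1 * X0 + dP2 * X1.
Proof.
move=> -> -> -> -> -> E a2E; rewrite a2E in E; apply: (addrI (P1 * a0 + P2 * a1)).
by rewrite E; ring.
Qed.

(** The Gram matrix is the product of the Jacobian matrices of [p] and [x], so its determinant is
    the product of theirs. Being also the square of the second factor, it forces the two factors to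
    be equal. *)
Lemma volume_arith (F : fieldType) (a b a' b' P Q P' Q' G11 G22 G12 G21 : F) :
  a * b' - b * a' != 0 ->
  G11 = P * a + Q * b -> G22 = P' * a' + Q' * b' ->
  G12 = P * a' + Q * b' -> G21 = P' * a + Q' * b ->
  (a * b' - b * a') ^+ 2 = G11 * G22 - G12 * G21 ->
  P * Q' - Q * P' = a * b' - b * a'.
Proof.
move=> j0 -> -> -> -> E; apply: (mulIf j0); rewrite -expr2 E; ring.
Qed.

Lemma diff_sum_prod (R : realType) (V : normedModType R) (f1 a1 f2 a2 : V -> R^o) (u v : V) :
  differentiable f1 u -> differentiable a1 u ->
  differentiable f2 u -> differentiable a2 u ->
  differentiable (f1 * a1 + f2 * a2) u /\
  'd (f1 * a1 + f2 * a2) u v =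
    f1 u * 'd a1 u v + 'd f1 u v * a1 u + (f2 u * 'd a2 u v + 'd f2 u v * a2 u).
Proof.
move=> df1 da1 df2 da2.
have D1 := is_diffM (differentiableP df1) (differentiableP da1).
have D2 := is_diffM (differentiableP df2) (differentiableP da2).
have [d e] := is_diffD D1 D2; split => //; rewrite e.
rewrite (mulrC ('d f1 u v)) (mulrC ('d f2 u v)).
by [].
Qed.

Section special_coordinates.
Context {R : realType} {Sigma : orientedSurface R}.
Local Notation V := 'rV[R]_2.
Local Notation e1 := (row2 1 0 : V).
Local Notation e2 := (row2 0 1 : V).
Implicit Types (c d : chart Sigma) (p q : Sigma) (u v w : V).

Lemma chart_diff_row (W : normedModType R) c (F : Sigma -> W) q v :
  chart_diff c F q v = v 0 0 *: chart_diff c F q e1 + v 0 1 *: chart_diff c F q e2.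
Proof. exact: row2_linE. Qed.

(* Locally psi is the graph of a function z of (x1, x2), in the direction of the
   constant affine normal; p is the gradient of z, and the affine metric is its
   Hessian, whose determinant is 1. *)
Record special_coordinates (g : Sigma -> 'M[R]_2)
    (x1 x2 z p1 p2 : Sigma -> R^o) : Prop := SpecialCoordinates {
  sc_x1 : smooth_map x1 ; sc_x2 : smooth_map x2 ; sc_z : smooth_map z ;
  sc_p1 : smooth_map p1 ; sc_p2 : smooth_map p2 ;
  sc_dz : forall c q v, chart_dom c q -> chart_diff c z q v =
    p1 q * chart_diff c x1 q v + p2 q * chart_diff c x2 q v ;
  sc_metric : forall c q v w, chart_dom c q ->
    form2 (g q) (frame c v q) (frame c w q) =
    chart_diff c p1 q v * chart_diff c x1 q w +
    chart_diff c p2 q v * chart_diff c x2 q w ;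
  sc_volume_gt0 : forall c q, chart_dom c q ->
    0 < chart_diff c x1 q e1 * chart_diff c x2 q e2
        - chart_diff c x2 q e1 * chart_diff c x1 q e2 ;
  sc_volume : forall c q, chart_dom c q ->
    chart_diff c p1 q e1 * chart_diff c p2 q e2
      - chart_diff c p2 q e1 * chart_diff c p1 q e2 =
    chart_diff c x1 q e1 * chart_diff c x2 q e2
      - chart_diff c x2 q e1 * chart_diff c x1 q e2 }.

Variables (psi xi : Sigma -> 'rV[R]_3)
    (nabla : (Sigma -> V) -> (Sigma -> V) -> Sigma -> V)
    (g S : Sigma -> 'M[R]_2) (tau : Sigma -> 'cV[R]_2).
Hypothesis Sigma_connected : connected [set: Sigma].
Hypothesis psi_smooth : smooth_map psi.
Hypothesis xi_smooth : smooth_map xi.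
Hypothesis psi_structure : gauss_weingarten psi xi nabla g S tau.
Hypothesis psi_convex : positive_definite g.
Hypothesis xi_affine_normal : affine_normal psi xi g tau.
Hypothesis psi_improper : forall p, S p = 0.
Variable q0 : Sigma.

Let xi_cst q : xi q = xi q0.
Proof. exact: (xi_cst xi_smooth psi_structure xi_affine_normal.1 psi_improper). Qed.

Let b1 := tangent_map psi q0 e1.
Let b2 := tangent_map psi q0 e2.
Let D0 := det3 b1 b2 (xi q0).

Let D0_gt0 : 0 < D0.
Proof.
rewrite /D0 /b1 /b2 -xi_affine_normal.2 /vol_form det_col_mx2 !row2_0 !row2_1.
by rewrite mulr1 mulr0 subr0 mulr1 sqrtr_gt0 positive_definite_det.
Qed.

(** The third basis vector is the constant affine normal, so the last coordinate measures the
    transversal part. The factor [D0^-1] makes the determinant 1, which preserves the volume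
    normalization of the affine normal. *)
Let B : 'M[R]_3 := col_mx (D0^-1 *: b1) (col_mx b2 (xi q0)).

Let detB : \det B = 1.
Proof.
by rewrite -[LHS]/(det3 _ _ _) det3Zl -/D0 mulVf // lt0r_neq0.
Qed.

Let B_unit : B \in unitmx.
Proof. by rewrite unitmxE detB unitr1. Qed.

Let xiB : xi q0 *m invmx B = delta_mx 0 2.
Proof.
have -> : xi q0 = delta_mx 0 2 *m B.
  rewrite -rowE; apply/rowP => j; rewrite !mxE; case: splitP => k /=; first by rewrite (ord1 k).
  move=> kE; rewrite mxE; case: splitP => l /=; first by rewrite (ord1 l) => lE; move: kE; rewrite lE.
  by rewrite (ord1 l).
by rewrite mulmxK.
Qed.

Let y (k : 'I_3) (q : Sigma) : R^o := mulmx_coord (invmx B) k (psi q).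

Let y_smooth k : smooth_map (y k).
Proof.
move=> c n.

exact: (@Ck_on_linear_comp R V 'rV[R]_3 R^o n _ (mulmx_coord (invmx B) k) (psi \o chart_inv c)
  (@chart_map_open R Sigma c) (@mulmx_coord_continuous R 3 (invmx B) k) (psi_smooth c n)).
Qed.

Let dy c q k v : chart_dom c q ->
  chart_diff c (y k) q v = mulmx_coord (invmx B) k (chart_diff c psi q v).
Proof.
move=> cq.
by have [_ E] := diff_linear_comp v (@mulmx_coord_continuous R 3 (invmx B) k)
  (smooth_map_differentiable psi_smooth cq); exact: E.
Qed.

Let jac c q := chart_diff c (y 0) q e1 * chart_diff c (y 1) q e2
  - chart_diff c (y 1) q e1 * chart_diff c (y 0) q e2.

(** This is the volume condition of the affine normal: in the basis [B] the vector [xi] is the third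
    unit vector, so the determinant with it reduces to the minor of the first two coordinates. *)
Let jacE c q : chart_dom c q -> jac c q = Num.sqrt (\det (g q)) *
  (frame c e1 q 0 0 * frame c e2 q 0 1 - frame c e1 q 0 1 * frame c e2 q 0 0).
Proof.
move=> cq; rewrite -det_col_mx2 -[RHS]/(vol_form g q _ _) xi_affine_normal.2 xi_cst.
have dpsi := smooth_map_differentiable psi_smooth cq.
rewrite (tangent_map_frame e1 cq dpsi) (tangent_map_frame e2 cq dpsi).
rewrite -[X in det3 X _ _](mulmxKV B_unit) -[X in det3 _ X _](mulmxKV B_unit).
rewrite -[X in det3 _ _ X](mulmxKV B_unit) det3_mulr detB mulr1 xiB det3E.
have d0 : (delta_mx 0 2 : 'rV[R]_3) 0 0 = 0 by rewrite mxE.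
have d1 : (delta_mx 0 2 : 'rV[R]_3) 0 1 = 0 by rewrite mxE.
have d2 : (delta_mx 0 2 : 'rV[R]_3) 0 2 = 1 by rewrite mxE.
rewrite d0 d1 d2 /jac !dy // /mulmx_coord /chart_diff; ring.
Qed.

Let jac_gt0 c q : chart_dom c q -> 0 < jac c q.
Proof.
move=> cq; rewrite jacE // mulr_gt0 ?frame_det_gt0 //.
by rewrite sqrtr_gt0 positive_definite_det.
Qed.

Let form c q v w := form2 (g q) (frame c v q) (frame c w q).

Let jac_sqr c q : chart_dom c q ->
  jac c q ^+ 2 = form c q e1 e1 * form c q e2 e2 - form c q e1 e2 * form c q e2 e1.
Proof.
move=> cq; rewrite jacE // exprMn sqr_sqrtr; last by rewrite ltW // positive_definite_det.
rewrite /form !form2E det2E; ring.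
Qed.

Let grad_num1 c q := chart_diff c (y 2) q e1 * chart_diff c (y 1) q e2
  - chart_diff c (y 1) q e1 * chart_diff c (y 2) q e2.
Let grad_num2 c q := chart_diff c (y 0) q e1 * chart_diff c (y 2) q e2
  - chart_diff c (y 2) q e1 * chart_diff c (y 0) q e2.

(** The gradient of the last coordinate with respect to the first two, by Cramer's rule in the
    preferred chart. Smoothness requires that any other chart gives the same value, which [p_chart]
    provides. *)
Let p1 q : R^o := grad_num1 (chart_at q) q / jac (chart_at q) q.
Let p2 q : R^o := grad_num2 (chart_at q) q / jac (chart_at q) q.

Let dz_eq c q v : chart_dom c q -> chart_diff c (y 2) q v =
  p1 q * chart_diff c (y 0) q v + p2 q * chart_diff c (y 1) q v.
Proof.
move=> cq.
have at_eq w : chart_diff (chart_at q) (y 2) q w =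
    p1 q * chart_diff (chart_at q) (y 0) q w + p2 q * chart_diff (chart_at q) (y 1) q w.
  have j0 := lt0r_neq0 (jac_gt0 (chart_atP q)).
  rewrite (chart_diff_row _ (y 2) q w) (chart_diff_row _ (y 0) q w) (chart_diff_row _ (y 1) q w).
  exact: (cramer2 _ _ _ _ j0).
have tr k : chart_diff c (y k) q v = chart_diff (chart_at q) (y k) q (frame c v q).
  exact: esym (tangent_map_frame v cq (smooth_map_differentiable (y_smooth k) cq)).
by rewrite !tr at_eq.
Qed.

Let p_chart c q : chart_dom c q ->
  p1 q = grad_num1 c q / jac c q /\ p2 q = grad_num2 c q / jac c q.
Proof.
move=> cq; have j0 := lt0r_neq0 (jac_gt0 cq).
have E1 := dz_eq e1 cq; have E2 := dz_eq e2 cq.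
exact: (cramer2_sol E1 E2 j0).
Qed.

Let partial_Ck (F : Sigma -> R^o) c v k : smooth_map F ->
  Ck_on k (chart_map c @` chart_dom c) (fun u => 'd (F \o chart_inv c) u v : R^o).
Proof. by move=> /(_ c k.+1)[_ /(_ v)]. Qed.

Let det_Ck c k (F G : Sigma -> R^o) : smooth_map F -> smooth_map G ->
  Ck_on k (chart_map c @` chart_dom c)
    (fun u => 'd (F \o chart_inv c) u e1 * 'd (G \o chart_inv c) u e2 -
              'd (G \o chart_inv c) u e1 * 'd (F \o chart_inv c) u e2 : R^o).
Proof.
move=> sF sG; have oU := @chart_map_open R Sigma c.
exact: (Ck_onD oU (Ck_onM oU (partial_Ck _ _ _ sF) (partial_Ck _ _ _ sG))
  (Ck_onN oU (Ck_onM oU (partial_Ck _ _ _ sG) (partial_Ck _ _ _ sF)))).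
Qed.

Let p_smooth : smooth_map p1 /\ smooth_map p2.
Proof.
have jV c k : Ck_on k (chart_map c @` chart_dom c)
    (fun u => ('d (y 0 \o chart_inv c) u e1 * 'd (y 1 \o chart_inv c) u e2 -
              'd (y 1 \o chart_inv c) u e1 * 'd (y 0 \o chart_inv c) u e2)^-1 : R^o).
  apply: Ck_onV; [exact: chart_map_open| |exact: det_Ck].
  by move=> _ [q cq <-]; exact: lt0r_neq0 (jac_gt0 cq).
split=> c k; have oU := @chart_map_open R Sigma c.
- apply: Ck_on_ext oU _ (Ck_onM oU (det_Ck c k (y_smooth 2) (y_smooth 1)) (jV c k)).
  by move=> _ [q cq <-] /=; rewrite (chart_mapK cq) (p_chart cq).1.
- apply: Ck_on_ext oU _ (Ck_onM oU (det_Ck c k (y_smooth 0) (y_smooth 2)) (jV c k)).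
  by move=> _ [q cq <-] /=; rewrite (chart_mapK cq) (p_chart cq).2.
Qed.

Let metric_eq c q v w : chart_dom c q -> form c q v w =
  chart_diff c p1 q v * chart_diff c (y 0) q w +
  chart_diff c p2 q v * chart_diff c (y 1) q w.
Proof.
move=> cq.
have [s gE] := gauss_chart psi_smooth psi_structure v w cq.
pose A k : V -> R^o := fun u => 'd (y k \o chart_inv c) u w.
have dA k : differentiable (A k) (chart_map c q).
  by have [+ _] := @partial_Ck (y k) c w 1 (y_smooth k); apply; exists q.
have xk k : mulmx_coord (invmx B) k (xi q) = (k == 2)%:R.
  by rewrite (xi_cst q) /mulmx_coord xiB mxE eqxx.
(* The k-th coordinate of the Gauss equation; only the coordinate 2 sees the normal term, whence the
   boolean factor. *)
have AE k b : (k == 2) = b ->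
    'd (A k) (chart_map c q) v = chart_diff c (y k) q s + form c q v w * b%:R.
  move=> kb.
  have nE : {near chart_map c q, (fun u => mulmx_coord (invmx B) k ('d (psi \o chart_inv c) u w)) =1 A k}.
    apply: filterS (chart_img_nbhs cq) => u /chart_imgP[cu uE].
    by have := esym (dy k w cu); rewrite /chart_diff uE.
  have [+ _] := (psi_smooth c 2).2 w; move=> /(_ (chart_map c q)) dw.
  have [d1 e] := diff_linear_comp v (@mulmx_coord_continuous R 3 (invmx B) k)
    (dw (ex_intro2 _ _ q cq erefl)).
  rewrite (near_eq_diff v nE d1) e gE linearD linearZ dy //; congr (_ + _ * _).
  by rewrite -kb; exact: xk.
have dp1 := smooth_map_differentiable p_smooth.1 cq.
have dp2 := smooth_map_differentiable p_smooth.2 cq.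
have nE : {near chart_map c q, (p1 \o chart_inv c) * A 0 + (p2 \o chart_inv c) * A 1 =1 A 2}.
  apply: filterS (chart_img_nbhs cq) => u /chart_imgP[cu uE].
  by have := esym (dz_eq w cu); rewrite /chart_diff uE.
have [d e] := diff_sum_prod v dp1 (dA 0) dp2 (dA 1).
have E := etrans (near_eq_diff v nE d) e.
have z0 (x f : R) : x + f * false%:R = x by rewrite mulr0 addr0.
have z1 (x f : R) : x + f * true%:R = x + f by rewrite mulr1.
have A2 := etrans (AE 2 true erefl) (z1 _ _).
have A0 := etrans (AE 0 false erefl) (z0 _ _).
have A1 := etrans (AE 1 false erefl) (z0 _ _).
have pE (P : Sigma -> R^o) : (P \o chart_inv c) (chart_map c q) = P q.
  exact: congr1 (chart_mapK cq).
exact: (metric_arith A2 A0 A1 (pE p1) (pE p2) E (dz_eq s cq)).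
Qed.

Let volume_eq c q : chart_dom c q ->
  chart_diff c p1 q e1 * chart_diff c p2 q e2
    - chart_diff c p2 q e1 * chart_diff c p1 q e2 = jac c q.
Proof.
move=> cq; have j0 := lt0r_neq0 (jac_gt0 cq).
exact: (volume_arith j0 (metric_eq e1 e1 cq) (metric_eq e2 e2 cq)
  (metric_eq e1 e2 cq) (metric_eq e2 e1 cq) (jac_sqr cq)).
Qed.

Lemma special_coordinates_exist : exists A : 'M[R]_3,
  exists x1 x2 z P1 P2 : Sigma -> R^o,
  [/\ A \in unitmx, special_coordinates g x1 x2 z P1 P2 &
    forall q, psi q = (\row_(i < 3) [:: x1 q; x2 q; z q]`_i) *m A].
Proof.
exists B, (y 0), (y 1), (y 2), p1, p2; split => //.
  have [s1 s2] := p_smooth.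
  by split.
move=> q; rewrite -[LHS](mulmxKV B_unit); congr (_ *m _).
apply/rowP => i; rewrite [RHS]mxE /y /mulmx_coord.
by case: i => [[|[|[|//]]] ilt] /=; congr (_ 0 _); exact/val_inj.
Qed.

End special_coordinates.

(** * The Lewy transform *)

Section lewy_algebra.
Context {R : realFieldType}.

(* With J, K the Jacobian matrices of x and p, these are the entries of
   M = (J + K)^-1 J. *)
Lemma lewy_matrix (a b a' b' P Q P' Q' : R) :
  0 < a * b' - b * a' -> P * Q' - Q * P' = a * b' - b * a' ->
  P * a' + Q * b' = P' * a + Q' * b ->
  (forall s t : R, 0 <= s * s * (P * a + Q * b) + s * t * (P * a' + Q * b')
    + t * s * (P' * a + Q' * b) + t * t * (P' * a' + Q' * b')) ->
  let D := (a + P) * (b' + Q') - (b + Q) * (a' + P') in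
  0 < D /\ exists m11 m12 m22 : R,
    [/\ 0 < m11, 0 < m22, m11 + m22 = 1 &
      m11 * m22 - m12 * m12 = (a * b' - b * a') / D] /\
    [/\ a = m11 * (a + P) + m12 * (b + Q), b = m12 * (a + P) + m22 * (b + Q),
      a' = m11 * (a' + P') + m12 * (b' + Q') &
      b' = m12 * (a' + P') + m22 * (b' + Q')].
Proof.
move=> j0 jE sym pos D.
(* The vector [(a', - a)] spans the kernel of [dx1]; there the form equals [a * b' - b * a'] times
   the quantity at hand. The vector [(b', - b)] does the same for [dx2]. *)
have t1 : 0 <= a * Q' - a' * Q.
  rewrite -(pmulr_rge0 _ j0); apply: le_trans (pos a' (- a)) _.
  by rewrite le_eqVlt; apply/orP; left; apply/eqP; ring.
have t2 : 0 <= P * b' - P' * b.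
  rewrite -(pmulr_rge0 _ j0); apply: le_trans (pos b' (- b)) _.
  by rewrite le_eqVlt; apply/orP; left; apply/eqP; ring.
(* Expansion of [det (J + K)]: the factor 2 collects [det J] and [det K], which are equal. The
   numerators of [m11] and [m22] add up to this expression, hence trace 1. *)
have DE : D = 2 * (a * b' - b * a') + (a * Q' - a' * Q) + (P * b' - P' * b).
  by rewrite -[X in X * _](_ : 1 + 1 = 2) // mulrDl mul1r -{2}jE /D; ring.
have D0 : 0 < D.
  by rewrite DE; move: j0 t1 t2; move: (a * b' - _) (a * Q' - _) (P * b' - _) => *; lra.
split=> //.
have Dn0 : D != 0 by rewrite gt_eqF.
have sym' : Q' * b - Q * b' = P * a' - P' * a.
  by apply/eqP; rewrite subr_eq addrAC eq_sym subr_eq sym addrC.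
exists ((a * b' - b * a' + (a * Q' - a' * Q)) / D), ((Q' * b - Q * b') / D),
  ((a * b' - b * a' + (P * b' - P' * b)) / D).
split; split.
- by rewrite divr_gt0 // ltr_pwDl.
- by rewrite divr_gt0 // ltr_pwDl.
- rewrite -mulrDl -[RHS](divff Dn0) DE; congr (_ / _).
  by rewrite -[X in _ = X * _ + _ + _](_ : 1 + 1 = 2) //; ring.
- have key : (a * b' - b * a' + (a * Q' - a' * Q)) * (a * b' - b * a' + (P * b' - P' * b))
      - (Q' * b - Q * b') * (Q' * b - Q * b') = D * (a * b' - b * a').
    by rewrite {2}sym' /D; ring.
  have fr (x y t j : R) : x * y - t * t = D * j -> x / D * (y / D) - t / D * (t / D) = j / D.
    by move=> E; rewrite !mulf_div -mulrBl E; field.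
  exact: fr.
- have key : (a * b' - b * a' + (a * Q' - a' * Q)) * (a + P) + (Q' * b - Q * b') * (b + Q) = D * a.
    by rewrite sym' /D; ring.
  by apply: (mulfI Dn0); rewrite -key; field.
- have key : (Q' * b - Q * b') * (a + P) + (a * b' - b * a' + (P * b' - P' * b)) * (b + Q) = D * b.
    by rewrite /D; ring.
  by apply: (mulfI Dn0); rewrite -key; field.
- have key : (a * b' - b * a' + (a * Q' - a' * Q)) * (a' + P') + (Q' * b - Q * b') * (b' + Q') = D * a'.
    by rewrite sym' /D; ring.
  by apply: (mulfI Dn0); rewrite -key; field.
- have key : (Q' * b - Q * b') * (a' + P') + (a * b' - b * a' + (P * b' - P' * b)) * (b' + Q') = D * b'.
    by rewrite /D; ring.
  by apply: (mulfI Dn0); rewrite -key; field.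
Qed.

Lemma quad_arith (s t P P' Q Q' a a' b b' : R) :
  (s * P + t * P') * (s * a + t * a') + (s * Q + t * Q') * (s * b + t * b') =
  s * s * (P * a + Q * b) + s * t * (P * a' + Q * b')
    + t * s * (P' * a + Q' * b) + t * t * (P' * a' + Q' * b').
Proof. by ring. Qed.

Lemma lewy_matrix_sum (a b a' b' P Q P' Q' f1 f2 f1' f2' G12 G21 : R) :
  f1 = a + P -> f2 = b + Q -> f1' = a' + P' -> f2' = b' + Q' ->
  0 < a * b' - b * a' -> P * Q' - Q * P' = a * b' - b * a' ->
  G12 = P * a' + Q * b' -> G21 = P' * a + Q' * b -> G12 = G21 ->
  (forall s t : R, 0 <=
    (s * P + t * P') * (s * a + t * a') + (s * Q + t * Q') * (s * b + t * b')) ->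
  0 < f1 * f2' - f2 * f1' /\ exists m11 m12 m22 : R,
    [/\ 0 < m11, 0 < m22, m11 + m22 = 1 &
      m11 * m22 - m12 * m12 = (a * b' - b * a') / (f1 * f2' - f2 * f1')] /\
    [/\ a = m11 * f1 + m12 * f2, b = m12 * f1 + m22 * f2,
      a' = m11 * f1' + m12 * f2' & b' = m12 * f1' + m22 * f2'].
Proof.
move=> -> -> -> -> j0 jE -> -> sym pos; apply: lewy_matrix => // s t.
by rewrite -quad_arith.
Qed.

Lemma ge0_arith (A B C D A' B' C' D' G : R) :
  A = A' -> B = B' -> C = C' -> D = D' -> G = A' * B' + C' * D' -> 0 <= G ->
  0 <= A * B + C * D.
Proof. by move=> -> -> -> -> ->. Qed.

Lemma lin_comb_arith (v0 v1 X1 X2 Y1 Y2 Z1 Z2 m n : R) :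
  X1 = m * Y1 + n * Z1 -> X2 = m * Y2 + n * Z2 ->
  v0 * X1 + v1 * X2 = m * (v0 * Y1 + v1 * Y2) + n * (v0 * Z1 + v1 * Z2).
Proof. by move=> -> ->; ring. Qed.

End lewy_algebra.

Section lewy_map.
Context {R : realType} {Sigma : orientedSurface R}.
Local Notation V := 'rV[R]_2.
Local Notation e1 := (row2 1 0 : V).
Local Notation e2 := (row2 0 1 : V).
Implicit Types (c d : chart Sigma) (p q : Sigma) (u v w : V).
Variables (g : Sigma -> 'M[R]_2) (x1 x2 z p1 p2 : Sigma -> R^o).
Hypothesis sc : special_coordinates g x1 x2 z p1 p2.
Hypothesis g_convex : positive_definite g.

Definition lewy1 q : R^o := x1 q + p1 q.
Definition lewy2 q : R^o := x2 q + p2 q.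
Definition lewy q : V := row2 (lewy1 q) (lewy2 q).

Lemma smooth_mapD (F G : Sigma -> R^o) : smooth_map F -> smooth_map G ->
  smooth_map (fun q => F q + G q : R^o).
Proof.
move=> sF sG c k.
exact: (Ck_onD (@chart_map_open R Sigma c) (sF c k) (sG c k)).
Qed.

Lemma lewy1_smooth : smooth_map lewy1.
Proof. exact: smooth_mapD (sc_x1 sc) (sc_p1 sc). Qed.

Lemma lewy2_smooth : smooth_map lewy2.
Proof. exact: smooth_mapD (sc_x2 sc) (sc_p2 sc). Qed.

Lemma chart_diffD (F G : Sigma -> R^o) c q v : smooth_map F -> smooth_map G ->
  chart_dom c q ->
  chart_diff c (fun q => F q + G q : R^o) q v = chart_diff c F q v + chart_diff c G q v.
Proof.
move=> sF sG cq.
have [_ e] := is_diffD (differentiableP (smooth_map_differentiable sF cq))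
  (differentiableP (smooth_map_differentiable sG cq)).
exact: (congr1 (fun h : V -> R => h v) e).
Qed.

Definition coord_jac c q := chart_diff c x1 q e1 * chart_diff c x2 q e2
  - chart_diff c x2 q e1 * chart_diff c x1 q e2.

Definition lewy_jac c q := chart_diff c lewy1 q e1 * chart_diff c lewy2 q e2
  - chart_diff c lewy2 q e1 * chart_diff c lewy1 q e2.

Let lin_comb (X Y Z : Sigma -> R^o) (m n : R) c q :
  chart_diff c X q e1 = m * chart_diff c Y q e1 + n * chart_diff c Z q e1 ->
  chart_diff c X q e2 = m * chart_diff c Y q e2 + n * chart_diff c Z q e2 ->
  forall v, chart_diff c X q v = m * chart_diff c Y q v + n * chart_diff c Z q v.
Proof.
move=> h1 h2 v.
rewrite (chart_diff_row c X q v) (chart_diff_row c Y q v) (chart_diff_row c Z q v).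
exact: lin_comb_arith.
Qed.

Lemma lewy_matrix_chart c q : chart_dom c q ->
  0 < lewy_jac c q /\ exists m11 m12 m22 : R,
    [/\ 0 < m11, 0 < m22, m11 + m22 = 1 &
      m11 * m22 - m12 * m12 = coord_jac c q / lewy_jac c q] /\
    forall v,
      chart_diff c x1 q v = m11 * chart_diff c lewy1 q v + m12 * chart_diff c lewy2 q v /\
      chart_diff c x2 q v = m12 * chart_diff c lewy1 q v + m22 * chart_diff c lewy2 q v.
Proof.
move=> cq.
have L1 v := chart_diffD v (sc_x1 sc) (sc_p1 sc) cq.
have L2 v := chart_diffD v (sc_x2 sc) (sc_p2 sc) cq.
have sym : form2 (g q) (frame c e1 q) (frame c e2 q) = form2 (g q) (frame c e2 q) (frame c e1 q).
  have g01 : g q 1 0 = g q 0 1 by rewrite -{1}(g_convex q).1 mxE.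
  by rewrite !form2E g01; ring.
have pos (s t : R) : 0 <=
    (s * chart_diff c p1 q e1 + t * chart_diff c p1 q e2) *
      (s * chart_diff c x1 q e1 + t * chart_diff c x1 q e2) +
    (s * chart_diff c p2 q e1 + t * chart_diff c p2 q e2) *
      (s * chart_diff c x2 q e1 + t * chart_diff c x2 q e2).
  have F (X : Sigma -> R^o) :
      s * chart_diff c X q e1 + t * chart_diff c X q e2 = chart_diff c X q (row2 s t).
    by rewrite (chart_diff_row c X q (row2 s t)) row2_0 row2_1.
  apply: (ge0_arith (F p1) (F x1) (F p2) (F x2) (sc_metric sc (row2 s t) (row2 s t) cq)).
  have [->|n0] := eqVneq (frame c (row2 s t) q) 0.
    by rewrite form2E !mxE !mul0r !addr0.
  by rewrite ltW //; exact: (g_convex q).2.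
have [D0 [m11 [m12 [m22 [M1 [h1 h2 h3 h4]]]]]] :=
  lewy_matrix_sum (L1 e1) (L2 e1) (L1 e2) (L2 e2) (sc_volume_gt0 sc cq) (sc_volume sc cq)
    (sc_metric sc e1 e2 cq) (sc_metric sc e2 e1 cq) sym pos.
split; first exact: D0.
exists m11, m12, m22; split; first exact: M1.
by move=> v; split; [exact: (lin_comb h1 h3)|exact: (lin_comb h2 h4)].
Qed.

Lemma lewy_smooth : smooth_map lewy.
Proof.
move=> c k; apply/(Ck_on_coordP _ _ (@chart_map_open R Sigma c)) => i.
case: i => [[|[|//]] ilt].
  apply: (Ck_on_ext (@chart_map_open R Sigma c) _ (lewy1_smooth c k)) => u _.
  by rewrite /lewy /= mxE.
apply: (Ck_on_ext (@chart_map_open R Sigma c) _ (lewy2_smooth c k)) => u _.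
by rewrite /lewy /= mxE.
Qed.

Lemma chart_diff_lewy c q v : chart_dom c q ->
  chart_diff c lewy q v = row2 (chart_diff c lewy1 q v) (chart_diff c lewy2 q v).
Proof.
move=> cq; have dl := smooth_map_differentiable lewy_smooth cq.
have H i := diff_coord i v dl.
apply: row2P; rewrite ?row2_0 ?row2_1.
  have E : (fun u => (lewy \o chart_inv c) u 0 0 : R^o) = lewy1 \o chart_inv c.
    by apply/funext => u; rewrite /lewy /= row2_0.
  by have := H 0; rewrite E => e; exact: esym e.
have E : (fun u => (lewy \o chart_inv c) u 0 1 : R^o) = lewy2 \o chart_inv c.
  by apply/funext => u; rewrite /lewy /= row2_1.
by have := H 1; rewrite E => e; exact: esym e.
Qed.

Lemma lewy_diff_inj c q v : chart_dom c q -> chart_diff c lewy q v = 0 -> v = 0.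
Proof.
move=> cq; have [D0 _] := lewy_matrix_chart cq.
rewrite chart_diff_lewy // => E.
have := congr1 (fun t : V => t 0 0) E; have := congr1 (fun t : V => t 0 1) E.
rewrite row2_0 row2_1 !mxE (chart_diff_row c lewy1 q v) (chart_diff_row c lewy2 q v).
move: D0; rewrite /lewy_jac.
move: (chart_diff c lewy1 q e1) (chart_diff c lewy2 q e2) (chart_diff c lewy2 q e1)
  (chart_diff c lewy1 q e2) => a b' b a' D0 h2 h1.
rewrite /GRing.scale /= in h1 h2.
have Dn0 : a * b' - b * a' != 0 by rewrite gt_eqF.
apply: row2P; rewrite mxE; apply: (mulIf Dn0); rewrite mul0r.
  have -> : v 0 0 * (a * b' - b * a') = (v 0 0 * a + v 0 1 * a') * b' - (v 0 0 * b + v 0 1 * b') * a' by ring.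
  by rewrite h1 h2 !mul0r subrr.
have -> : v 0 1 * (a * b' - b * a') = (v 0 0 * b + v 0 1 * b') * a - (v 0 0 * a + v 0 1 * a') * b by ring.
by rewrite h1 h2 !mul0r subrr.
Qed.

(** With [f] the value of the differential of the Lewy map on [v], [dx] is [M f] and [dp] is
    [(I - M) f], so the metric is the quadratic form of [M - M^2]. By Cayley-Hamilton and trace 1
    this is [det M] times the identity, and [det M] is the quotient of Jacobians. *)
Lemma metric_conformal c q v : chart_dom c q ->
  form2 (g q) (frame c v q) (frame c v q) = coord_jac c q / lewy_jac c q *
    (chart_diff c lewy1 q v ^+ 2 + chart_diff c lewy2 q v ^+ 2).
Proof.
move=> cq; rewrite (sc_metric sc v v cq).
have L1 := chart_diffD v (sc_x1 sc) (sc_p1 sc) cq.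
have L2 := chart_diffD v (sc_x2 sc) (sc_p2 sc) cq.
have [_ [m11 [m12 [m22 [[_ _ tr <-] /(_ v)[X1 X2]]]]]] := lewy_matrix_chart cq.
have aux (a b p r f1 f2 : R) : f1 = a + p -> f2 = b + r -> a = m11 * f1 + m12 * f2 ->
    b = m12 * f1 + m22 * f2 ->
    p * a + r * b = (m11 * m22 - m12 * m12) * (f1 ^+ 2 + f2 ^+ 2).
  move=> E1 E2 A B.
  have -> : p = f1 - a by rewrite E1 addrAC subrr add0r.
  have -> : r = f2 - b by rewrite E2 addrAC subrr add0r.
  rewrite A B -(addrK m11 m22) (addrC m22) tr; ring.
exact: (aux _ _ _ _ _ _ L1 L2 X1 X2).
Qed.

End lewy_map.

(** * Differentiability of continuous right inverses *)

Section right_inverse.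
Context {R : realType}.
Local Notation V := 'rV[R]_2.

Lemma linear_bound_continuous (W : normedModType R) (L : {linear W -> W}) (K : R) :
  (forall w, `|L w| <= K * `|w|) -> continuous L.
Proof.
move=> LK x; apply/continuous_epsP => e e0.
have K1 : 0 < `|K| + 1 by rewrite ltr_wpDl.
exists (e / (`|K| + 1)); first by rewrite divr_gt0.
move=> y; rewrite ltr_pdivlMr // -raddfB => yx.
apply: (le_lt_trans (LK _)); apply: (le_lt_trans _ yx).
by rewrite mulrC ler_wpM2l // (le_trans (ler_norm K)) // lerDl.
Qed.

(** Let [k = s (w + h) - s w], small by continuity. Differentiability of [phi] reads
    [h - 'd phi k = o(k)]; applying the inverse differential gives [k - Li h = o(k)], hence
    [|k| <= 2 K |h|], and the error is [o(h)]. *)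
Lemma diff_right_inverse (phi s : V -> V) (w : V) :
  differentiable phi (s w) -> (forall v, 'd phi (s w) v = 0 -> v = 0) ->
  {for w, continuous s} -> (\forall y \near w, phi (s y) = y) ->
  exists Li : {linear V -> V}, (forall v, 'd phi (s w) (Li v) = v) /\ is_diff w s Li.
Proof.
move=> dphi inj /(@continuous_epsP R _ _ s w) sc phis.
have [Li [K K0 [LiK KLi LiB]]] := inverse_matrix_bound inj.
exists Li; split=> //; apply: is_diff_eps => [|e e0].
  exact: linear_bound_continuous LiB.
(* The first bound gives [K * eps <= 1/2], which absorbs the error in [|k| <= 2 K |h|]; the second
   makes the final error [K * eps * 2 K |h|] at most [e |h|]. *)
pose eps := Num.min (2 * K)^-1 (e / (2 * K ^+ 2)).
have eps0 : 0 < eps.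
  by rewrite lt_min invr_gt0 mulr_gt0 // divr_gt0 // mulr_gt0 // exprn_gt0.
have [r /= r0 Hr] := (nbhs_ballP _ _).1 (diff_eps dphi eps0).
have [d d0 Hd] := sc r r0.
have [d' /= d'0 Hd'] := (nbhs_ballP _ _).1 phis.
apply/nbhs_ballP; exists (Num.min d d'); first by rewrite /= lt_min d0.
move=> h; rewrite -ball_normE /= sub0r normrN lt_min => /andP[hd hd'].
have wh : `|w + h - w| < d by rewrite addrAC subrr add0r.
pose k := s (w + h) - s w.
have kr : `|k| < r := Hd _ wh.
have phiwh : phi (s (w + h)) = w + h.
  by apply: Hd'; rewrite -ball_normE /= opprD addrA subrr sub0r normrN.
have phiw : phi (s w) = w by apply: Hd'; exact: ballxx.
have := Hr k; rewrite -ball_normE /= sub0r normrN => /(_ kr).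
have -> : s w + k = s (w + h) by rewrite /k addrC subrK.
rewrite phiwh phiw.
have -> : w + h - w = h by rewrite addrAC subrr add0r.
move=> H.
have kE : k - Li h = - Li (h - 'd phi (s w) k).
  have -> : Li (h - 'd phi (s w) k) = Li h - k.
    exact: etrans (raddfB Li _ _) (congr1 (fun t => Li h - t) (LiK k)).
  by rewrite opprB.
have K1 : `|k - Li h| <= K * (eps * `|k|).
  by rewrite kE normrN (le_trans (LiB _)) // ler_wpM2l // ltW.
have epsK : K * eps <= 2^-1.
  have : eps <= (2 * K)^-1 by rewrite /eps ge_min lexx.
  move=> /(ler_wpM2l (ltW K0)); rewrite invfM mulrCA mulfV ?gt_eqF // mulr1.
  by [].
have epsKe : 2 * K * (K * eps) <= e.
  have : eps <= e / (2 * K ^+ 2) by rewrite /eps ge_min lexx orbT.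
  rewrite ler_pdivlMr ?mulr_gt0 ?exprn_gt0 //.
  by rewrite (_ : eps * (2 * K ^+ 2) = 2 * K * (K * eps)) //; ring.
have kK : `|k| <= 2 * K * `|h|.
  have k1 : `|k| <= `|Li h| + `|k - Li h|.
    by rewrite -[X in `|X| <= _](subrK (Li h) k) addrC ler_normD.
  have := LiB h; move: k1 K1; move: `|k| (normr_ge0 k) `|Li h| `|k - Li h| `|h| => a a0 b c0 f.
  by move: epsK; rewrite mulrA; move: (K * eps) => y; nra.
rewrite -/k (le_trans K1) //.
rewrite mulrA; apply: (le_trans (ler_wpM2l _ kK)); first by rewrite mulr_ge0 // ltW.
have -> : K * eps * (2 * K * `|h|) = 2 * K * (K * eps) * `|h| by ring.
by rewrite ler_wpM2r.
Qed.

End right_inverse.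

Section lewy_sections.
Context {R : realType} {Sigma : orientedSurface R}.
Local Notation V := 'rV[R]_2.
Local Notation e1 := (row2 1 0 : V).
Local Notation e2 := (row2 0 1 : V).
Implicit Types (c d : chart Sigma) (p q : Sigma) (u v w : V).
Variables (g : Sigma -> 'M[R]_2) (x1 x2 z p1 p2 : Sigma -> R^o).
Hypothesis sc : special_coordinates g x1 x2 z p1 p2.
Hypothesis g_convex : positive_definite g.
Local Notation Phi := (lewy x1 x2 p1 p2).
Local Notation Phi1 := (lewy1 x1 p1).
Local Notation Phi2 := (lewy2 x2 p2).

Lemma section_diff (s : V -> Sigma) c w :
  {for w, continuous s} -> (\forall y \near w, Phi (s y) = y) -> chart_dom c (s w) ->
  exists Li : {linear V -> V},
    [/\ forall v, chart_diff c Phi (s w) (Li v) = v,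
      is_diff w (chart_map c \o s) Li &
      forall (W : normedModType R) (F : Sigma -> W), smooth_map F ->
        is_diff w (F \o s) (fun v => chart_diff c F (s w) (Li v))].
Proof.
move=> scont Ps cs.
have dPhi := smooth_map_differentiable (lewy_smooth sc) cs.
have near_s : \forall y \near w, chart_dom c (s y).
  by apply: scont; exact: chart_dom_nbhs.
have inj v : 'd (Phi \o chart_inv c) (chart_map c (s w)) v = 0 -> v = 0.
  by move=> E; apply: (lewy_diff_inj sc g_convex cs); exact: E.
have cc : {for w, continuous (chart_map c \o s)}.
  by apply: continuous_comp => //; exact: chart_map_continuous.
have Pc : \forall y \near w, (Phi \o chart_inv c) ((chart_map c \o s) y) = y.
  by apply: filterS2 Ps near_s => y Py cy /=; rewrite (chart_mapK cy).
have [Li [LiE Lid]] := @diff_right_inverse R (Phi \o chart_inv c) (chart_map c \o s) w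
  dPhi inj cc Pc.
exists Li; split => // W F sF.
have dF := smooth_map_differentiable sF cs.
have [d e] := is_diff_comp Lid (differentiableP dF).
have nE : {near w, (F \o chart_inv c) \o (chart_map c \o s) =1 F \o s}.
  by apply: filterS near_s => y cy /=; rewrite (chart_mapK cy).
have [d' e'] := near_eq_is_diff nE d.
by apply: DiffDef; [exact: d'|exact: etrans e' e].
Qed.

(** Along a section the differential of [Phi] is the identity in [w], so the matrix of
    [lewy_matrix_chart] becomes the Jacobian matrix of [(x1, x2)] in [w]; the formula for [z] is
    then [dz = p . dx]. *)
Lemma section_gradient (s : V -> Sigma) w :
  {for w, continuous s} -> (\forall y \near w, Phi (s y) = y) ->
  exists m11 m12 m22 : R, [/\ 0 < m11, 0 < m22, m11 + m22 = 1, 0 < m11 * m22 - m12 * m12 &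
    [/\ is_diff w (x1 \o s) (fun v => m11 * v 0 0 + m12 * v 0 1),
      is_diff w (x2 \o s) (fun v => m12 * v 0 0 + m22 * v 0 1) &
      is_diff w (z \o s) (fun v => p1 (s w) * (m11 * v 0 0 + m12 * v 0 1) +
        p2 (s w) * (m12 * v 0 0 + m22 * v 0 1))]].
Proof.
move=> scont Ps; have cs := chart_atP (s w); set c := chart_at (s w) in cs.
have [Li [LiE _ LiF]] := section_diff scont Ps cs.
have [D0 [m11 [m12 [m22 [[m1 m2 tr det] X]]]]] := lewy_matrix_chart sc g_convex cs.
have L v : chart_diff c Phi1 (s w) (Li v) = v 0 0 /\ chart_diff c Phi2 (s w) (Li v) = v 0 1.
  have := LiE v; rewrite (chart_diff_lewy sc (Li v) cs) => E; split.
    exact: etrans (esym (row2_0 _ _)) (congr1 (fun t : V => t 0 0) E).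
  exact: etrans (esym (row2_1 _ _)) (congr1 (fun t : V => t 0 1) E).
have X1 v : chart_diff c x1 (s w) (Li v) = m11 * v 0 0 + m12 * v 0 1.
  by have [E _] := X (Li v); have [l1 l2] := L v; rewrite E l1 l2.
have X2 v : chart_diff c x2 (s w) (Li v) = m12 * v 0 0 + m22 * v 0 1.
  by have [_ E] := X (Li v); have [l1 l2] := L v; rewrite E l1 l2.
exists m11, m12, m22; split=> //.
  by rewrite det; exact: divr_gt0 (sc_volume_gt0 sc cs) D0.
split.
- have [d e] := LiF _ _ (sc_x1 sc); apply: DiffDef; first exact: d.
  by apply: (etrans e); apply/funext => v; exact: X1.
- have [d e] := LiF _ _ (sc_x2 sc); apply: DiffDef; first exact: d.
  by apply: (etrans e); apply/funext => v; exact: X2.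
- have [d e] := LiF _ _ (sc_z sc); apply: DiffDef; first exact: d.
  apply: (etrans e); apply/funext => v.
  by apply: (etrans (sc_dz sc (Li v) cs)); rewrite X1 X2.
Qed.

(** The inverse function theorem in the preferred chart. [N] accompanies [s] because a value of
    [Phi] may have several preimages: sections are later identified by showing that their values lie
    in [N] and have the same image. *)
Lemma local_section q : exists r : R, exists N : set Sigma, exists s : V -> Sigma,
  [/\ 0 < r, open N, N q,
    forall p p', N p -> N p' -> Phi p = Phi p' -> p = p' &
    forall y, `|y - Phi q| < r -> [/\ N (s y), Phi (s y) = y & {for y, continuous s}]].
Proof.
have cq := chart_atP q; set c := chart_at q in cq.
have oU : open (chart_map c @` chart_dom c) by exact: chart_map_open.
have inj0 v : 'd (Phi \o chart_inv c) (chart_map c q) v = 0 -> v = 0.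
  by move=> E; apply: (lewy_diff_inj sc g_convex cq); exact: E.
have [rho [r [s0 [rho0 r0 rhoU inj s0P]]]] :=
  @inverse_function_local R (chart_map c @` chart_dom c) (Phi \o chart_inv c)
    (chart_map c q) oU (lewy_smooth sc c 1) (ex_intro2 _ _ q cq erefl) inj0.
pose N := [set p | chart_dom c p /\ `|chart_map c p - chart_map c q| < rho].
have PhiE : (Phi \o chart_inv c) (chart_map c q) = Phi q by rewrite /= (chart_mapK cq).
exists r, N, (chart_inv c \o s0); split=> //.
- rewrite openE => p [cp pr].
  have H1 : \forall x \near p, `|chart_map c p - chart_map c x| < rho - `|chart_map c p - chart_map c q|.
    have := chart_map_continuous cp; move/cvgrPdist_lt; apply.
    by rewrite subr_gt0.
  apply: filterS2 (chart_dom_nbhs cp) H1 => x cx xp; split=> //.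
  have -> : chart_map c x - chart_map c q = - (chart_map c p - chart_map c x) + (chart_map c p - chart_map c q).
    by rewrite opprB addrA subrK.
  by rewrite (le_lt_trans (ler_normD _ _)) // normrN -ltrBrDr.
- by split=> //; rewrite subrr normr0.
- move=> p p' [cp pr] [cp' pr'] E.
  rewrite -(chart_mapK cp) -(chart_mapK cp'); congr chart_inv.
  by apply: inj => //=; rewrite !chart_mapK.
- rewrite -PhiE => y /s0P[y1 y2 y3].
  have [q' cq' q'E] := rhoU _ y1.
  have cs : chart_dom c (chart_inv c (s0 y)) by rewrite -q'E chart_mapK.
  split=> //.
    split=> //=; rewrite -q'E chart_mapK // q'E; exact: y1.
  apply: continuous_comp => //.
  by rewrite -q'E; exact: chart_inv_continuous.
Qed.

End lewy_sections.

(** * Curves and lengths *)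

Section curves.
Context {R : realType} {Sigma : orientedSurface R}.
Local Notation V := 'rV[R]_2.
Implicit Types (c d : chart Sigma) (p q : Sigma) (u v w : V).

Definition rate (W : normedModType R) (F : Sigma -> W) (gamma : R -> Sigma) (t : R) : W :=
  'd (F \o gamma : R^o -> W) (t : R^o) (1 : R^o).

Variables (gamma : R -> Sigma) (U : set R).
Hypothesis U_open : open U.
Hypothesis gamma_cont : forall t, U t -> {for t, continuous gamma}.
Hypothesis gamma_C1 : forall c,
  Ck_on 1 (U `&` gamma @^-1` chart_dom c : set R^o) (chart_map c \o gamma : R^o -> V).

Lemma curve_chart_near t c : U t -> chart_dom c (gamma t) ->
  \forall s \near t, U s /\ chart_dom c (gamma s).
Proof.
move=> Ut ct; apply: filterI; first by apply: open_nbhs_nbhs.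
by apply: (gamma_cont Ut); exact: chart_dom_nbhs.
Qed.

Lemma curve_chain (W : normedModType R) (F : Sigma -> W) t c : smooth_map F -> U t ->
  chart_dom c (gamma t) ->
  is_diff (t : R^o) (F \o gamma : R^o -> W)
    (fun r => chart_diff c F (gamma t) ('d (chart_map c \o gamma : R^o -> V) (t : R^o) r)).
Proof.
move=> sF Ut ct.
have dc : differentiable (chart_map c \o gamma : R^o -> V) (t : R^o).
  by have [+ _] := gamma_C1 c; apply; split.
have [d e] := is_diff_comp (differentiableP dc)
  (differentiableP (smooth_map_differentiable sF ct)).
have nE : {near (t : R^o), (F \o chart_inv c) \o (chart_map c \o gamma) =1 (F \o gamma : R^o -> W)}.
  apply: filterS (curve_chart_near Ut ct) => y [_ cy] /=; by rewrite (chart_mapK cy).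
have [d' e'] := near_eq_is_diff nE d.
by apply: DiffDef; [exact: d'|exact: etrans e' e].
Qed.

Lemma rate_chart (W : normedModType R) (F : Sigma -> W) t c : smooth_map F -> U t ->
  chart_dom c (gamma t) ->
  rate F gamma t = chart_diff c F (gamma t) (rate (chart_map c) gamma t).
Proof.
move=> sF Ut ct; have [_ e] := curve_chain sF Ut ct.
exact: (congr1 (fun h : R^o -> W => h 1) e).
Qed.

Lemma rate_differentiable (W : normedModType R) (F : Sigma -> W) t : smooth_map F -> U t ->
  differentiable (F \o gamma : R^o -> W) (t : R^o).
Proof. by move=> sF Ut; have [] := curve_chain sF Ut (chart_atP (gamma t)). Qed.

Lemma velocity_frame t c : U t -> chart_dom c (gamma t) ->
  velocity gamma t = frame c (rate (chart_map c) gamma t) (gamma t).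
Proof.
move=> Ut ct; set q := gamma t; have aq := chart_atP q.
have dc : differentiable (chart_map c \o gamma : R^o -> V) (t : R^o).
  by have [+ _] := gamma_C1 c; apply; split.
have [d e] := is_diff_comp (differentiableP dc)
  (differentiableP (transition_differentiable ct aq)).
have nE : {near (t : R^o), (chart_map (chart_at q) \o chart_inv c) \o (chart_map c \o gamma) =1
    (chart_map (chart_at q) \o gamma : R^o -> V)}.
  apply: filterS (curve_chart_near Ut ct) => y [_ cy] /=; by rewrite (chart_mapK cy).
have [d' e'] := near_eq_is_diff nE d.
exact: (congr1 (fun h : R^o -> V => h 1) (etrans e' e)).
Qed.

(** The basis of [chart_at (gamma t)] may jump with [t]; expanding in one chart, fixed near [t],
    leaves continuous factors only. *)
Lemma rate_continuous (F : Sigma -> R^o) t : smooth_map F -> U t ->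
  {for t, continuous (rate F gamma)}.
Proof.
move=> sF Ut; have ct := chart_atP (gamma t); set c := chart_at (gamma t) in ct.
have rE s : U s -> chart_dom c (gamma s) -> rate F gamma s =
    (rate (chart_map c) gamma s) 0 0 * chart_diff c F (gamma s) (row2 1 0) +
    (rate (chart_map c) gamma s) 0 1 * chart_diff c F (gamma s) (row2 0 1).
  by move=> Us cs; rewrite (rate_chart sF Us cs); exact: chart_diff_row.
have nE : {near t, (fun s => (rate (chart_map c) gamma s) 0 0 * chart_diff c F (gamma s) (row2 1 0) +
    (rate (chart_map c) gamma s) 0 1 * chart_diff c F (gamma s) (row2 0 1)) =1 rate F gamma}.
  by apply: filterS (curve_chart_near Ut ct) => s [Us cs]; rewrite rE.
have cr : {for t, continuous (rate (chart_map c) gamma)}.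
  by have [_ /(_ 1)] := gamma_C1 c; apply; split.
have crc i : {for t, continuous (fun s => (rate (chart_map c) gamma s) 0 i : R)}.
  apply: (@continuous_comp _ _ _ (rate (chart_map c) gamma) (fun N : V => N 0 i : R)) => //.
  exact: coord_continuous.
have cd v : {for t, continuous (fun s => chart_diff c F (gamma s) v : R)}.
  apply: (@continuous_comp _ _ _ (chart_map c \o gamma) (fun u => 'd (F \o chart_inv c) u v : R)).
    by apply: continuous_comp; [exact: gamma_cont|exact: chart_map_continuous].
  by have [_ /(_ v)] := sF c 1%N; apply; exists (gamma t).
apply: (near_eq_continuous nE).
by apply: cvgD; apply: cvgM; [exact: crc|exact: cd|exact: crc|exact: cd].
Qed.

End curves.

(** * Increments and integrals on the unit interval *)

Section length_estimate.
Context {R : realType}.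
Local Notation mu := (@lebesgue_measure R).

Lemma continuous_within_segment (f : R -> R) :
  (forall t, 0 <= t <= 1 -> {for t, continuous f}) -> {within `[0, 1], continuous f}.
Proof.
move=> fc; apply: continuous_in_subspaceT => t; rewrite inE /= in_itv /=.
exact: fc.
Qed.

Lemma segment_integrable (f : R -> R) :
  (forall t, 0 <= t <= 1 -> {for t, continuous f}) ->
  mu.-integrable `[0, 1] (EFin \o f).
Proof.
move=> fc; apply: continuous_compact_integrable; first exact: segment_compact.
exact: continuous_within_segment.
Qed.

(** As the derivative of [h] is only bounded above pointwise, it is not integrated: the fundamental
    theorem for the continuous [f] shows instead that [C] times the running integral of [f], minus
    [h], is nondecreasing. *)
Lemma increment_le_integral (h f : R -> R) (C : R) :
  (forall t, 0 <= t <= 1 -> {for t, continuous f}) ->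
  (forall t : R, 0 <= t <= 1 -> derivable h t 1 /\ h^`()%classic t <= C * f t) ->
  h 1 - h 0 <= C * (\int[mu]_(t in `[0%R, 1%R]) f t)%R.
Proof.
move=> fc hd.
have fi := segment_integrable fc.
pose L (x : R) := (\int[mu]_(t in `[0%R, x]) f t)%R.
have Lc : {within `[0, 1], continuous L}.
  exact: (@parameterized_integral_continuous R 0 1 f ler01 fi).
have L0 : L 0 = 0 by rewrite /L set_itv1 Rintegral_set1.
have Ld t : t \in `]0%R, 1%R[ -> derivable L t 1 /\ L^`()%classic t = f t.
  rewrite in_itv /= => /andP[t0 t1].
  apply: (continuous_FTC1_closed t1 fi t0); apply: fc; by rewrite !ltW.
pose G (x : R) := C * L x - h x.
have hc : {within `[0, 1], continuous h}.
  apply: derivable_within_continuous => t; rewrite in_itv /= => t01.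
  by have [] := hd t t01.
have Gd t : t \in `]0%R, 1%R[ -> derivable G t 1 /\ 0 <= G^`()%classic t.
  move=> t01; have [dL eL] := Ld t t01.
  have t01' : 0 <= t <= 1 by move: t01; rewrite in_itv /= => /andP[? ?]; rewrite !ltW.
  have [dh eh] := hd t t01'.
  have dG : is_derive t 1 G (C * f t - h^`()%classic t).
    rewrite derive1E -eL derive1E.
    apply: is_deriveB; last exact: derivableP.
    exact: (is_deriveZ _ (derivableP dL)).
  by have [d e] := dG; split=> //; rewrite derive1E e subr_ge0.
have Gc : {within `[0, 1], continuous G}.
  move=> x; apply: cvgB; last exact: hc.
  by apply: cvgM; [exact: cvg_cst|exact: Lc].
have := @ger0_derive1_le_cc R G 0 1 (fun t t01 => (Gd t t01).1) (fun t t01 => (Gd t t01).2)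
  Gc 0 1.
rewrite !in_itv /= !lexx ler01 => /(_ isT isT isT).
by rewrite /G L0 mulr0 sub0r; rewrite /L; lra.
Qed.

Lemma integral_le_cst (f : R -> R) (C : R) :
  (forall t, 0 <= t <= 1 -> {for t, continuous f}) ->
  (forall t, 0 <= t <= 1 -> f t <= C) ->
  (\int[mu]_(t in `[0%R, 1%R]) f t)%R <= C.
Proof.
move=> fc fC.
apply: (@le_trans _ _ (\int[mu]_(t in `[0%R, 1%R]) C)%R).
  apply: le_Rintegral => //.
  - exact: segment_integrable.
  - apply: (@segment_integrable (fun=> C)) => t _; exact: cst_continuous.
have mE : mu `[0%R, 1%R]%classic = 1%:E.
  by rewrite lebesgue_measure_itv /= lte_fin ltr01 oppr0 adde0.
suff -> : (\int[mu]_(t in `[0%R, 1%R]) C)%R = C by [].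
transitivity (C * fine (mu `[0%R, 1%R]%classic)); first exact: Rintegral_cst.
by rewrite mE mulr1.
Qed.

End length_estimate.

Lemma sum_prod_eq (R : pzRingType) (a b c d a' b' c' d' : R) :
  a = a' -> b = b' -> c = c' -> d = d' -> a' * b' + c' * d' = a * b + c * d.
Proof. by move=> -> -> -> ->. Qed.

Lemma scaled_sqr_eq (R : pzRingType) (k a b a' b' : R) :
  a = a' -> b = b' -> k * (a' ^+ 2 + b' ^+ 2) = k * (a ^+ 2 + b ^+ 2).
Proof. by move=> -> ->. Qed.

Section metric_length.
Context {R : realType} {Sigma : orientedSurface R}.
Local Notation V := 'rV[R]_2.
Local Notation e1 := (row2 1 0 : V).
Local Notation e2 := (row2 0 1 : V).
Implicit Types (c d : chart Sigma) (p q : Sigma) (u v w : V).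
Variables (g : Sigma -> 'M[R]_2) (x1 x2 z p1 p2 : Sigma -> R^o).
Hypothesis sc : special_coordinates g x1 x2 z p1 p2.
Hypothesis g_convex : positive_definite g.
Local Notation Phi := (lewy x1 x2 p1 p2).
Local Notation Phi1 := (lewy1 x1 p1).
Local Notation Phi2 := (lewy2 x2 p2).

Definition speed (gamma : R -> Sigma) (t : R) : R :=
  Num.sqrt (form2 (g (gamma t)) (velocity gamma t) (velocity gamma t)).

Definition conformal_factor c q : R :=
  coord_jac x1 x2 c q / lewy_jac x1 x2 p1 p2 c q.

(** The factor is [det M <= m11 * m22 <= 1], the diagonal entries being positive with sum 1. *)
Lemma conformal_factor_bounds c q : chart_dom c q -> 0 < conformal_factor c q <= 1.
Proof.
move=> cq.
have [D0 [m11 [m12 [m22 [[m1 m2 tr det] _]]]]] := lewy_matrix_chart sc g_convex cq.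
apply/andP; split; first exact: divr_gt0 (sc_volume_gt0 sc cq) D0.
by rewrite /conformal_factor -det; nra.
Qed.

Section one_curve.
Variables (gamma : R -> Sigma) (U : set R).
Hypothesis U_open : open U.
Hypothesis gamma_cont : forall t, U t -> {for t, continuous gamma}.
Hypothesis gamma_C1 : forall c,
  Ck_on 1 (U `&` gamma @^-1` chart_dom c : set R^o) (chart_map c \o gamma : R^o -> V).

(** The entries of [g] in varying bases need not be continuous, whereas rates of smooth functions
    are; this chart-free form therefore yields continuity of the speed, and the conformal form below
    serves for estimates. *)
Lemma speed_sqr_metric t : U t ->
  form2 (g (gamma t)) (velocity gamma t) (velocity gamma t) =
  rate p1 gamma t * rate x1 gamma t + rate p2 gamma t * rate x2 gamma t.
Proof.
move=> Ut; have ct := chart_atP (gamma t); set c := chart_at (gamma t) in ct.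
have rE (F : Sigma -> R^o) (sF : smooth_map F) := rate_chart U_open gamma_cont gamma_C1 sF Ut ct.
rewrite (velocity_frame U_open gamma_cont gamma_C1 Ut ct) (sc_metric sc _ _ ct).
exact: (sum_prod_eq (rE p1 (sc_p1 sc)) (rE x1 (sc_x1 sc)) (rE p2 (sc_p2 sc)) (rE x2 (sc_x2 sc))).
Qed.

Lemma speed_sqr_conformal t c : U t -> chart_dom c (gamma t) ->
  form2 (g (gamma t)) (velocity gamma t) (velocity gamma t) =
  conformal_factor c (gamma t) * (rate Phi1 gamma t ^+ 2 + rate Phi2 gamma t ^+ 2).
Proof.
move=> Ut ct.
have rE (F : Sigma -> R^o) (sF : smooth_map F) := rate_chart U_open gamma_cont gamma_C1 sF Ut ct.
rewrite (velocity_frame U_open gamma_cont gamma_C1 Ut ct) (metric_conformal sc g_convex _ ct).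
exact: (scaled_sqr_eq _ (rE Phi1 (lewy1_smooth sc)) (rE Phi2 (lewy2_smooth sc))).
Qed.

Lemma speed_continuous t : U t -> {for t, continuous (speed gamma)}.
Proof.
move=> Ut.
have nE : {near t, (fun s => Num.sqrt (rate p1 gamma s * rate x1 gamma s + rate p2 gamma s * rate x2 gamma s))
    =1 speed gamma}.
  have : \forall s \near t, U s by apply: open_nbhs_nbhs.
  by apply: filterS => s Us; rewrite /speed speed_sqr_metric.
apply: (near_eq_continuous nE).
apply: (@continuous_comp _ _ _ (fun s => rate p1 gamma s * rate x1 gamma s + rate p2 gamma s * rate x2 gamma s : R)
  (@Num.sqrt R)); last exact: sqrt_continuous.
have cr (F : Sigma -> R^o) (sF : smooth_map F) := rate_continuous U_open gamma_cont gamma_C1 sF Ut.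
apply: (@cvgD _ R^o); apply: cvgM; apply: cr; [exact: (sc_p1 sc)|exact: (sc_x1 sc)|exact: (sc_p2 sc)|exact: (sc_x2 sc)].
Qed.

End one_curve.

(** The differential of a section is known to exist at each point separately; this Cramer formula
    shows that it varies continuously along a lifted segment. *)
Lemma lewy_solve c q u h : chart_dom c q -> chart_diff c Phi q u = h ->
  u = row2
    ((h 0 0 * chart_diff c Phi2 q e2 - h 0 1 * chart_diff c Phi1 q e2) / lewy_jac x1 x2 p1 p2 c q)
    ((h 0 1 * chart_diff c Phi1 q e1 - h 0 0 * chart_diff c Phi2 q e1) / lewy_jac x1 x2 p1 p2 c q).
Proof.
move=> cq; have [D0 _] := lewy_matrix_chart sc g_convex cq.
rewrite (chart_diff_lewy sc u cq) => <-; rewrite row2_0 row2_1.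
have sol (f1 f1' f2 f2' u0 u1 F1 F2 : R) : 0 < f1 * f2' - f2 * f1' ->
   F1 = u0 * f1 + u1 * f1' -> F2 = u0 * f2 + u1 * f2' ->
   u0 = (F1 * f2' - F2 * f1') / (f1 * f2' - f2 * f1') /\
   u1 = (F2 * f1 - F1 * f2) / (f1 * f2' - f2 * f1').
  by move=> D -> ->; have Dn := lt0r_neq0 D; split; field.
have [s0 s1] := sol _ _ _ _ _ _ _ _ D0 (chart_diff_row c Phi1 q u) (chart_diff_row c Phi2 q u).
by apply: row2P; [rewrite row2_0; exact: s0|rewrite row2_1; exact: s1].
Qed.

Section lifted_segment.
Variables (s : V -> Sigma) (O : set V) (a h : V).
Hypothesis O_open : open O.
Hypothesis s_cont : forall w, O w -> {for w, continuous s}.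
Hypothesis s_section : forall w, O w -> Phi (s w) = w.
Hypothesis segment_sub : forall t : R, 0 <= t <= 1 -> O (a + t *: h).

Let gamma (t : R) := s (a + t *: h).
Let U := [set t : R | O (a + t *: h)].

Let line_continuous : continuous (fun t : R => a + t *: h).
Proof.
move=> t; apply: differentiable_continuous.
apply: differentiableD; first exact: differentiable_cst.
exact: (@ex_diff _ _ _ _ _ _ _ (is_diff_scalel _ _)).
Qed.

Let U_open : open U.
Proof.
have -> : U = (fun t : R => a + t *: h) @^-1` O by [].
by apply: open_comp => // t _; exact: line_continuous.
Qed.

Let gamma_cont t : U t -> {for t, continuous gamma}.
Proof.
move=> Ut; apply: (@continuous_comp _ _ _ (fun t : R => a + t *: h) s).
  exact: line_continuous.
exact: s_cont.
Qed.

Let near_section w : O w -> \forall y \near w, Phi (s y) = y.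
Proof.
move=> Ow; have : \forall y \near w, O y by apply: open_nbhs_nbhs.
by apply: filterS => y; exact: s_section.
Qed.

Let line_diff t : is_diff (t : R^o) (fun t : R^o => a + t *: h) (fun r => r *: h).
Proof.
have := @is_diffD R R^o V (cst a) (fun s : R^o => s *: h) 0 (fun s => s *: h) t _ _.
by rewrite add0r; apply.
Qed.

Let chart_velocity c q : V := row2
    ((h 0 0 * chart_diff c Phi2 q e2 - h 0 1 * chart_diff c Phi1 q e2) / lewy_jac x1 x2 p1 p2 c q)
    ((h 0 1 * chart_diff c Phi1 q e1 - h 0 0 * chart_diff c Phi2 q e1) / lewy_jac x1 x2 p1 p2 c q).

Let gamma_chart_diff t c : U t -> chart_dom c (gamma t) ->
  is_diff (t : R^o) (chart_map c \o gamma : R^o -> V) (fun r => r *: chart_velocity c (gamma t)).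
Proof.
move=> Ut ct.
have [Li [LiE Lid _]] := section_diff sc g_convex (s_cont Ut) (near_section Ut) ct.
have [d e] := is_diff_comp (line_diff t) Lid.
apply: DiffDef; first exact: d.
apply: (etrans e); apply/funext => r.
rewrite -[LHS]/(Li ((r : R) *: h)) linearZ /=; congr (_ *: _).
exact: lewy_solve ct (LiE h).
Qed.

Let gamma_C1 c :
  Ck_on 1 (U `&` gamma @^-1` chart_dom c : set R^o) (chart_map c \o gamma : R^o -> V).
Proof.
split=> [t [Ut ct]|r t [Ut ct]]; first by have [] := gamma_chart_diff Ut ct.
have nE : {near t, (fun y => r *: chart_velocity c (gamma y)) =1
    (fun y : R^o => 'd (chart_map c \o gamma : R^o -> V) y r)}.
  apply: filterS (curve_chart_near U_open gamma_cont Ut ct) => y [Uy cy].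
  by have [_ e] := gamma_chart_diff Uy cy; exact: esym (congr1 (fun k : R^o -> V => k r) e).
apply: (near_eq_continuous nE).
have cd (F : Sigma -> R^o) v : smooth_map F -> {for t, continuous (fun y => chart_diff c F (gamma y) v : R)}.
  move=> sF.
  apply: (@continuous_comp _ _ _ (chart_map c \o gamma) (fun u => 'd (F \o chart_inv c) u v : R)).
    by apply: continuous_comp; [exact: gamma_cont|exact: chart_map_continuous].
  by have [_ /(_ v)] := sF c 1%N; apply; exists (gamma t).
have s1 := lewy1_smooth sc; have s2 := lewy2_smooth sc.
have [D0 _] := lewy_matrix_chart sc g_convex ct.
have cD : {for t, continuous (fun y => (lewy_jac x1 x2 p1 p2 c (gamma y))^-1 : R)}.
  apply: cvgV; first by rewrite gt_eqF.
  by apply: (@cvgB _ R^o); apply: cvgM; exact: cd.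
apply: (@cvgZr _ V); apply: rV_cvg => i; case: i => [[|[|//]] ilt] /=.
  under eq_fun do rewrite mxE /=.
  rewrite mxE /=; apply: cvgM => //.
  by apply: (@cvgB _ R^o); apply: cvgM; [exact: cvg_cst|exact: cd|exact: cvg_cst|exact: cd].
under eq_fun do rewrite mxE /=.
rewrite mxE /=; apply: cvgM => //.
by apply: (@cvgB _ R^o); apply: cvgM; [exact: cvg_cst|exact: cd|exact: cvg_cst|exact: cd].
Qed.

Let rate_Phi t : U t -> rate Phi1 gamma t = h 0 0 /\ rate Phi2 gamma t = h 0 1.
Proof.
move=> Ut.
have [d e] := line_diff t.
have nE : {near (t : R^o), (fun t : R^o => a + t *: h) =1 (Phi \o gamma : R^o -> V)}.
  have : \forall y \near t, U y by apply: open_nbhs_nbhs.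
  by apply: filterS => y Uy; rewrite /= /gamma s_section.
have [d' e'] := near_eq_is_diff nE d.
have E : rate Phi gamma t = h.
  by apply: (etrans (congr1 (fun k : R^o -> V => k 1) (etrans e' e))); rewrite scale1r.
have E0 := @diff_coord R R^o 2 (Phi \o gamma) 0 t 1 d'.
have E1 := @diff_coord R R^o 2 (Phi \o gamma) 1 t 1 d'.
have F0 : (fun y : R^o => (Phi \o gamma) y 0 0 : R^o) = (Phi1 \o gamma : R^o -> R^o).
  by apply/funext => y; rewrite /= row2_0.
have F1 : (fun y : R^o => (Phi \o gamma) y 0 1 : R^o) = (Phi2 \o gamma : R^o -> R^o).
  by apply/funext => y; rewrite /= row2_1.
rewrite F0 in E0; rewrite F1 in E1.
split; first exact: etrans E0 (congr1 (fun k : V => k 0 0) E).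
exact: etrans E1 (congr1 (fun k : V => k 0 1) E).
Qed.

(** Along the lift the rates of [Phi] are the components of [h], and the conformal factor is at most
    1, so the speed is at most the Euclidean norm of [h]. The factor 2, a crude form of [sqrt 2],
    passes to the maximum norm. *)
Lemma lifted_segment_length : exists2 l : R, l <= 2 * `|h| &
  piecewise_C1_length g (s a) (s (a + h)) l.
Proof.
have C1 : C1_curve gamma.
  by exists U; split.
exists (curve_length g gamma + 0); last first.
  have := PiecewiseCons C1 (PiecewiseNil g (gamma 1)).
  by rewrite /gamma scale0r addr0 scale1r.
rewrite addr0; apply: (@integral_le_cst R (speed gamma)) => t t01.
  exact: (speed_continuous U_open gamma_cont gamma_C1 (segment_sub t01)).
have Ut : U t := segment_sub t01.
have ct := chart_atP (gamma t).
rewrite /speed (speed_sqr_conformal U_open gamma_cont gamma_C1 Ut ct).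
have [-> ->] := rate_Phi Ut.
have /andP[k0 k1] := conformal_factor_bounds ct.
have := rV_coord_le h 0; have := rV_coord_le h 1; rewrite !ler_norml.
move: k0 k1; move: (conformal_factor _ _) (h 0 0) (h 0 1) `|h| (normr_ge0 h).
move=> k b0 b1 n n0 k0 k1 /andP[? ?] /andP[? ?].
have n2 : 0 <= 2 * n by rewrite mulr_ge0.
rewrite -(ger0_norm n2) -sqrtr_sqr ler_wsqrtr //.
have b0n : b0 ^+ 2 <= n ^+ 2 by nra.
have b1n : b1 ^+ 2 <= n ^+ 2 by nra.
rewrite exprMn; move: (sqr_ge0 b0) (sqr_ge0 b1) b0n b1n.
by move: (b0 ^+ 2) (b1 ^+ 2) (n ^+ 2) => *; nra.
Qed.

End lifted_segment.

End metric_length.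

(** * A differentiable truncated profile *)

Section bump.
Context {R : realType}.

Lemma eps_is_derive (h : R -> R) (c d : R) :
  (forall e : R, 0 < e -> \forall k \near (0 : R), `|h (c + k) - h c - k * d| <= e * `|k|) ->
  is_derive c 1 h d.
Proof.
move=> hd.
have [dl el] := @is_diff_scalel R R^o 0 (d : R^o).
have [d1 e1] : is_diff (c : R^o) (h : R^o -> R^o) ('d ( *:%R ^~ d : R^o -> R^o) (0 : R^o)).
  apply: is_diff_eps; first exact: diff_continuous.
  by move=> e e0; have := hd e e0; rewrite el.
have := diff_is_derive (1 : R^o) d1.
by rewrite e1 el /= scale1r.
Qed.

Lemma sqr_max0_taylor (y k : R) :
  `|Num.max 0 (y + k) ^+ 2 - Num.max 0 y ^+ 2 - k * (2 * Num.max 0 y)| <= `|k| ^+ 2.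
Proof.
rewrite real_normK ?num_real //.
have E (a b : R) : 0 <= a -> a <= b -> `|a| <= b by move=> a0; rewrite ger0_norm.
have [y0|y0] := leP 0 y; have [z0|z0] := leP 0 (y + k); apply: E; nra.
Qed.

(** Squaring removes the corner of the truncation: the first-order remainder is at most [|k|^2] even
    across 0. The bump below thus stays differentiable where it begins to vanish. *)
Lemma is_derive_sqr_max0 (y : R) :
  is_derive y 1 (fun x : R => Num.max 0 x ^+ 2) (2 * Num.max 0 y).
Proof.
apply: eps_is_derive => e e0; apply/nbhs_ballP; exists e => // k.
rewrite -ball_normE /= sub0r normrN => ke.
rewrite (le_trans (sqr_max0_taylor y k)) // expr2 ler_wpM2r //.
exact: ltW.
Qed.

(* The factor 8 is 2 (from the square) * 2 (from |f - b|^2) * 2 (from |r1| + |r2|). *)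
Lemma bump_rate_le (rho s2 k k0 a b r1 r2 : R) : 0 < rho -> 0 < k0 -> k0 <= k ->
  s2 = Num.sqrt (k * (r1 ^+ 2 + r2 ^+ 2)) ->
  2 * Num.max 0 (rho ^+ 2 - (a ^+ 2 + b ^+ 2)) * (- (2 * a * r1 + 2 * b * r2)) <=
  8 * rho ^+ 3 / Num.sqrt k0 * s2.
Proof.
move=> rho0 k00 k0k ->.
have sk0 : 0 < Num.sqrt k0 by rewrite sqrtr_gt0.
have r1s (x y : R) : `|x| * Num.sqrt k0 <= Num.sqrt (k * (x ^+ 2 + y ^+ 2)).
  rewrite -sqrtr_sqr -sqrtrM ?sqr_ge0 // ler_wsqrtr // mulrC.
  apply: (@le_trans _ _ (k * x ^+ 2)); first by rewrite ler_wpM2r // sqr_ge0.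
  rewrite ler_wpM2l ?lerDl ?sqr_ge0 //; exact: le_trans (ltW k00) k0k.
have h1 := r1s r1 r2; have h2 := r1s r2 r1; rewrite [r2 ^+ 2 + _]addrC in h2.
move: h1 h2; set S := Num.sqrt (k * _); set sk := Num.sqrt k0 in sk0 *.
have S0 : 0 <= S by exact: sqrtr_ge0.
move=> h1 h2; rewrite -ler_pdivlMr // in h1; rewrite -ler_pdivlMr // in h2.
rewrite [leRHS]mulrAC -[leRHS]mulrA; move: h1 h2.
have T0 : 0 <= S / sk by rewrite divr_ge0 // ltW.
move: (S / sk) T0 => T T0; rewrite !ler_norml => /andP[l1 u1] /andP[l2 u2].
have [m0|m0] := leP (rho ^+ 2 - (a ^+ 2 + b ^+ 2)) 0.
  have r3 : 0 <= rho ^+ 3 by rewrite exprn_ge0 // ltW.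
  rewrite mulr0 mul0r; apply: mulr_ge0 => //; exact: mulr_ge0.
have a2 : a ^+ 2 <= rho ^+ 2 by have := sqr_ge0 b; lra.
have b2 : b ^+ 2 <= rho ^+ 2 by have := sqr_ge0 a; lra.
have sq (x : R) : x ^+ 2 <= rho ^+ 2 -> -rho <= x <= rho by move=> ?; apply/andP; split; nra.
have /andP[a1 a1'] := sq a a2; have /andP[b1 b1'] := sq b b2.
have q : - (2 * a * r1 + 2 * b * r2) <= 4 * rho * T.
  have : - (a * r1) <= rho * T by nra.
  have : - (b * r2) <= rho * T by nra.
  by lra.
have m1 : rho ^+ 2 - (a ^+ 2 + b ^+ 2) <= rho ^+ 2.
  by have := sqr_ge0 a; have := sqr_ge0 b; lra.
have rT : 0 <= 4 * rho * T by rewrite !mulr_ge0 // ltW.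
apply: (@le_trans _ _ (2 * (rho ^+ 2 - (a ^+ 2 + b ^+ 2)) * (4 * rho * T))).
  by rewrite ler_wpM2l // mulr_ge0 // ltW.
apply: (@le_trans _ _ (2 * rho ^+ 2 * (4 * rho * T))).
  by rewrite ler_wpM2r // ler_wpM2l.
by rewrite le_eqVlt; apply/orP; left; apply/eqP; ring.
Qed.

End bump.

(** * The topology of the Riemannian distance *)

Lemma sum_sqr_lt (R : realFieldType) (x y rho : R) : 0 < rho ->
  0 < rho ^+ 2 - (x ^+ 2 + y ^+ 2) -> `|x| <= rho /\ `|y| <= rho.
Proof.
move=> rho0 h.
have x2 : x ^+ 2 <= rho ^+ 2 by have := sqr_ge0 y; lra.
have y2 : y ^+ 2 <= rho ^+ 2 by have := sqr_ge0 x; lra.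
by rewrite !ler_norml; split; apply/andP; split; nra.
Qed.

Section distance_topology.
Context {R : realType} {Sigma : orientedSurface R}.
Local Notation V := 'rV[R]_2.
Local Notation e1 := (row2 1 0 : V).
Local Notation e2 := (row2 0 1 : V).
Implicit Types (c d : chart Sigma) (p q : Sigma) (u v w : V).
Variables (g : Sigma -> 'M[R]_2) (x1 x2 z p1 p2 : Sigma -> R^o).
Hypothesis sc : special_coordinates g x1 x2 z p1 p2.
Hypothesis g_convex : positive_definite g.
Local Notation Phi := (lewy x1 x2 p1 p2).
Local Notation Phi1 := (lewy1 x1 p1).
Local Notation Phi2 := (lewy2 x2 p2).

Lemma smooth_map_continuous (W : normedModType R) (F : Sigma -> W) q :
  smooth_map F -> {for q, continuous F}.
Proof.
move=> sF; have cq := chart_atP q; set c := chart_at q in cq.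
have nE : {near q, (F \o chart_inv c) \o chart_map c =1 F}.
  by apply: filterS (chart_dom_nbhs cq) => p cp /=; rewrite (chart_mapK cp).
apply: (near_eq_continuous nE).
apply: continuous_comp; first exact: chart_map_continuous.
exact: differentiable_continuous (smooth_map_differentiable sF cq).
Qed.

Lemma lewy_continuous q : {for q, continuous Phi}.
Proof. exact: smooth_map_continuous (lewy_smooth sc). Qed.

Lemma conformal_factor_continuous c q : chart_dom c q ->
  {for q, continuous (conformal_factor x1 x2 p1 p2 c)}.
Proof.
move=> cq.
have cd (F : Sigma -> R^o) v : smooth_map F -> {for q, continuous (fun y => chart_diff c F y v : R)}.
  move=> sF.
  apply: (@continuous_comp _ _ _ (chart_map c) (fun u => 'd (F \o chart_inv c) u v : R)).
    exact: chart_map_continuous.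
  by have [_ /(_ v)] := sF c 1%N; apply; exists q.
have s1 := lewy1_smooth sc; have s2 := lewy2_smooth sc.
have [D0 _] := lewy_matrix_chart sc g_convex cq.
apply: cvgM.
  by apply: (@cvgB _ R^o); apply: cvgM; apply: cd; first [exact: sc_x1 sc|exact: sc_x2 sc].
apply: cvgV; first by rewrite gt_eqF.
by apply: (@cvgB _ R^o); apply: cvgM; exact: cd.
Qed.

Section bump_function.
Variables (q : Sigma) (r rho k0 : R) (N : set Sigma) (s : V -> Sigma).
Hypothesis r_gt0 : 0 < r.
Hypothesis rho_gt0 : 0 < rho.
Hypothesis rho_lt : rho < r.
Hypothesis k0_gt0 : 0 < k0.
Hypothesis N_open : open N.
Hypothesis N_inj : forall p p', N p -> N p' -> Phi p = Phi p' -> p = p'.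
Hypothesis N_chart : forall p, N p -> exists2 c, chart_dom c p &
  k0 <= conformal_factor x1 x2 p1 p2 c p.
Hypothesis s_section : forall y, `|y - Phi q| < r ->
  [/\ N (s y), Phi (s y) = y & {for y, continuous s}].
Hypothesis Nq : N q.

(** The image of [s] over the ball of radius [r], described by an equation that makes openness a
    consequence of injectivity on [N]. *)
Let sheet := [set p | `|Phi p - Phi q| < r /\ s (Phi p) = p].

Let sheet_open : open sheet.
Proof.
rewrite openE => p [pr pE].
have [Np _ _] := s_section pr; rewrite pE in Np.
have H1 : \forall p' \near p, N p' by apply: open_nbhs_nbhs.
have H2 : \forall p' \near p, `|Phi p - Phi p'| < r - `|Phi p - Phi q|.
  have := @lewy_continuous p; move/cvgrPdist_lt; apply.
  by rewrite subr_gt0.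
apply: filterS2 H1 H2 => p' Np' pp'.
have p'r : `|Phi p' - Phi q| < r.
  have -> : Phi p' - Phi q = - (Phi p - Phi p') + (Phi p - Phi q).
    by rewrite opprB addrA subrK.
  by rewrite (le_lt_trans (ler_normD _ _)) // normrN -ltrBrDr.
have [Ns sE _] := s_section p'r.
by split=> //; exact: N_inj.
Qed.

(** Compact, hence closed in a Hausdorff space. It lies in the open [sheet] and contains the support
    of the bump, so extension by 0 remains differentiable along curves. *)
Let core := s @` [set y | `|y - Phi q| <= rho].

Let core_closed : closed core.
Proof.
apply: compact_closed; first exact: surface_hausdorff.
apply: continuous_compact; last exact: rV_closed_ball_compact.
apply: continuous_in_subspaceT => y; rewrite inE /= => yr.
by have [_ _] := s_section (le_lt_trans yr rho_lt).
Qed.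

Let profile (y : V) : R :=
  Num.max 0 (rho ^+ 2 - ((y 0 0 - Phi1 q) ^+ 2 + (y 0 1 - Phi2 q) ^+ 2)) ^+ 2.

Let bump p : R := if pselect (sheet p) then profile (Phi p) else 0.

Let bump_sheet p : sheet p -> bump p = profile (row2 (Phi1 p) (Phi2 p)).
Proof. by rewrite /bump; case: pselect. Qed.

Let bump_off_core p : ~ core p -> bump p = 0.
Proof.
move=> np; rewrite /bump; case: pselect => // -[pr pE].
rewrite /profile /lewy !row2_0 !row2_1.
have [h|h] := leP (rho ^+ 2 - ((Phi1 p - Phi1 q) ^+ 2 + (Phi2 p - Phi2 q) ^+ 2)) 0.
  by rewrite expr0n.
exfalso; apply: np; exists (Phi p) => //=.
have [l1 l2] := sum_sqr_lt rho_gt0 h.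
apply: rV_norm_le; first exact: ltW.
case=> [[|[|//]] ilt]; rewrite !mxE /=; [exact: l1|exact: l2].
Qed.

(** In [sheet] the chain rule and [bump_rate_le] bound the derivative by the speed; elsewhere the
    curve is outside [core], and the bump vanishes at nearby parameters. *)
Let bump_curve (gamma : R -> Sigma) : C1_curve gamma ->
  bump (gamma 1) - bump (gamma 0) <= 8 * rho ^+ 3 / Num.sqrt k0 * curve_length g gamma.
Proof.
move=> [U [U_open segU gamma_cont gamma_C1]].
have Ut t : 0 <= t <= 1 -> U t by move=> t01; apply: segU; rewrite /= in_itv.
set C := 8 * rho ^+ 3 / Num.sqrt k0.
apply: (@increment_le_integral R (bump \o gamma) (speed g gamma) C).
  by move=> t /Ut U_t; exact: (speed_continuous sc U_open gamma_cont gamma_C1 U_t).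
move=> t /Ut U_t.
have sp0 : 0 <= speed g gamma t by exact: sqrtr_ge0.
suff [dd [dE dC]] : exists dd, is_derive t 1 (bump \o gamma) dd /\ dd <= C * speed g gamma t.
  by have [d1 d2] := dE; split; [exact: d1|rewrite derive1E d2].
have C0 : 0 <= C.
  by apply: divr_ge0; [apply: mulr_ge0 => //; rewrite exprn_ge0 // ltW|exact: sqrtr_ge0].
have [St|nSt] := pselect (sheet (gamma t)); last first.
  have nK : ~ core (gamma t).
    move=> [y yr yE]; apply: nSt; rewrite /sheet /= -yE.
    have yr' := le_lt_trans yr rho_lt.
    by have [_ sE _] := s_section yr'; rewrite sE.
  exists 0; split; last exact: mulr_ge0.
  have nE : {near t, (fun=> 0 : R) =1 bump \o gamma}.
    have : \forall y \near t, (~` core) (gamma y).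
      apply: (gamma_cont _ U_t); apply: open_nbhs_nbhs; split => //.
      exact: closed_openC.
    by apply: filterS => y ny /=; rewrite bump_off_core.
  exact: (near_eq_is_derive nE (is_derive_cst (0 : R^o) t 1)).
have nS : \forall y \near t, sheet (gamma y).
  by apply: (gamma_cont _ U_t); apply: open_nbhs_nbhs.
pose A y := rho ^+ 2 - ((Phi1 (gamma y) - Phi1 q) ^+ 2 + (Phi2 (gamma y) - Phi2 q) ^+ 2).
have dPhi1 : is_derive t 1 (Phi1 \o gamma) (rate Phi1 gamma t).
  exact: diff_is_derive (rate_differentiable U_open gamma_cont gamma_C1 (lewy1_smooth sc) U_t).
have dPhi2 : is_derive t 1 (Phi2 \o gamma) (rate Phi2 gamma t).
  exact: diff_is_derive (rate_differentiable U_open gamma_cont gamma_C1 (lewy2_smooth sc) U_t).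
have dA : is_derive t 1 A (- (2 * (Phi1 (gamma t) - Phi1 q) * rate Phi1 gamma t +
    2 * (Phi2 (gamma t) - Phi2 q) * rate Phi2 gamma t)).
  have D (f : R -> R) (b df : R) : is_derive t 1 f df ->
      is_derive t 1 (fun y => (f y - b) ^+ 2) (2 * (f t - b) * df).
    by move=> fd; apply: is_derive_eq; rewrite /GRing.scale /= subr0; ring.
  have := is_deriveB (is_derive_cst (rho ^+ 2 : R^o) t 1)
    (is_deriveD (D _ (Phi1 q) _ dPhi1) (D _ (Phi2 q) _ dPhi2)).
  by rewrite sub0r; apply.
have dB := @is_derive1_comp R (fun x => Num.max 0 x ^+ 2) A t _ _ (is_derive_sqr_max0 (A t)) dA.
exists (2 * Num.max 0 (A t) * (- (2 * (Phi1 (gamma t) - Phi1 q) * rate Phi1 gamma t +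
    2 * (Phi2 (gamma t) - Phi2 q) * rate Phi2 gamma t))); split.
  have nE : {near t, (fun x => Num.max 0 x ^+ 2) \o A =1 bump \o gamma}.
    apply: filterS nS => y Sy /=; rewrite bump_sheet // /profile row2_0 row2_1.
    by [].
  exact: (near_eq_is_derive nE dB).
have [Np sE _] := s_section St.1; rewrite St.2 in Np.
have [c cp kc] := N_chart Np.
have spE := congr1 (@Num.sqrt R)
  (speed_sqr_conformal sc g_convex U_open gamma_cont gamma_C1 U_t cp).
exact: (@bump_rate_le R rho (speed g gamma t) _ k0 (Phi1 (gamma t) - Phi1 q)
  (Phi2 (gamma t) - Phi2 q) _ _ rho_gt0 k0_gt0 kc spE).
Qed.

Let bump_piecewise p p' l : piecewise_C1_length g p p' l ->
  bump p' - bump p <= 8 * rho ^+ 3 / Num.sqrt k0 * l.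
Proof.
elim=> [x|gamma x l' C1 _ IH]; first by rewrite subrr mulr0.
rewrite mulrDr; apply: (le_trans _ (lerD (bump_curve C1) IH)).
by move: (bump x) (bump (gamma 1)) (bump (gamma 0)) => a b b'; lra.
Qed.

(** The bump is [rho^4] at [q] and vanishes off [sheet], which lies in [N]. A curve reaching [q]
    from outside must raise it by [rho^4], at the cost of length at least [rho^4 / C]. *)
Lemma short_dist_sheet : exists2 e : R, 0 < e &
  forall p, (riemannian_dist g p q < e%:E)%E -> N p.
Proof.
set C := 8 * rho ^+ 3 / Num.sqrt k0.
have C0 : 0 < C.
  by apply: divr_gt0; [apply: mulr_gt0 => //; rewrite exprn_gt0|rewrite sqrtr_gt0].
have sheetq : sheet q.
  have q0 : `|Phi q - Phi q| < r by rewrite subrr normr0.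
  by split=> //; have [Ns sE _] := s_section q0; exact: N_inj.
have bq : bump q = rho ^+ 4.
  rewrite bump_sheet // /profile row2_0 row2_1 !subrr expr0n /= addr0 subr0.
  by rewrite max_r ?sqr_ge0 // -exprM.
exists (rho ^+ 4 / C); first by rewrite divr_gt0 // exprn_gt0.
move=> p /ereal_inf_lt[_ [l pl <-]]; rewrite lte_fin ltr_pdivlMr // => lC.
have := bump_piecewise pl; rewrite bq -/C => H.
have bp : 0 < bump p by move: H lC; rewrite mulrC; move: (bump p) (rho ^+ 4) (l * C) => *; lra.
have [[pr pE]|nS] := pselect (sheet p).
  by have [Ns _ _] := s_section pr; rewrite pE in Ns.
by move: bp; rewrite /bump; case: pselect => // ?; rewrite ltxx.
Qed.

End bump_function.

(** It turns limits for the Riemannian distance into limits in the topology. The bump argument is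
    run on a sheet where the conformal factor stays above half its value at [q]. *)
Lemma riemannian_dist_nbhs q (N : set Sigma) : nbhs q N -> exists2 e : R, 0 < e &
  forall p, (riemannian_dist g p q < e%:E)%E -> N p.
Proof.
move=> Nq.
have [r [N0 [s [r0 N0o N0q N0inj sP]]]] := local_section sc g_convex q.
have cq := chart_atP q; set c := chart_at q in cq.
have /andP[k0 _] := conformal_factor_bounds sc g_convex cq.
set k := conformal_factor _ _ _ _ c q in k0.
have Hk : \forall p \near q, k / 2 < conformal_factor x1 x2 p1 p2 c p.
  have := conformal_factor_continuous cq; move/cvgrPdist_lt => /(_ (k / 2)).
  rewrite divr_gt0 // => /(_ isT); apply: filterS => p; rewrite -/k ltr_norml => /andP[_].
  by move: (conformal_factor _ _ _ _ _ _) => y; lra.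
have H0 : \forall p \near q, N0 p by apply: open_nbhs_nbhs.
have HN : nbhs q (interior (N `&` N0 `&` chart_dom c `&` [set p | k / 2 < conformal_factor x1 x2 p1 p2 c p])).
  apply: nbhs_interior; apply: filterI => //; apply: filterI; last exact: chart_dom_nbhs.
  exact: filterI.
set N1 := interior _ in HN.
have N1sub p : N1 p -> [/\ N p, N0 p, chart_dom c p & k / 2 < conformal_factor x1 x2 p1 p2 c p].
  by move=> /interior_subset [[[? ?] ?] ?].
have q0 : `|Phi q - Phi q| < r by rewrite subrr normr0.
have [Ns0 sE sc0] := sP _ q0.
have sq : s (Phi q) = q by exact: N0inj.
have HS : \forall y \near Phi q, N1 (s y).
  by apply: sc0; rewrite sq.
have [r1 /= r10 Hr1] := (nbhs_ballP _ _).1 HS.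
pose r2 := Num.min r r1.
have r20 : 0 < r2 by rewrite lt_min r0.
have N1inj p p' : N1 p -> N1 p' -> Phi p = Phi p' -> p = p'.
  by move=> /N1sub[_ n _ _] /N1sub[_ n' _ _]; exact: N0inj.
have N1chart p : N1 p -> exists2 c, chart_dom c p & k / 2 <= conformal_factor x1 x2 p1 p2 c p.
  by move=> /N1sub[_ _ cp kp]; exists c; [exact: cp|exact: ltW kp].
have N1s y : `|y - Phi q| < r2 -> [/\ N1 (s y), Phi (s y) = y & {for y, continuous s}].
  rewrite lt_min => /andP[yr yr1]; have [_ ? ?] := sP y yr; split=> //.
  by apply: Hr1; rewrite -ball_normE /= distrC.
have k20 : 0 < k / 2 by rewrite divr_gt0.
have r22 : 0 < r2 / 2 by rewrite divr_gt0.
have r2r : r2 / 2 < r2 by rewrite ltr_pdivrMr // ltr_pMr // ltr1n.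
have [e e0 He] := short_dist_sheet r20 r22 r2r k20 (@open_interior _ _) N1inj N1chart N1s
  (nbhs_singleton HN).
by exists e => // p /He /N1sub[].
Qed.

End distance_topology.

(** * The global section of the Lewy transform *)

Lemma ball_segment (R : realType) (V : normedModType R) (a b c : V) (r t : R) :
  `|a - c| < r -> `|b - c| < r -> 0 <= t <= 1 -> `|a + t *: (b - a) - c| < r.
Proof.
move=> ar br /andP[t0 t1].
have -> : a + t *: (b - a) - c = (1 - t) *: (a - c) + t *: (b - c).
  have -> : t *: (b - a) = t *: (b - c) - t *: (a - c).
    by rewrite -scalerBr opprB addrA subrK.
  rewrite scalerBl scale1r addrAC -[RHS]addrA; congr (_ + _).
  by rewrite addrC.
rewrite (le_lt_trans (ler_normD _ _)) // !normrZ !ger0_norm ?subr_ge0 //.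
move: ar br; move: `|a - c| `|b - c| => x y xr yr; have [xy|xy] := leP x y; nra.
Qed.

Section global_section.
Context {R : realType} {Sigma : orientedSurface R}.
Local Notation V := 'rV[R]_2.
Implicit Types (c d : chart Sigma) (p q : Sigma) (u v w : V).
Variables (g : Sigma -> 'M[R]_2) (x1 x2 z p1 p2 : Sigma -> R^o).
Hypothesis sc : special_coordinates g x1 x2 z p1 p2.
Hypothesis g_convex : positive_definite g.
Local Notation Phi := (lewy x1 x2 p1 p2).

(** Unique path lifting by connectedness of the interval: the set of agreement is open by local
    injectivity of [Phi] and closed by the Hausdorff property. *)
Lemma path_unique (gamma1 gamma2 : R -> Sigma) :
  (forall t, 0 <= t <= 1 -> {for t, continuous gamma1}) ->
  (forall t, 0 <= t <= 1 -> {for t, continuous gamma2}) ->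
  (forall t, 0 <= t <= 1 -> Phi (gamma1 t) = Phi (gamma2 t)) ->
  gamma1 0 = gamma2 0 -> gamma1 1 = gamma2 1.
Proof.
move=> c1 c2 PE E0.
pose I := `[0%R, 1%R]%classic : set R.
pose B := [set t | I t /\ gamma1 t = gamma2 t].
have I01 t : I t -> 0 <= t <= 1 by rewrite /I /= in_itv.
suff BI : B = I.
  have : I 1 by rewrite /I /= in_itv /= ler01 lexx.
  by rewrite -BI => -[].
apply: (@segment_connected R 0 1 B).
- by exists 0; split => //; rewrite /I /= in_itv /= lexx ler01.
- exists (interior [set t | I t -> gamma1 t = gamma2 t]); first exact: open_interior.
  apply/seteqP; split=> [t [It tE]|t [It /interior_subset]]; last by move=> /(_ It).
  split=> //.
  have [r [N [s [_ oN Nq inj _]]]] := local_section sc g_convex (gamma1 t).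
  have nN : nbhs (gamma1 t) N by apply: open_nbhs_nbhs.
  have H1 : \forall y \near t, N (gamma1 y) by apply: (c1 t (I01 t It)).
  have H2 : \forall y \near t, N (gamma2 y).
    by apply: (c2 t (I01 t It)); rewrite /= -tE.
  apply: filterS2 H1 H2 => y N1 N2 Iy; apply: inj => //.
  by apply: PE; exact: I01.
- exists (closure B); first exact: closed_closure.
  apply/seteqP; split=> [t Bt|t [It clt]]; first by split; [case: Bt|exact: subset_closure].
  split=> //; have [//|ne] := pselect (gamma1 t = gamma2 t).
  have := @surface_hausdorff R Sigma; rewrite open_hausdorff.
  move=> /(_ _ _ (introN eqP ne))[[A1 A2] /= [A1m A2m] [A1o A2o /eqP dis]].
  have H1 : \forall y \near t, A1 (gamma1 y).
    apply: (c1 t (I01 t It)); apply: open_nbhs_nbhs; split => //; exact: set_mem.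
  have H2 : \forall y \near t, A2 (gamma2 y).
    apply: (c2 t (I01 t It)); apply: open_nbhs_nbhs; split => //; exact: set_mem.
  have [y [[_ yE] [y1 y2]]] := clt _ (filterI H1 H2).
  exfalso; have : (A1 `&` A2) (gamma1 y) by split => //; rewrite yE.
  by rewrite dis.
Qed.

Lemma section_unique (s1 s2 : V -> Sigma) (a h : V) :
  (forall t : R, 0 <= t <= 1 -> {for a + t *: h, continuous s1}) ->
  (forall t : R, 0 <= t <= 1 -> {for a + t *: h, continuous s2}) ->
  (forall t : R, 0 <= t <= 1 -> Phi (s1 (a + t *: h)) = Phi (s2 (a + t *: h))) ->
  s1 a = s2 a -> s1 (a + h) = s2 (a + h).
Proof.
move=> c1 c2 PE E0.
have lc : continuous (fun t : R => a + t *: h).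
  move=> t; apply: differentiable_continuous.
  apply: differentiableD; first exact: differentiable_cst.
  exact: (@ex_diff _ _ _ _ _ _ _ (is_diff_scalel _ _)).
have cc (s : V -> Sigma) t : {for a + t *: h, continuous s} ->
    {for t, continuous (fun t : R => s (a + t *: h))}.
  move=> cs; apply: (@continuous_comp _ _ _ (fun t : R => a + t *: h) s) => //.
  exact: lc.
have := @path_unique (fun t => s1 (a + t *: h)) (fun t => s2 (a + t *: h))
  (fun t t01 => cc s1 t (c1 t t01)) (fun t t01 => cc s2 t (c2 t t01)) PE.
by rewrite !scale0r !addr0 !scale1r; apply.
Qed.

Lemma sheet_nbhs q r (N : set Sigma) (s : V -> Sigma) : 0 < r -> open N -> N q ->
  (forall p p', N p -> N p' -> Phi p = Phi p' -> p = p') ->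
  (forall y, `|y - Phi q| < r -> [/\ N (s y), Phi (s y) = y & {for y, continuous s}]) ->
  \forall p \near q, `|Phi p - Phi q| < r /\ s (Phi p) = p.
Proof.
move=> r0 oN Nq inj sP.
have H1 : \forall p' \near q, N p' by apply: open_nbhs_nbhs.
have H2 : \forall p' \near q, `|Phi q - Phi p'| < r.
  by have := lewy_continuous sc (q := q); move/cvgrPdist_lt; apply.
apply: filterS2 H1 H2 => p Np pr; rewrite distrC in pr; split=> //.
by have [Ns sE _] := sP _ pr; exact: inj.
Qed.

Variable q0 : Sigma.
Let b0 := Phi q0.
Let ray (w : V) (t : R) : V := b0 + t *: (w - b0).

(** Star-shapedness about [b0] lets two such sections be compared along rays from [b0], where both
    take the value [q0]; they agree on common points and glue to a largest one. *)
Definition is_lift (O : set V) (s : V -> Sigma) := [/\ open O, O b0,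
  forall w t, O w -> 0 <= t <= 1 -> O (ray w t),
  forall w, O w -> {for w, continuous s} /\ Phi (s w) = w & s b0 = q0].

Let ray1 w : ray w 1 = w.
Proof. by rewrite /ray scale1r addrC subrK. Qed.

Lemma lift_exists : exists O s, is_lift O s.
Proof.
have [r [N [s [r0 oN Nq inj sP]]]] := local_section sc g_convex q0.
exists [set w | `|w - b0| < r], s; split.
- rewrite [X in open X](_ : _ = ball b0 r); first exact: ball_open.
  by apply/seteqP; split => y; rewrite -ball_normE /= distrC.
- by rewrite /= subrr normr0.
- move=> w t wr t01 /=; apply: ball_segment => //.
  by rewrite subrr normr0.
- by move=> w /sP[].
- have q0r : `|Phi q0 - Phi q0| < r by rewrite subrr normr0.
  by have [Ns sE _] := sP _ q0r; exact: inj.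
Qed.

Lemma lift_agree O1 s1 O2 s2 w : is_lift O1 s1 -> is_lift O2 s2 -> O1 w -> O2 w ->
  s1 w = s2 w.
Proof.
move=> [_ _ star1 P1 e1] [_ _ star2 P2 e2] w1 w2.
rewrite -(ray1 w) /ray scale1r; apply: section_unique.
- by move=> t t01; have [] := P1 _ (star1 w t w1 t01).
- by move=> t t01; have [] := P2 _ (star2 w t w2 t01).
- move=> t t01; have [_ ->] := P1 _ (star1 w t w1 t01).
  by have [_ ->] := P2 _ (star2 w t w2 t01).
- by rewrite e1 e2.
Qed.

Definition lift_dom : set V := [set w | exists O s, is_lift O s /\ O w].
(** By [lift_agree] the value does not depend on the section chosen; [q0] is the default outside
    [lift_dom]. *)
Definition lift (w : V) : Sigma :=
  xget q0 [set q | exists O s, [/\ is_lift O s, O w & s w = q]].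

Lemma liftE O s w : is_lift O s -> O w -> lift w = s w.
Proof.
move=> Ls Ow; rewrite /lift; case: xgetP => [q|/(_ (s w))].
  by move=> _ [D2 [s2 [Ls2 D2w <-]]]; exact: lift_agree Ls2 Ls D2w Ow.
by move=> H; exfalso; apply: H; exists O, s.
Qed.

Lemma lift_is_lift : is_lift lift_dom lift.
Proof.
split.
- rewrite openE => w [D [s [Ls Dw]]].
  have [oD _ _ _ _] := Ls.
  have : \forall y \near w, D y by apply: open_nbhs_nbhs.
  by apply: filterS => y Dy; exists D, s.
- by have [D [s Ls]] := lift_exists; exists D, s; split=> //; case: Ls.
- move=> w t [D [s [Ls Dw]]] t01; exists D, s; split=> //.
  by have [_ _ star _ _] := Ls; exact: star.
- move=> w [D [s [Ls Dw]]].
  have [oD _ _ P _] := Ls; have [cs sE] := P w Dw.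
  split; last by rewrite (liftE Ls Dw).
  have nE : {near w, s =1 lift}.
    have : \forall y \near w, D y by apply: open_nbhs_nbhs.
    by apply: filterS => y Dy; rewrite (liftE Ls Dy).
  exact: near_eq_continuous nE cs.
- have [D [s Ls]] := lift_exists.
  by have [_ D0 _ _ e] := Ls; rewrite (liftE Ls D0).
Qed.

End global_section.

(** * Completeness makes the section global *)

Section completeness.
Context {R : realType} {Sigma : orientedSurface R}.
Local Notation V := 'rV[R]_2.
Implicit Types (c d : chart Sigma) (p q : Sigma) (u v w : V).
Variables (g : Sigma -> 'M[R]_2) (x1 x2 z p1 p2 : Sigma -> R^o).
Hypothesis sc : special_coordinates g x1 x2 z p1 p2.
Hypothesis g_convex : positive_definite g.
Hypothesis g_complete : complete_metric g.
Local Notation Phi := (lewy x1 x2 p1 p2).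
Variable q0 : Sigma.
Let b0 := Phi q0.
Local Notation dom := (lift_dom x1 x2 p1 p2 q0).
Local Notation lift := (lift x1 x2 p1 p2 q0).
Local Notation is_lift := (is_lift x1 x2 p1 p2 q0).

Let ray (w : V) (t : R) : V := b0 + t *: (w - b0).

Let dom_open : open dom.
Proof. by have [] := lift_is_lift sc g_convex q0. Qed.

Let dom0 : dom b0.
Proof. by have [] := lift_is_lift sc g_convex q0. Qed.

Let dom_star w t : dom w -> 0 <= t <= 1 -> dom (ray w t).
Proof. by have [_ _ star _ _] := lift_is_lift sc g_convex q0; exact: star. Qed.

Let lift_cont w : dom w -> {for w, continuous lift}.
Proof. by have [_ _ _ P _] := lift_is_lift sc g_convex q0; move=> /P[]. Qed.

Let lift_section w : dom w -> Phi (lift w) = w.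
Proof. by have [_ _ _ P _] := lift_is_lift sc g_convex q0; move=> /P[]. Qed.

Let lift0 : lift b0 = q0.
Proof. by have [] := lift_is_lift sc g_convex q0. Qed.

Let rayD w a t : ray w (a + t) = ray w a + t *: (w - b0).
Proof. by rewrite /ray scalerDl addrA. Qed.

Lemma invS_small (e : R) : 0 < e -> exists N : nat, forall n : nat,
  (N <= n)%N -> n.+1%:R^-1 < e.
Proof.
move=> e0; have [N _ HN] := near_infty_natSinv_lt (PosNum e0).
by exists N => n; exact: HN.
Qed.

Section extension.
Variable w : V.
Hypothesis ray_dom : forall t : R, 0 <= t < 1 -> dom (ray w t).

(** Parameters increasing to 1; the shifted index starts them at 0 and keeps them below 1. *)
Let tn (n : nat) : R := 1 - n.+1%:R^-1.

Let tn01 n : 0 <= tn n < 1.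
Proof.
by rewrite /tn subr_ge0 invf_le1 // ler1n /= ltrBlDr ltrDl invr_gt0 ltr0n.
Qed.

Let lift_ray_dist (a b : R) : 0 <= a < 1 -> 0 <= b < 1 ->
  (riemannian_dist g (lift (ray w a)) (lift (ray w b)) <= (2 * (`|b - a| * `|w - b0|))%:E)%E.
Proof.
move=> /andP[a0 a1] /andP[b0' b1].
have seg (t : R) : 0 <= t <= 1 -> dom (ray w a + t *: ((b - a) *: (w - b0))).
  move=> /andP[t0 t1]; rewrite scalerA -rayD; apply: ray_dom.
  by apply/andP; split; have [ab|ab] := leP a b; nra.
have [l lle pl] := lifted_segment_length sc g_convex dom_open lift_cont lift_section seg.
move: pl; rewrite -rayD (addrC a) subrK => pl.
apply: (@le_trans _ _ l%:E); last by rewrite lee_fin -normrZ.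
by apply: ereal_inf_lbound; exists l.
Qed.

Let tn_dist N m n : (N <= m)%N -> (N <= n)%N -> `|tn m - tn n| < N.+1%:R^-1.
Proof.
move=> Nm Nn.
have H k : (N <= k)%N -> 0 < k.+1%:R^-1 :> R /\ k.+1%:R^-1 <= N.+1%:R^-1 :> R.
  by move=> Nk; split; [rewrite invr_gt0 ltr0n|rewrite lef_pV2 ?posrE ?ltr0n // ler_nat ltnS].
have [m0 m1] := H m Nm; have [n0 n1] := H n Nn.
rewrite /tn; move: (m.+1%:R^-1) (n.+1%:R^-1) (N.+1%:R^-1) m0 m1 n0 n1 => a b k *.
by rewrite ltr_norml; apply/andP; split; lra.
Qed.

Let limit_point : exists q, forall N, nbhs q N ->
  exists M : nat, forall n : nat, (M <= n)%N -> N (lift (ray w (tn n))).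
Proof.
have [|q Hq] := @g_complete (fun n => lift (ray w (tn n))).
  (* The summand 1 keeps [C] positive when the ray is constant. *)
  move=> e e0; pose C := 2 * (`|w - b0| + 1).
  have C0 : 0 < C by rewrite mulr_gt0 // ltr_wpDl.
  have [N HN] := invS_small (divr_gt0 e0 C0); exists N => m n Nm Nn.
  apply: (le_lt_trans (lift_ray_dist (tn01 m) (tn01 n))); rewrite lte_fin.
  have := tn_dist Nn Nm; have := HN N (leqnn N).
  rewrite ltr_pdivlMr // /C; move: (`|tn n - tn m|) (normr_ge0 (tn n - tn m)) => x x0.
  have := normr_ge0 (w - b0); move: `|w - b0| (N.+1%:R^-1) => h k h0 k1 k2.
  by nra.
exists q => N /(riemannian_dist_nbhs sc g_convex)[e e0 He].
by have [M HM] := Hq e e0; exists M => n Mn; apply: He; exact: HM.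
Qed.

Let ray_tn_near (e : R) : 0 < e -> exists M : nat, forall n : nat, (M <= n)%N ->
  `|ray w (tn n) - w| < e.
Proof.
move=> e0; have h1 : 0 < `|w - b0| + 1 by rewrite ltr_wpDl.
have [M HM] := invS_small (divr_gt0 e0 h1); exists M => n Mn.
have -> : ray w (tn n) - w = - (n.+1%:R^-1 *: (w - b0)).
  rewrite /ray /tn scalerBl scale1r addrA (addrC b0) subrK addrAC subrr add0r.
  by [].
rewrite normrN normrZ ger0_norm ?invr_ge0 //.
have := HM n Mn; rewrite ltr_pdivlMr //.
have : 0 < n.+1%:R^-1 :> R by rewrite invr_gt0.
move: (n.+1%:R^-1) `|w - b0| => x y x0; lra.
Qed.

(** A local section around the limit point [q] covers a ball about [w] and coincides with the lift
    near some [cc] late on the ray. Gluing the two gives a lift whose domain contains [w], and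
    [lift_dom] contains every such domain. *)
Lemma lift_extend : dom w.
Proof.
have [q Hq] := limit_point.
have Pq : Phi q = w.
  apply/eqP; rewrite -subr_eq0 -normr_le0 leNgt; apply/negP => pos.
  have e2 : 0 < `|Phi q - w| / 2 by rewrite divr_gt0.
  have [M1 H1] := ray_tn_near e2.
  have [M2 H2] := Hq [set p | `|Phi q - Phi p| < `|Phi q - w| / 2]
    ((cvgrPdist_lt _ _).1 (lewy_continuous sc (q := q)) _ e2).
  have h1 := H1 _ (leq_maxl M1 M2); have /= h2 := H2 _ (leq_maxr M1 M2).
  rewrite lift_section in h2; last exact: ray_dom.
  have : `|Phi q - w| <= `|Phi q - ray w (tn (maxn M1 M2))| + `|ray w (tn (maxn M1 M2)) - w|.
    by rewrite -[X in `|X| <= _](subrKA (ray w (tn (maxn M1 M2)))) ler_normD.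
  by move: h1 h2; move: `|_| `|_| `|_| => x y z' *; lra.
have [r [N [s [r0 oN Nq inj sP]]]] := local_section sc g_convex q.
have shn := sheet_nbhs sc r0 oN Nq inj sP; rewrite Pq in sP shn.
have [M HM] := Hq _ shn; have [/= cr sc_eq] := HM M (leqnn M).
set tau := tn M in cr sc_eq; set cc := ray w tau in cr sc_eq.
have tau01 := tn01 M; rewrite -/tau in tau01.
have domc : dom cc by exact: ray_dom.
rewrite lift_section // in cr sc_eq.
have [e e0 He] : exists2 e : R, 0 < e & forall y, `|y - cc| < e -> dom y /\ `|y - w| < r.
  have H1 : \forall y \near cc, dom y by apply: open_nbhs_nbhs.
  have [e1 /= e10 He1] := (nbhs_ballP _ _).1 H1.
  exists (Num.min e1 (r - `|cc - w|)); first by rewrite lt_min e10 subr_gt0.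
  move=> y; rewrite lt_min => /andP[y1 y2]; split.
    by apply: He1; rewrite -ball_normE /= distrC.
  have -> : y - w = (y - cc) + (cc - w) by rewrite addrA subrK.
  by rewrite (le_lt_trans (ler_normD _ _)) // -ltrBrDr.
have agree_c y : `|y - cc| < e -> lift y = s y.
  move=> ye; have -> : y = cc + (y - cc) by rewrite addrC subrK.
  have seg (t : R) : 0 <= t <= 1 -> `|cc + t *: (y - cc) - cc| < e.
    by move=> t01; apply: ball_segment => //; rewrite subrr normr0.
  apply: (section_unique sc g_convex).
  - by move=> t /seg /He[dt _]; exact: lift_cont.
  - by move=> t /seg /He[_ tr]; have [] := sP _ tr.
  - move=> t /seg /He[dt tr]; rewrite (lift_section dt).
    by have [_ -> _] := sP _ tr.
  - by rewrite sc_eq.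
(* Adding a whole ball about [w] might destroy star-shapedness or meet [dom] in pieces. Requiring
   the ray of [y] to cross the small ball about [cc] settles both: the two sections agree there,
   hence along the segment from there to [y]. *)
pose T := [set y : V | `|y - w| < r /\ exists2 t : R, 0 <= t <= 1 & `|ray y t - cc| < e].
have T_open : open T.
  rewrite openE => y [yr [t t01 yt]].
  pose dd := Num.min (r - `|y - w|) (e - `|ray y t - cc|).
  have d0 : 0 < dd by rewrite lt_min !subr_gt0 yr.
  apply/nbhs_ballP; exists dd => // y'; rewrite -ball_normE /= distrC lt_min => /andP[y1 y2].
  split.
    have -> : y' - w = (y' - y) + (y - w) by rewrite addrA subrK.
    by rewrite (le_lt_trans (ler_normD _ _)) // -ltrBrDr.
  exists t => //; have -> : ray y' t - cc = t *: (y' - y) + (ray y t - cc).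
    rewrite addrA; congr (_ - _); rewrite /ray addrCA -scalerDr addrA subrK.
    by [].
  rewrite (le_lt_trans (ler_normD _ _)) // -ltrBrDr (le_lt_trans _ y2) //.
  by case/andP: t01 => t0 t1; rewrite normrZ ger0_norm // ler_piMl.
have agree_T y : T y -> dom y -> lift y = s y.
  move=> [yr [t t01 yt]] dy.
  have -> : y = ray y t + (1 - t) *: (y - b0).
    by rewrite -rayD addrC subrK /ray scale1r addrC subrK.
  have seg (t' : R) : 0 <= t' <= 1 -> ray y t + t' *: ((1 - t) *: (y - b0)) = ray y (t + t' * (1 - t)).
    by move=> _; rewrite scalerA -rayD.
  have seg1 (t' : R) : 0 <= t' <= 1 -> dom (ray y t + t' *: ((1 - t) *: (y - b0))).
    move=> t01'; rewrite seg //; apply: dom_star => //.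
    by case/andP: t01 => ? ?; case/andP: t01' => ? ?; apply/andP; split; nra.
  have seg2 (t' : R) : 0 <= t' <= 1 -> `|ray y t + t' *: ((1 - t) *: (y - b0)) - w| < r.
    move=> t01'.
    have -> : (1 - t) *: (y - b0) = y - ray y t.
      by rewrite /ray scalerBl scale1r opprD addrA.
    apply: ball_segment => //; exact: (He _ yt).2.
  apply: (section_unique sc g_convex).
  - by move=> t' /seg1; exact: lift_cont.
  - by move=> t' /seg2 tr; have [] := sP _ tr.
  - move=> t' t01'; rewrite (lift_section (seg1 _ t01')).
    by have [_ -> _] := sP _ (seg2 _ t01').
  - exact: agree_c.
pose s' y := if pselect (dom y) then lift y else s y.
have s'dom y : dom y -> s' y = lift y by rewrite /s'; case: pselect.
have s'T y : T y -> s' y = s y.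
  by move=> Ty; rewrite /s'; case: pselect => // dy; exact: agree_T.
have L : is_lift (dom `|` T) s'.
  split.
  - exact: openU.
  - by left.
  - move=> y t' [dy|[yr [t t01 yt]]] t01'; first by left; exact: dom_star.
    case/andP: (t01) => t0 t1; case/andP: (t01') => t0' t1'.
    change ((dom `|` T) (ray y t')).
    have rr a b : ray (ray y a) b = ray y (b * a).
      by rewrite /ray [X in b *: X]addrAC subrr add0r scalerA.
    (* Before the crossing parameter [t] the point lies on the ray to a point of [dom]; after it,
       convexity keeps the point in the ball about [w], and its ray still crosses near [cc]. *)
    have [tt|tt] := leP t t'; last first.
      left; have tn0 : t != 0 by rewrite gt_eqF // (le_lt_trans t0').
      have -> : ray y t' = ray (ray y t) (t' / t) by rewrite rr divfK.
      apply: dom_star; first exact: (He _ yt).1.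
      by rewrite divr_ge0 // ler_pdivrMr ?mul1r ?ltW // lt_def tn0.
    right; split.
      have [t1e|t1n] := eqVneq t 1.
        by have -> : t' = 1; [lra|rewrite /ray scale1r (addrC b0) subrK].
      have t1n0 : 1 - t != 0 by rewrite subr_eq0 eq_sym.
      have -> : ray y t' = ray y t + ((t' - t) / (1 - t)) *: (y - ray y t).
        have -> : y - ray y t = (1 - t) *: (y - b0).
          by rewrite /ray scalerBl scale1r opprD addrA.
        by rewrite scalerA divfK // -rayD addrC subrK.
      apply: ball_segment => //; first exact: (He _ yt).2.
      have t1l : 0 < 1 - t by rewrite lt_def t1n0 subr_ge0.
      rewrite divr_ge0 ?subr_ge0 //= ler_pdivrMr // mul1r; lra.
    (* At this parameter the ray to [ray y t'] reaches [ray y t]. If [t' = 0] then [t = 0] too, and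
       the quotient is 0 by convention. *)
    exists (t / t').
      have [->|tn0] := eqVneq t' 0; first by rewrite invr0 mulr0 lexx ler01.
      by rewrite divr_ge0 //= ler_pdivrMr ?mul1r // lt_def tn0.
    rewrite rr; have [t0e|tn0] := eqVneq t' 0; last by rewrite divfK.
    by have te : t = 0; [lra|rewrite te mul0r mul0r -te].
  - move=> y [dy|Ty].
      split; last by rewrite s'dom // lift_section.
      have nE : {near y, lift =1 s'}.
        have : \forall y' \near y, dom y' by apply: open_nbhs_nbhs.
        by apply: filterS => y' dy'; rewrite s'dom.
      exact: near_eq_continuous nE (lift_cont dy).
    have [Ns sE scy] := sP _ Ty.1.
    split; last by rewrite s'T.
    have nE : {near y, s =1 s'}.
      have : \forall y' \near y, T y' by apply: open_nbhs_nbhs.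
      by apply: filterS => y' Ty'; rewrite s'T.
    exact: near_eq_continuous nE scy.
  - by rewrite s'dom.
exists (dom `|` T), s'; split=> //; right; split; first by rewrite subrr normr0.
exists tau; first by case/andP: tau01 => h1 h2; rewrite h1 ltW.
by rewrite subrr normr0.
Qed.

End extension.

(** Continuity method on the ray to [w]: the supremum of the parameters reached is itself reached,
    by [lift_extend], and openness of the domain lets it be exceeded unless it is 1. *)
Lemma lift_dom_total w : dom w.
Proof.
have [//|ndw] := pselect (dom w); exfalso.
have ray1 : ray w 1 = w by rewrite /ray scale1r (addrC b0) subrK.
have ray0 : ray w 0 = b0 by rewrite /ray scale0r addr0.
have rr a b : ray (ray w a) b = ray w (b * a).
  by rewrite /ray [X in b *: X]addrAC subrr add0r scalerA.
pose T := [set t : R | 0 <= t <= 1 /\ dom (ray w t)].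
have T0 : T 0 by split; [rewrite lexx ler01|rewrite ray0].
have hs : has_sup T by split; [exists 0|exists 1 => t [/andP[]]].
pose m := sup T.
have m0 : 0 <= m by exact: (ub_le_sup hs.2 T0).
have m1 : m <= 1 by apply: ge_sup; [exact: hs.1|move=> t [/andP[]]].
have below t : 0 <= t < m -> dom (ray w t).
  move=> /andP[t0 tm].
  have [t' [/andP[t0' t1'] dt'] tt'] : exists2 t', T t' & t < t'.
    have := @sup_adherent R T (m - t); rewrite subr_gt0 tm => /(_ isT hs)[t' Tt' H].
    by exists t' => //; move: H; rewrite -/m; lra.
  have tn0 : t' != 0 by rewrite gt_eqF // (le_lt_trans t0).
  have -> : ray w t = ray (ray w t') (t / t') by rewrite rr divfK.
  apply: dom_star => //; rewrite divr_ge0 //= ler_pdivrMr ?mul1r ?ltW //.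
  exact: le_lt_trans t0 tt'.
have dm : dom (ray w m).
  apply: lift_extend => t /andP[t0 t1].
  change (dom (ray (ray w m) t)); rewrite rr.
  have [->|mn0] := eqVneq m 0; first by rewrite mulr0 ray0.
  by apply: below; rewrite mulr_ge0 //= gtr_pMl // lt_def mn0.
have m_lt1 : m < 1.
  by rewrite lt_def m1 andbT; apply/eqP => m1e; apply: ndw; rewrite -ray1 m1e.
have : \forall y \near ray w m, dom y by apply: open_nbhs_nbhs.
move=> /nbhs_ballP[e /= e0 He].
pose d := Num.min (1 - m) (e / (`|w - b0| + 1)) / 2.
have h1 : 0 < `|w - b0| + 1 by rewrite ltr_wpDl.
have M0 : 0 < Num.min (1 - m) (e / (`|w - b0| + 1)) by rewrite lt_min subr_gt0 m_lt1 divr_gt0.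
have d0 : 0 < d by rewrite /d divr_gt0.
have : d < Num.min (1 - m) (e / (`|w - b0| + 1)) by rewrite /d; lra.
rewrite lt_min => /andP[d1 d2].
have : T (m + d).
  split; first by apply/andP; split; lra.
  apply: He; rewrite -ball_normE /= rayD opprD addrA subrr sub0r normrN normrZ gtr0_norm //.
  by move: d2; rewrite ltr_pdivlMr //; move: `|w - b0| => x; lra.
by move=> /(ub_le_sup hs.2); rewrite -/m; lra.
Qed.

Lemma lift_continuous : continuous lift.
Proof. by move=> w; exact: lift_cont (lift_dom_total w). Qed.

Lemma lewy_lift w : Phi (lift w) = w.
Proof. exact: lift_section (lift_dom_total w). Qed.

(** The range is open by local injectivity of [Phi]. It is closed because a sheet around a limit
    point [q] contains a point of the range, from which the lift and the local section agree along
    the segment to [Phi q]. *)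
Lemma lift_surj : connected [set: Sigma] -> forall q, exists w, lift w = q.
Proof.
move=> conn.
pose A := range lift.
have sheet_lift q w : A q -> \forall p \near q, A p.
  move=> [y _ yE].
  have [r [N [s [r0 oN Nq inj sP]]]] := local_section sc g_convex q.
  have H1 : \forall p \near q, N p by apply: open_nbhs_nbhs.
  have H2 : \forall p \near q, N (lift (Phi p)).
    have : \forall v \near Phi q, N (lift v).
      by apply: lift_continuous; rewrite -yE lewy_lift yE; apply: open_nbhs_nbhs.
    exact: (lewy_continuous sc).
  apply: filterS2 H1 H2 => p Np Nl; exists (Phi p) => //.
  by apply: inj => //; rewrite lewy_lift.
have oA : open A by rewrite openE => q Aq; exact: sheet_lift.
have cA : closed A.
  move=> q clq.
  have [r [N [s [r0 oN Nq inj sP]]]] := local_section sc g_convex q.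
  have shn := sheet_nbhs sc r0 oN Nq inj sP.
  have [_ [[y _ <-] [yr yE]]] := clq _ shn; rewrite lewy_lift in yr yE.
  exists (Phi q) => //.
  have -> : Phi q = y + (Phi q - y) by rewrite addrC subrK.
  have qr : `|Phi q - Phi q| < r by rewrite subrr normr0.
  have seg (t : R) : 0 <= t <= 1 -> `|y + t *: (Phi q - y) - Phi q| < r.
    by move=> t01; exact: ball_segment.
  have -> : lift (y + (Phi q - y)) = s (y + (Phi q - y)).
    apply: (section_unique sc g_convex) => [t _|t /seg tr|t /seg tr|].
    - exact: lift_continuous.
    - by have [] := sP _ tr.
    - by rewrite lewy_lift; have [_ -> _] := sP _ tr.
    - by rewrite yE.
  rewrite addrC subrK; have [Ns sE _] := sP _ qr; exact: inj.
have AT : A = setT.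
  apply: conn; first by exists q0; exists b0 => //; exact: lift0.
    by exists A => //; rewrite setTI.
  by exists A => //; rewrite setTI.
by move=> q; have : setT q by []; rewrite -AT => -[w _ <-]; exists w.
Qed.

End completeness.

(** * Rigidity *)

Section quadratic_potential.
Context {R : realType}.
Local Notation V := 'rV[R]_2.

Let is_diff_cst0 (F : V -> R^o) (dF : V -> V -> R) :
  (forall w : V, is_diff w F (dF w)) -> (forall w v, dF w v = 0) -> forall w, F w = F 0.
Proof.
move=> FD F0 w; apply: diff0_cst => [w1|w1 v]; first by have [] := FD w1.
by have [_ ->] := FD w1; exact: F0.
Qed.

Let is_diff_coord (i : 'I_2) (w : V) : is_diff w (fun v : V => v 0 i : R^o) (fun v => v 0 i).
Proof.
apply: DiffDef; first exact: differentiable_coord.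
have [did eid] := is_diff_id w.
by apply/funext => v; apply: (etrans (diff_coord i v did)); rewrite eid.
Qed.

Let affine_of_diff (F : V -> R^o) (a b : R) :
  (forall w : V, is_diff w F (fun v => a * v 0 0 + b * v 0 1)) ->
  forall w, F w = a * w 0 0 + b * w 0 1 + F 0.
Proof.
move=> FD w; pose L : V -> R^o := fun w => a * w 0 0 + b * w 0 1.
have DL w1 : is_diff w1 (F - L) (fun v => a * v 0 0 + b * v 0 1 - (a * v 0 0 + b * v 0 1)).
  exact: (is_diffB (FD w1) (is_diffD (is_diffZ a (is_diff_coord 0 w1))
    (is_diffZ b (is_diff_coord 1 w1)))).
have : F w - L w = F 0 - L 0 := is_diff_cst0 DL (fun _ _ => subrr _) w.
by rewrite /L !mxE !mulr0 addr0 subr0 => <-; rewrite addrC subrK.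
Qed.

(** The product rule for [theta], with [y1], [y2] the derivatives of [X1], [X2]: all terms in them
    cancel. *)
Let theta_arith (x1 x2 y1 y2 w1 w2 v1 v2 : R) :
  x1 * v1 + w1 * y1 + (x2 * v2 + w2 * y2)
    - (2^-1 * (x1 * y1 + x1 * y1 + (x2 * y2 + x2 * y2))
       + ((w1 - x1) * y1 + (w2 - x2) * y2)) = x1 * v1 + x2 * v2.
Proof.
by field.
Qed.

Let gram_bound (a b d : R) : 0 < a -> 0 < d -> a + d = 1 -> 0 < a * d - b * b ->
  [/\ `|a| <= 1, `|b| <= 1 & `|d| <= 1].
Proof.
move=> a0 d0 ad D0; have b2 : b * b <= 1 by nra.
split; rewrite ler_norml; apply/andP; split; nra.
Qed.

Variables X1 X2 Z : V -> R^o.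
Hypothesis gradient : forall w, exists m11 m12 m22 : R,
  [/\ 0 < m11, 0 < m22, m11 + m22 = 1, 0 < m11 * m22 - m12 * m12 &
    [/\ is_diff w X1 (fun v => m11 * v 0 0 + m12 * v 0 1),
      is_diff w X2 (fun v => m12 * v 0 0 + m22 * v 0 1) &
      is_diff w Z (fun v => (w 0 0 - X1 w) * (m11 * v 0 0 + m12 * v 0 1) +
        (w 0 1 - X2 w) * (m12 * v 0 0 + m22 * v 0 1))]].

Lemma gradient_affine : exists a b d : R,
  [/\ 0 < a, 0 < d, a + d = 1, 0 < a * d - b * b & forall w,
    [/\ X1 w = a * w 0 0 + b * w 0 1 + X1 0, X2 w = b * w 0 0 + d * w 0 1 + X2 0 &
      is_diff w Z (fun v => (w 0 0 - X1 w) * (a * v 0 0 + b * v 0 1) +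
        (w 0 1 - X2 w) * (b * v 0 0 + d * v 0 1))]].
Proof.
have [m11 /choice[m12 /choice[m22 m]]] := choice gradient.
have D1 w : is_diff w X1 (fun v => m11 w * v 0 0 + m12 w * v 0 1) by have [_ _ _ _ []] := m w.
have D2 w : is_diff w X2 (fun v => m12 w * v 0 0 + m22 w * v 0 1) by have [_ _ _ _ []] := m w.
(* |X|^2 / 2 + X . P - Z with P = w - X; its Laplacian is m11 + m22 = 1. *)
pose theta : V -> R^o := fun w => X1 w * w 0 0 + X2 w * w 0 1
  - (2^-1 * (X1 w * X1 w + X2 w * X2 w) + Z w).
have Dt w : is_diff w theta (fun v => X1 w * v 0 0 + X2 w * v 0 1).
  have [_ _ _ _ [_ _ DZ]] := m w.
  have Dl := is_diffD (is_diffM (D1 w) (is_diff_coord 0 w)) (is_diffM (D2 w) (is_diff_coord 1 w)).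
  have Dq := is_diffZ 2^-1 (is_diffD (is_diffM (D1 w) (D1 w)) (is_diffM (D2 w) (D2 w))).
  have [dt et] := is_diffB Dl (is_diffD Dq DZ).
  apply: DiffDef; first exact: dt.
  apply: (etrans et); apply/funext => v; exact: theta_arith.
have cst : forall w, [/\ m11 w = m11 0, m12 w = m12 0 & m22 w = m22 0].
  apply: (@gradient_matrix_cst R X1 X2 theta) => [w|w|w|w v|w v|w v|w|w].
  - by have [] := D1 w.
  - by have [] := D2 w.
  - by have [] := Dt w.
  - by have [_ ->] := Dt w.
  - by have [_ ->] := D1 w.
  - by have [_ ->] := D2 w.
  - by have [] := m w.
  - by have [m1 m2 tr det _] := m w; exact: gram_bound.
have [a0 d0 tr det _] := m 0.
exists (m11 0), (m12 0), (m22 0); split => // w; split.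
- by apply: affine_of_diff => y; have [<- <- _] := cst y.
- by apply: affine_of_diff => y; have [_ <- <-] := cst y.
- by have [<- <- <-] := cst w; have [_ _ _ _ []] := m w.
Qed.
Let quadratic_arith (a b d k1 k2 w1 w2 v1 v2 : R) : a * d - b * b != 0 ->
  let X1 := a * w1 + b * w2 + k1 in let X2 := b * w1 + d * w2 + k2 in
  let Y1 := a * v1 + b * v2 in let Y2 := b * v1 + d * v2 in
  let c1 := (b * k2 - d * k1) / (a * d - b * b) in
  let c2 := (b * k1 - a * k2) / (a * d - b * b) in
  (w1 - X1) * Y1 + (w2 - X2) * Y2 -
  2^-1 * ((w1 - X1 + c1) * Y1 + X1 * (v1 - Y1 + 0)
    + ((w2 - X2 + c2) * Y2 + X2 * (v2 - Y2 + 0))) = 0.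
Proof. by move=> D0 /=; field. Qed.

(** Inverting the affine relation gives [w = M^-1 X + c], so [w - X], the gradient of [Z] with
    respect to [X], is [H X + c] with [H = M^-1 - I]. Trace 1 yields
    [det H = (1 - tr M + det M) / det M = 1]. *)
Lemma potential_quadratic : exists h11 h12 h22 c1 c2 k : R,
  [/\ 0 < h11, h11 * h22 - h12 * h12 = 1,
    forall w w', X1 w = X1 w' -> X2 w = X2 w' -> w = w',
    forall y1 y2, exists w, X1 w = y1 /\ X2 w = y2 &
    forall w, Z w = 2^-1 * (h11 * X1 w ^+ 2 + 2 * h12 * X1 w * X2 w + h22 * X2 w ^+ 2)
      + c1 * X1 w + c2 * X2 w + k].
Proof.
have [a [b [d [a0 d0 tr det aff]]]] := gradient_affine.
have Dn0 := lt0r_neq0 det.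
pose k1 := X1 0; pose k2 := X2 0.
(* These are the components of [- M^-1 k], the constant term of [w] as an affine function of [X]. *)
pose c1 := (b * k2 - d * k1) / (a * d - b * b).
pose c2 := (b * k1 - a * k2) / (a * d - b * b).
have wE w : w = row2 ((d * X1 w - b * X2 w) / (a * d - b * b) + c1)
    ((a * X2 w - b * X1 w) / (a * d - b * b) + c2).
  have [-> -> _] := aff w; rewrite -/k1 -/k2 /c1 /c2.
  by apply: row2P; rewrite ?row2_0 ?row2_1; field.
have hD : d / (a * d - b * b) - 1 = (d * d + b * b) / (a * d - b * b).
  by rewrite -(divff Dn0) -mulrBl; congr (_ / _); rewrite (_ : a = 1 - d); [ring|lra].
(* As [w - X = H X + c], this is [X . H X / 2 + c . X], the expected quadratic part of [Z]. *)
pose Q : V -> R^o := fun w => 2^-1 * ((w 0 0 - X1 w + c1) * X1 w + (w 0 1 - X2 w + c2) * X2 w).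
have DX1 w : is_diff w X1 (fun v => a * v 0 0 + b * v 0 1).
  have [d1 e1] := is_diffD (is_diffD (is_diffZ a (is_diff_coord 0 w))
    (is_diffZ b (is_diff_coord 1 w))) (is_diff_cst k1 w).
  have -> : X1 = (fun w : V => a * w 0 0 + b * w 0 1 + k1 : R^o).
    by apply/funext => y; have [-> _ _] := aff y.
  apply: DiffDef; first exact: d1.
  by apply: (etrans e1); apply/funext => v; exact: addr0.
have DX2 w : is_diff w X2 (fun v => b * v 0 0 + d * v 0 1).
  have [d1 e1] := is_diffD (is_diffD (is_diffZ b (is_diff_coord 0 w))
    (is_diffZ d (is_diff_coord 1 w))) (is_diff_cst k2 w).
  have -> : X2 = (fun w : V => b * w 0 0 + d * w 0 1 + k2 : R^o).
    by apply/funext => y; have [_ -> _] := aff y.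
  apply: DiffDef; first exact: d1.
  by apply: (etrans e1); apply/funext => v; exact: addr0.
have QE w : Z w - Q w = Z 0 - Q 0.
  have DZ y : is_diff y Z (fun v => (y 0 0 - X1 y) * (a * v 0 0 + b * v 0 1) +
    (y 0 1 - X2 y) * (b * v 0 0 + d * v 0 1)) by have [] := aff y.
  pose dQ (y v : V) := 2^-1 *
   ((y 0 0 - X1 y + c1) * (a * v 0 0 + b * v 0 1) + X1 y * (v 0 0 - (a * v 0 0 + b * v 0 1) + 0)
    + ((y 0 1 - X2 y + c2) * (b * v 0 0 + d * v 0 1) + X2 y * (v 0 1 - (b * v 0 0 + d * v 0 1) + 0))).
  have DQ y : is_diff y Q (dQ y).
    exact: (is_diffZ 2^-1 (is_diffD
      (is_diffM (is_diffD (is_diffB (is_diff_coord 0 y) (DX1 y)) (is_diff_cst c1 y)) (DX1 y))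
      (is_diffM (is_diffD (is_diffB (is_diff_coord 1 y) (DX2 y)) (is_diff_cst c2 y)) (DX2 y)))).
  apply: (is_diff_cst0 (fun y => is_diffB (DZ y) (DQ y))) => y v.
  rewrite /dQ; have [-> -> _] := aff y; exact: quadratic_arith.
exists (d / (a * d - b * b) - 1), (- b / (a * d - b * b)), (a / (a * d - b * b) - 1),
  c1, c2, (Z 0 - Q 0); split.
- by rewrite hD divr_gt0 // ltr_pwDl ?mulr_gt0 // -expr2 sqr_ge0.
- move: Dn0; have -> : d = 1 - a by lra.
  by move=> Dn0; field.
- by move=> w w' E1 E2; rewrite (wE w) (wE w') E1 E2.
- move=> y1 y2.
  exists (row2 ((d * y1 - b * y2) / (a * d - b * b) + c1)
    ((a * y2 - b * y1) / (a * d - b * b) + c2)).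
  set w := row2 _ _; have [-> -> _] := aff w.
  by rewrite -/k1 -/k2 /w row2_0 row2_1 /c1 /c2; split; field.
move=> w; rewrite -(QE w) /Q.
have := congr1 (fun y : V => y 0 0) (wE w); rewrite row2_0 => ->.
have := congr1 (fun y : V => y 0 1) (wE w); rewrite row2_1 => ->.
move: (X1 w) (X2 w) (Z w) => x1 x2 t.
by field.
Qed.

End quadratic_potential.

(** * Quadratic graphs as affine images of the standard paraboloid *)

Section affine_paraboloid.
Context {R : realType}.
Local Notation row3 x y z := (\row_(i < 3) [:: x; y; z]`_i).

Let matrix3P (A B : 'M[R]_3) : (forall i : 'I_3, row i A = row i B) -> A = B.
Proof. by move=> E; apply/row_matrixP. Qed.

Let rows3 (r0 r1 r2 : 'rV[R]_3) : 'M[R]_3 := \matrix_(i < 3) [:: r0; r1; r2]`_i.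

Let mul_rows3 (x y z : R) r0 r1 r2 :
  row3 x y z *m rows3 r0 r1 r2 = x *: r0 + y *: r1 + z *: r2.
Proof.
rewrite mulmx_sum_row !big_ord_recl big_ord0 addr0 addrA.
by rewrite !rowK !mxE.
Qed.

Let row3_lin (a b c : R) (x0 x1 x2 y0 y1 y2 z0 z1 z2 : R) :
  a *: row3 x0 x1 x2 + b *: row3 y0 y1 y2 + c *: row3 z0 z1 z2 =
  row3 (a * x0 + b * y0 + c * z0) (a * x1 + b * y1 + c * z1) (a * x2 + b * y2 + c * z2).
Proof.
by apply/rowP => i; rewrite !mxE; case: i => [[|[|[|//]]] ?].
Qed.

(** Completing the square diagonalizes the quadratic part, determinant 1 fixing the second pivot.
    The linear terms are absorbed by the last column of the matrix, the constant by the
    translation. *)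
Lemma quadratic_graph_paraboloid (h11 h12 h22 c1 c2 k : R) (A : 'M[R]_3) :
  0 < h11 -> h11 * h22 - h12 * h12 = 1 -> A \in unitmx ->
  exists (A' : 'M[R]_3) (b : 'rV[R]_3), A' \in unitmx /\
  range (fun y : 'rV[R]_2 => row3 (y 0 0) (y 0 1)
    (2^-1 * (h11 * y 0 0 ^+ 2 + 2 * h12 * y 0 0 * y 0 1 + h22 * y 0 1 ^+ 2)
      + c1 * y 0 0 + c2 * y 0 1 + k) *m A) =
  (fun x => x *m A' + b) @` standard_paraboloid.
Proof.
move=> h0 det Au; pose s := Num.sqrt h11.
have s0 : 0 < s by rewrite sqrtr_gt0.
have sn0 := lt0r_neq0 s0.
have hs : h11 = s ^+ 2 by rewrite sqr_sqrtr // ltW.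
have h22E : h22 = (1 + h12 * h12) / s ^+ 2.
  by rewrite -hs -det addrAC addrK mulrAC divff ?mul1r // lt0r_neq0.
(* (y1, y2, z) = (u1, u2, |u|^2 / 2) *m A1 + (0, 0, k), where H = L L^T for the
   lower triangular L = [[s, 0], [h12 / s, 1 / s]] and u = y L. *)
pose A1 := rows3 (row3 s^-1 0 (c1 / s)) (row3 (- h12 / s) s (c2 * s - c1 * h12 / s))
  (row3 0 0 1).
pose B1 := rows3 (row3 s 0 (- c1)) (row3 (h12 / s) s^-1 (- c2)) (row3 0 0 1).
have A1u : A1 \in unitmx.
  suff /mulmx1_unit[] : A1 *m B1 = 1%:M by [].
  apply: matrix3P => i; rewrite row_mul rowK row1.
  case: i => [[|[|[|//]]] ?] /=; rewrite mul_rows3 row3_lin; apply/rowP => j;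
    rewrite !mxE; case: j => [[|[|[|//]]] ?] /=; by field.
exists (A1 *m A), (row3 0 0 k *m A); split; first by rewrite unitmx_mul A1u.
have E (u : 'rV[R]_2) (y1 y2 : R) :
    y1 = (u 0 0 - h12 * u 0 1) / s -> y2 = s * u 0 1 ->
    row3 (u 0 0) (u 0 1) (2^-1 * (u 0 0 ^+ 2 + u 0 1 ^+ 2)) *m (A1 *m A) + row3 0 0 k *m A =
    row3 y1 y2 (2^-1 * (h11 * y1 ^+ 2 + 2 * h12 * y1 * y2 + h22 * y2 ^+ 2)
      + c1 * y1 + c2 * y2 + k) *m A.
  move=> -> ->; rewrite mulmxA -mulmxDl mul_rows3 row3_lin h22E hs.
  congr (_ *m _); apply/rowP => j.
  by rewrite !mxE; case: j => [[|[|[|//]]] ?] /=; field.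
apply/seteqP; split=> [_ [y _ <-]|_ [_ [u _ <-] <-]].
  pose u := row2 (s * y 0 0 + h12 / s * y 0 1) (y 0 1 / s).
  exists (row3 (u 0 0) (u 0 1) (2^-1 * (u 0 0 ^+ 2 + u 0 1 ^+ 2))); first by exists u.
  by apply: E; rewrite /u ?row2_0 row2_1; field.
exists (row2 ((u 0 0 - h12 * u 0 1) / s) (s * u 0 1)) => //.
by rewrite row2_0 row2_1; exact/esym/E.
Qed.

End affine_paraboloid.

Theorem corollary3p6 (R : realType) (Sigma : orientedSurface R)
    (psi xi : Sigma -> 'rV[R]_3)
    (nabla : (Sigma -> 'rV[R]_2) -> (Sigma -> 'rV[R]_2) -> Sigma -> 'rV[R]_2)
    (g S : Sigma -> 'M[R]_2) (tau : Sigma -> 'cV[R]_2)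
    (Sigma_neq0 : [set: Sigma] !=set0)
    (Sigma_connected : connected [set: Sigma])
    (psi_immersion : immersion psi)
    (xi_transversal : transversal_field psi xi)
    (psi_structure : gauss_weingarten psi xi nabla g S tau)
    (psi_convex : positive_definite g)
    (xi_affine_normal : affine_normal psi xi g tau)
    (psi_improper : forall p, S p = 0)
    (g_complete : complete_metric g) :
  elliptic_paraboloid psi.
Proof.
have [q0 _] := Sigma_neq0.
have [A [x1 [x2 [z [p1 [p2 [Au sc psiE]]]]]]] := special_coordinates_exist
  Sigma_connected psi_immersion.1 xi_transversal.1 psi_structure psi_convex
  xi_affine_normal psi_improper q0.
pose E := lift x1 x2 p1 p2 q0.
have EK w : lewy x1 x2 p1 p2 (E w) = w by exact: (lewy_lift sc psi_convex g_complete).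
have E_surj q : exists w, E w = q by exact: (lift_surj sc psi_convex g_complete).
(* Since [x + p] is [w] along [E], [p] can be eliminated, and the coordinates become functions of
   [w] to which the rigidity result applies. *)
have p1E w : p1 (E w) = w 0 0 - x1 (E w).
  by rewrite -[in w 0 0](EK w) row2_0 /lewy1 addrAC subrr add0r.
have p2E w : p2 (E w) = w 0 1 - x2 (E w).
  by rewrite -[in w 0 1](EK w) row2_1 /lewy2 addrAC subrr add0r.
have E_continuous w : {for w, continuous E}.
  exact: (lift_continuous sc psi_convex g_complete).
have E_section (w : 'rV[R]_2) : \forall y \near w, lewy x1 x2 p1 p2 (E y) = y.
  exact: (@filterE _ (nbhs w) _ _ EK).
have gradient w := section_gradient sc psi_convex (E_continuous w) (E_section w).
have [h11 [h12 [h22 [c1 [c2 [k [h0 det X_inj X_surj ZE]]]]]]] :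
  exists h11 h12 h22 c1 c2 k : R,
  [/\ 0 < h11, h11 * h22 - h12 * h12 = 1,
    forall w w', x1 (E w) = x1 (E w') -> x2 (E w) = x2 (E w') -> w = w',
    forall y1 y2, exists w, x1 (E w) = y1 /\ x2 (E w) = y2 &
    forall w, z (E w) = 2^-1 * (h11 * x1 (E w) ^+ 2 + 2 * h12 * x1 (E w) * x2 (E w)
      + h22 * x2 (E w) ^+ 2) + c1 * x1 (E w) + c2 * x2 (E w) + k].
  apply: (@potential_quadratic R (x1 \o E) (x2 \o E) (z \o E)) => w.
  have [m11 [m12 [m22 [m1 m2 tr dm [D1 D2 D3]]]]] := gradient w.
  exists m11, m12, m22; split=> //; split=> //.
  by rewrite /= -p1E -p2E.
split.
  move=> q q'; have [w <-] := E_surj q; have [w' <-] := E_surj q'.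
  rewrite !psiE => /(can_inj (mulmxK Au))/rowP eq_coord; congr E; apply: X_inj.
    by have := eq_coord 0; rewrite !mxE.
  by have := eq_coord 1; rewrite !mxE.
have [A' [b [A'u rangeE]]] := quadratic_graph_paraboloid c1 c2 k h0 det Au.
exists A', b; split=> //; rewrite -rangeE; apply/seteqP; split=> [_ [q _ <-]|_ [y _ <-]].
  have [w <-] := E_surj q; exists (row2 (x1 (E w)) (x2 (E w))) => //.
  by rewrite row2_0 row2_1 psiE ZE.
(* Every value of [(x1, x2)] is attained, so the image is the entire graph and not a piece of it. *)
have [w [<- <-]] := X_surj (y 0 0) (y 0 1).
by exists (E w) => //; rewrite psiE ZE.
Qed.
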